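(* Let $(N,\mathbb{R},\theta)$ be a centrally ergodic W* dynamical system where the von Neumann algebra $N$ is not a factor. Let $t$ be a nonzero real number. Denote by $\widetilde{\theta}$ the restriction of $\theta$ to the center $Z(N)$ of $N$, and by $\Lambda(\widetilde{\theta})$ the set of eigenvalues of $\widetilde{\theta}$. The following statements are equivalent. (1) The W* dynamical system $(N,\mathbb{Z},\theta_t)$ is not centrally ergodic. (2) The von Neumann algebra crossed product $N\rtimes_{\theta_t}\mathbb{Z}$ is not a factor. (3) There exists $(r,s)\in\mathbb{Q}\times\Lambda(\widetilde{\theta})$ such that $rst=2\pi$.
   Context: A W* dynamical system $(N,\mathbb{R},\theta)$ consists of a von Neumann algebra $N$ and a (pointwise $\sigma$-weakly continuous) one-parameter group $\theta=(\theta_t)_{t\in\mathbb{R}}$ of automorphisms of $N$. For fixed $t$, $(N,\mathbb{Z},\theta_t)$ denotes the W* dynamical system given by the $\mathbb{Z}$-action $n\mapsto\theta_t^n=\theta_{nt}$. An action is ergodic if its fixed-point algebra is $\mathbb{C}1$; an action on $N$ is centrally ergodic if its restriction to the center $Z(N)$ is ergodic. A real number $s$ is an eigenvalue of a one-parameter automorphism group $\theta$ of a von Neumann algebra if there is a nonzero element $a$ of that algebra with $\theta_t(a)=e^{ist}a$ for all $t\in\mathbb{R}$; the set of eigenvalues is denoted $\Lambda(\theta)$. *)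

(* Defs.v *)
From HB Require Import structures.
From mathcomp Require Import all_boot all_order all_algebra.
From mathcomp Require Import all_classical all_reals all_analysis.
From mathcomp Require Import complex ring.
Set Implicit Arguments.
Unset Strict Implicit.
Unset Printing Implicit Defensive.

Import Order.TTheory GRing.Theory Num.Theory.
Import numFieldNormedType.Exports.

Local Open Scope classical_set_scope.
Local Open Scope ring_scope.
(* The library puts the norm topology of a numeric field on its regular module;
   this makes it available on R[i] itself. *)
HB.instance Definition _ (R : rcfType) := NormedModule.copy R[i] (R[i])^o.

HB.mixin Record NormedModule_isHilbert (R : realType) H & NormedModule R[i] H := {
  inner : H -> H -> R[i];
  innerDl : forall x y z, inner (x + y) z = inner x z + inner y z;
  innerZl : forall a x z, inner (a *: x) z = a * inner x z;
  innerC : forall x y, inner x y = (inner y x)^*;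
  innerE : forall x, inner x x = `|x| ^+ 2 }.

#[short(type="hilbertType")]
HB.structure Definition Hilbert (R : realType) :=
  {H of CompleteNormedModule R[i] H & NormedModule_isHilbert R H}.

Section complex_series.
Context {R : realType}.
Local Notation C := R[i].

Lemma cvgC_ge0 (T : Type) (F : set_system T) {FF : ProperFilter F}
    (f : T -> C) (l : C) :
  f @ F --> l -> (\forall x \near F, 0 <= f x) -> 0 <= l.
Proof.
move=> fl f0; suff -> : l = `|l| by exact: normr_ge0.
apply: (cvg_unique _ fl); first exact: norm_hausdorff.
apply: cvg_trans (cvg_norm fl); apply: near_eq_cvg.
by near=> x; rewrite ger0_norm//; near: x.
Unshelve. all: by end_near. Qed.

Lemma cvgC_le (T : Type) (F : set_system T) {FF : ProperFilter F}
    (f : T -> C) (l M : C) :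
  f @ F --> l -> (\forall x \near F, f x <= M) -> l <= M.
Proof.
move=> fl fM; rewrite -subr_ge0.
apply: (@cvgC_ge0 _ F FF (fun x => M - f x)).
  by apply: cvgB; [exact: cvg_cst | exact: fl].
by apply: filterS fM => x; rewrite subr_ge0.
Qed.

Lemma cvg_conjC (T : Type) (F : set_system T) {FF : Filter F}
    (f : T -> C) (l : C) :
  f @ F --> l -> (f x)^* @[x --> F] --> l^*.
Proof.
move=> /cvgrPdist_le fl; apply/cvgrPdist_le => e /fl.
by apply: filterS => x; rewrite -rmorphB/= norm_conjC.
Qed.

Lemma cvg_realC (u : nat -> R) (l : R) :
  u @ \oo --> l -> (u n)%:C%C @[n --> \oo] --> (l%:C%C : C).
Proof.
move=> /cvgrPdist_le ul; apply/cvgrPdist_le => e e0.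
have re : e = (complex.Re e)%:C%C by rewrite RRe_real// gtr0_real.
have e1 : 0 < complex.Re e by move: e0; rewrite re ltcR.
have := ul _ e1; apply: filterS => n h.
by rewrite -rmorphB/= normc_def/= expr0n/= addr0 sqrtr_sqr re lecR.
Qed.

Lemma nneg_series_cvg (u : nat -> C) (M : C) :
  (forall n, 0 <= u n) -> (forall n, series u n <= M) -> cvgn (series u).
Proof.
move=> u0 uM; pose v n := complex.Re (u n).
have uv n : u n = (v n)%:C%C by rewrite /v RRe_real// ger0_real.
have v0 n : 0 <= v n by have := u0 n; rewrite uv lecR.
have suv : series u = (fun n => (series v n)%:C%C).
  apply/funext => n; rewrite /series/= rmorph_sum/=.
  by apply: eq_bigr => i _; exact: uv.
have vnd : {homo series v : n m / (n <= m)%N >-> n <= m}.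
  move=> n m nm; rewrite -subr_ge0 sub_series_geq//.
  by apply: sumr_ge0 => i _.
have vb : has_ubound (range (series v)).
  exists (complex.Re M) => _ [n _ <-].
  have := uM n; rewrite suv lecE/= => /andP[_].
  by [].
have := cvg_realC (nondecreasing_cvgn vnd vb).
by rewrite suv; apply: cvgP.
Qed.

Lemma nneg_series_le (u : nat -> C) : (forall n, 0 <= u n) ->
  cvgn (series u) -> forall n, series u n <= limn (series u).
Proof.
move=> u0 cu n; rewrite -subr_ge0.
apply: (@cvgC_ge0 _ \oo _ (fun m => series u m - series u n)).
  by apply: cvgB; [exact: cu | exact: cvg_cst].
exists n => // m /= nm; rewrite sub_series_geq//.
by apply: sumr_ge0.
Qed.

Lemma nneg_series_cvg_le (u v : nat -> C) :
  (forall n, 0 <= u n <= v n) -> cvgn (series v) -> cvgn (series u).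
Proof.
move=> uv cv; have u0 n : 0 <= u n by have /andP[] := uv n.
have v0 n : 0 <= v n by apply: le_trans (u0 n) _; have /andP[] := uv n.
apply: (@nneg_series_cvg _ (limn (series v))) => // n.
apply: le_trans (nneg_series_le v0 cv n).
by apply: ler_sum => i _; have /andP[] := uv i.
Qed.

End complex_series.

Section preinner.
Context {R : realType}.
Local Notation C := R[i].
Variables (V : lmodType C) (f : V -> V -> C).
Hypothesis fDl : forall x y z, f (x + y) z = f x z + f y z.
Hypothesis fZl : forall a x z, f (a *: x) z = a * f x z.
Hypothesis fC : forall x y, f x y = (f y x)^*.
Hypothesis f_ge0 : forall x, 0 <= f x x.
Hypothesis f_eq0 : forall x, f x x = 0 -> x = 0.

Lemma preinnerDr x y z : f z (x + y) = f z x + f z y.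
Proof. by rewrite fC fDl rmorphD/= -!fC. Qed.

Lemma preinnerZr a x z : f z (a *: x) = a^* * f z x.
Proof. by rewrite fC fZl rmorphM/= -fC. Qed.

Lemma preinner_normZ a x : sqrtC (f (a *: x) (a *: x)) = `|a| * sqrtC (f x x).
Proof.
rewrite fZl preinnerZr mulrA -normCK rootCMl ?exprn_ge0//.
by rewrite sqrCK.
Qed.

Lemma preinner_normD x y :
  sqrtC (f (x + y) (x + y)) <= sqrtC (f x x) + sqrtC (f y y).
Proof.
set a := sqrtC (f x x); set b := sqrtC (f y y).
have a0 : 0 <= a by rewrite sqrtC_ge0.
have b0 : 0 <= b by rewrite sqrtC_ge0.
have [->|nx] := eqVneq x 0.
  by rewrite add0r -/b lerDr.
have [->|ny] := eqVneq y 0.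
  by rewrite addr0 -/a lerDl.
have a1 : 0 < a.
  by rewrite lt_def a0 andbT sqrtC_eq0; apply: contra nx => /eqP/f_eq0/eqP.
have b1 : 0 < b.
  by rewrite lt_def b0 andbT sqrtC_eq0; apply: contra ny => /eqP/f_eq0/eqP.
rewrite -(@ler_pXn2r _ 2)// ?nnegrE ?sqrtC_ge0 ?addr_ge0// sqrtCK sqrrD.
rewrite fDl !preinnerDr (fC y x) /a /b !sqrtCK -/a -/b.
suff h : f x y + (f x y)^* <= a * b *+ 2.
  rewrite [leLHS](_ : _ = f x x + (f x y + (f x y)^*) + f y y); last first.
    by rewrite !addrA.
  by rewrite lerD2r lerD2l.
have := f_ge0 (b *: x + (- a) *: y).
rewrite !fDl !preinnerDr !fZl !preinnerZr (fC y x).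
have ar : a^* = a by apply: conj_Creal; exact: ger0_real.
have br : b^* = b by apply: conj_Creal; exact: ger0_real.
rewrite rmorphN/= ar br.
rewrite -[f x x]sqrtCK -[f y y]sqrtCK -/a -/b.
rewrite [X in 0 <= X -> _](_ : _ = a * b * (a * b *+ 2 - (f x y + (f x y)^*))).
  by rewrite pmulr_rge0 ?mulr_gt0// subr_ge0.
by move: (f x y) (f x y)^* => d d'; ring.
Qed.

End preinner.

Section inner_theory.
Context {R : realType} {H : hilbertType R}.
Implicit Types x y z : H.

Lemma innerDr x y z : inner z (x + y) = inner z x + inner z y.
Proof. exact: (preinnerDr innerDl innerC). Qed.

Lemma innerZr a x z : inner z (a *: x) = a^* * inner z x.
Proof. exact: (preinnerZr innerZl innerC). Qed.

Lemma norm_sqrD_le x y : `|x + y| ^+ 2 <= 2 * (`|x| ^+ 2 + `|y| ^+ 2).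
Proof.
apply: (@le_trans _ _ ((`|x| + `|y|) ^+ 2)).
  by rewrite ler_pXn2r ?nnegrE ?addr_ge0// ler_normD.
rewrite -subr_ge0 [X in 0 <= X](_ : _ = (`|x| - `|y|) ^+ 2); last by ring.
by apply: real_exprn_even_ge0 => //; rewrite rpredB// normr_real.
Qed.

Lemma polarization x y : inner x y =
  4%:R^-1 * (`|x + y| ^+ 2 - `|x + (-1) *: y| ^+ 2
    + 'i * `|x + 'i *: y| ^+ 2 - 'i * `|x + (- 'i) *: y| ^+ 2).
Proof.
rewrite -!innerE !(innerDl, innerDr, innerZl, innerZr).
rewrite !rmorphN rmorph1 /= !conjCi !opprK.
apply: (@mulfI _ 4%:R); first by rewrite pnatr_eq0.
rewrite mulVKf ?pnatr_eq0//.
have i2 : 'i * 'i = -1 :> R[i] by rewrite -expr2 sqrCi.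
move: (inner x x) (inner x y) (inner y x) (inner y y) => a b c d.
rewrite [RHS](_ : _ = 2 * b + 2 * c - 2 * ('i * 'i) * b + 2 * ('i * 'i) * c).
  by rewrite i2; ring.
by ring.
Qed.

End inner_theory.

Section l2.
Context {R : realType}.
Local Notation C := R[i].

(* Partial sums of a sum over Z; the limit is the sum of a whenever a is
   absolutely summable, which is the only case in which it is used. *)
Definition int_series (a : int -> C) : nat -> C :=
  series (fun n => a (Posz n) + a (Negz n)).

Lemma int_seriesD (a b : int -> C) :
  int_series (fun k => a k + b k) = (fun n => int_series a n + int_series b n).
Proof.
apply/funext => n; rewrite /int_series /series/= -big_split/=.
by apply: eq_bigr => i _; rewrite addrACA.
Qed.

Lemma int_seriesZ (c : C) (a : int -> C) :
  int_series (fun k => c * a k) = (fun n => c * int_series a n).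
Proof.
apply/funext => n; rewrite /int_series /series/= mulr_sumr.
by apply: eq_bigr => i _; rewrite mulrDr.
Qed.

Lemma is_cvg_int_seriesD (a b : int -> C) : cvgn (int_series a) ->
  cvgn (int_series b) -> cvgn (int_series (fun k => a k + b k)).
Proof.
move=> ca cb; rewrite int_seriesD; apply: is_cvgD; [exact: ca | exact: cb].
Qed.

Lemma lim_int_seriesD (a b : int -> C) : cvgn (int_series a) ->
  cvgn (int_series b) -> limn (int_series (fun k => a k + b k)) =
  limn (int_series a) + limn (int_series b).
Proof.
move=> ca cb; rewrite int_seriesD; apply: cvg_lim; first exact: norm_hausdorff.
by apply: cvgD; [exact: ca | exact: cb].
Qed.

Lemma is_cvg_int_seriesZ (c : C) (a : int -> C) : cvgn (int_series a) ->
  cvgn (int_series (fun k => c * a k)).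
Proof.
move=> ca; rewrite int_seriesZ; apply: is_cvgM; last exact: ca.
exact: is_cvg_cst.
Qed.

Lemma lim_int_seriesZ (c : C) (a : int -> C) : cvgn (int_series a) ->
  limn (int_series (fun k => c * a k)) = c * limn (int_series a).
Proof.
move=> ca; rewrite int_seriesZ; apply: cvg_lim; first exact: norm_hausdorff.
by apply: cvgM; [exact: cvg_cst | exact: ca].
Qed.

Lemma int_series_cvg_le (u v : int -> C) :
  (forall k, 0 <= u k <= v k) -> cvgn (int_series v) -> cvgn (int_series u).
Proof.
move=> uv; apply: nneg_series_cvg_le => n.
have /andP[u1 u2] := uv (Posz n); have /andP[u3 u4] := uv (Negz n).
by rewrite addr_ge0//= lerD.
Qed.

Lemma int_series_le (u : int -> C) : (forall k, 0 <= u k) ->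
  cvgn (int_series u) -> forall n, int_series u n <= limn (int_series u).
Proof. by move=> u0; apply: nneg_series_le => n; rewrite addr_ge0. Qed.

Lemma int_series_term_le (u : int -> C) : (forall k, 0 <= u k) ->
  cvgn (int_series u) -> forall k, u k <= limn (int_series u).
Proof.
move=> u0 cu k.
pose m := match k with Posz m => m | Negz m => m end.
apply: le_trans (int_series_le u0 cu m.+1).
rewrite /int_series /series/= big_nat_recr//=.
apply: (@le_trans _ _ (u (Posz m) + u (Negz m))).
  by rewrite /m; case: (k) => j; rewrite ?lerDl ?lerDr.
by rewrite lerDr; apply: sumr_ge0 => i _; rewrite addr_ge0.
Qed.

Lemma cvg_int_series (T : Type) (F : set_system T) {FF : Filter F}
    (u : T -> int -> C) (v : int -> C) (n : nat) :
  (forall k, u t k @[t --> F] --> v k) ->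
  int_series (u t) n @[t --> F] --> int_series v n.
Proof.
move=> uv; elim: n => [|n IH].
  rewrite (_ : (fun t => _) = fun=> 0).
    by rewrite /int_series /series/= big_geq//; exact: cvg_cst.
  by apply/funext => t; rewrite /int_series /series/= big_geq.
have E w : int_series w n.+1 = int_series w n + (w (Posz n) + w (Negz n)).
  by rewrite /int_series /series/= big_nat_recr.
rewrite E (_ : (fun t => _) = fun t =>
  int_series (u t) n + (u t (Posz n) + u t (Negz n))).
  by apply: cvgD; [exact: IH | apply: cvgD; exact: uv].
by apply/funext => t; rewrite E.
Qed.

Variable H : hilbertType R.
Implicit Types x y z : int -> H.

Definition square_summable x : Prop := cvgn (int_series (fun k => `|x k| ^+ 2)).

Lemma sqsumD x y : square_summable x -> square_summable y ->
  square_summable (x + y).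
Proof.
move=> cx cy.
apply: (@int_series_cvg_le _ (fun k => 2 * (`|x k| ^+ 2 + `|y k| ^+ 2))).
  by move=> k; rewrite exprn_ge0//= norm_sqrD_le.
by apply: is_cvg_int_seriesZ; apply: is_cvg_int_seriesD; [exact: cx|exact: cy].
Qed.

Lemma sqsumZ a x : square_summable x -> square_summable (a *: x).
Proof.
move=> cx; rewrite /square_summable.
rewrite [X in int_series X](_ : _ = fun k => `|a| ^+ 2 * `|x k| ^+ 2).
  by apply: is_cvg_int_seriesZ; exact: cx.
by apply/funext => k; rewrite -exprMn -normrZ.
Qed.

Lemma sqsum0 : square_summable 0.
Proof.
rewrite /square_summable [X in int_series X](_ : _ = fun=> 0).
  rewrite [int_series _](_ : _ = fun=> 0); first exact: is_cvg_cst.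
  apply/funext => n; rewrite /int_series /series/= big1// => i _.
  by rewrite addr0.
by apply/funext => k; rewrite normr0 expr0n.
Qed.

Lemma is_cvg_inner_series x y : square_summable x -> square_summable y ->
  cvgn (int_series (fun k => inner (x k) (y k))).
Proof.
move=> cx cy; have c a : cvgn (int_series (fun k => `|x k + a *: y k| ^+ 2)).
  exact: (sqsumD cx (sqsumZ (a := a) cy)).
pose q a k : C := `|x k + a *: y k| ^+ 2.
rewrite (_ : (fun k => inner (x k) (y k)) = fun k =>
    4%:R^-1 * (q 1 k + -1 * q (-1) k + ('i * q 'i k + - 'i * q (- 'i) k))).
  apply: is_cvg_int_seriesZ.
  apply: is_cvg_int_seriesD; first apply: is_cvg_int_seriesD.
  - exact: c.
  - by apply: is_cvg_int_seriesZ; exact: c.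
  - apply: is_cvg_int_seriesD; first by apply: is_cvg_int_seriesZ; exact: c.
    by apply: is_cvg_int_seriesZ; exact: c.
apply/funext => k; rewrite polarization /q scale1r.
by rewrite mulN1r [in RHS]mulNr addrA.
Qed.

Definition l2_pred : {pred int -> H} := fun x => `[< square_summable x >].

Lemma l2_submod_closed : submod_closed l2_pred.
Proof.
split; first exact/asboolP/sqsum0.
move=> a x y /asboolP cx /asboolP cy; apply/asboolP.
by apply: sqsumD; [apply: sqsumZ; exact: cx | exact: cy].
Qed.

HB.instance Definition _ :=
  GRing.isSubmodClosed.Build R[i] (int -> H) l2_pred l2_submod_closed.

Record l2 := L2 { l2_fun :> int -> H ; _ : l2_fun \in l2_pred }.

HB.instance Definition _ := [isSub for l2_fun].
HB.instance Definition _ := [Choice of l2 by <:].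
HB.instance Definition _ := [SubChoice_isSubLmodule of l2 by <:].

Lemma l2P (x : l2) : square_summable x.
Proof. by apply/asboolP; exact: (valP x). Qed.

Arguments l2P : clear implicits.

Definition l2_inner (x y : l2) : C :=
  limn (int_series (fun k => inner (x k) (y k))).

Lemma l2_innerDl (x y z : l2) :
  l2_inner (x + y) z = l2_inner x z + l2_inner y z.
Proof.
rewrite /l2_inner -lim_int_seriesD.
- by congr (limn (int_series _)); apply/funext => k; rewrite -innerDl.
- exact: (is_cvg_inner_series (l2P x) (l2P z)).
- exact: (is_cvg_inner_series (l2P y) (l2P z)).
Qed.

Lemma l2_innerZl a (x z : l2) : l2_inner (a *: x) z = a * l2_inner x z.
Proof.
rewrite /l2_inner -lim_int_seriesZ; last first.
  exact: (is_cvg_inner_series (l2P x) (l2P z)).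
by congr (limn (int_series _)); apply/funext => k; rewrite -innerZl.
Qed.

Lemma l2_innerC (x y : l2) : l2_inner x y = (l2_inner y x)^*.
Proof.
apply: cvg_lim; first exact: norm_hausdorff.
have h := cvg_conjC (is_cvg_inner_series (l2P y) (l2P x)).
rewrite (_ : int_series _ = fun n =>
  (int_series (fun k => inner (y k) (x k)) n)^*); first exact: h.
apply/funext => n.
rewrite /int_series /series/= rmorph_sum; apply: eq_bigr => i _.
by rewrite rmorphD/= -!innerC.
Qed.

Lemma l2_innerxx (x : l2) :
  l2_inner x x = limn (int_series (fun k => `|x k| ^+ 2)).
Proof.
by congr (limn (int_series _)); apply/funext => k; rewrite innerE.
Qed.

Lemma l2_term_le (x : l2) k : `|x k| ^+ 2 <= l2_inner x x.
Proof.
rewrite l2_innerxx.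
apply: (@int_series_term_le (fun k => `|x k| ^+ 2)); last exact: l2P.
by move=> j; rewrite exprn_ge0.
Qed.

Lemma l2_inner_ge0 (x : l2) : 0 <= l2_inner x x.
Proof. by apply: le_trans (l2_term_le x 0); rewrite exprn_ge0. Qed.

Lemma l2_inner_eq0 (x : l2) : l2_inner x x = 0 -> x = 0.
Proof.
move=> x0; apply/val_inj/funext => k /=.
apply/eqP; rewrite -normr_eq0 -sqrf_eq0 eq_le exprn_ge0//= andbT.
by rewrite -x0; exact: l2_term_le.
Qed.

Definition l2_norm (x : l2) : C := sqrtC (l2_inner x x).

Lemma l2_normD (x y : l2) : l2_norm (x + y) <= l2_norm x + l2_norm y.
Proof.
exact: (preinner_normD l2_innerDl l2_innerZl l2_innerC l2_inner_ge0
  l2_inner_eq0).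
Qed.

Lemma l2_normZ a (x : l2) : l2_norm (a *: x) = `|a| * l2_norm x.
Proof. exact: (preinner_normZ l2_innerZl l2_innerC). Qed.

Lemma l2_norm_eq0 (x : l2) : l2_norm x = 0 -> x = 0.
Proof. by move/eqP; rewrite sqrtC_eq0 => /eqP; exact: l2_inner_eq0. Qed.

HB.instance Definition _ :=
  Lmodule_isNormed.Build R[i] l2 l2_normD l2_normZ l2_norm_eq0.

Lemma l2_innerE (x : l2) : l2_inner x x = `|x| ^+ 2.
Proof. by rewrite (_ : `|x| = l2_norm x)// sqrtCK. Qed.

Lemma l2_norm_coord (x : l2) k : `|x k| <= `|x|.
Proof.
by rewrite -(@ler_pXn2r _ 2)// ?nnegrE// -l2_innerE l2_term_le.
Qed.

Lemma l2_partial_le (x : l2) n :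
  int_series (fun k => `|x k| ^+ 2) n <= `|x| ^+ 2.
Proof.
rewrite -l2_innerE l2_innerxx; apply: int_series_le; last exact: l2P.
by move=> k; rewrite exprn_ge0.
Qed.

Lemma l2_complete (F : set_system l2) : ProperFilter F -> cauchy F -> cvg F.
Proof.
move=> FF /cauchyP Fc.
have Fe (e : C) : 0 < e -> exists2 A, F A &
    forall x y : l2, A x -> A y -> `|x - y| <= e.
  move=> e0; have [|w Fw] := Fc (e / 2); first by rewrite divr_gt0.
  exists (ball w (e / 2)); first exact: Fw.
  move=> x y; rewrite -ball_normE/= => xw yw.
  rewrite [e]splitr -(subrKA w); apply: le_trans (ler_normD _ _) _.
  by apply: lerD; apply: ltW; first rewrite distrC.
have ck k : cvg ((fun x : l2 => x k) @ F).
  apply: cauchy_cvg; apply/cauchyP => e /Fc[w Fw].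
  exists (w k).
  suff : F ((fun x : l2 => x k) @^-1` ball (w k) e) by [].
  apply: filterS Fw => x; rewrite -!ball_normE/=.
  apply: le_lt_trans; rewrite (_ : w k - x k = (w - x) k)//.
  exact: l2_norm_coord.
pose z : int -> H := fun k => lim ((fun x : l2 => x k) @ F).
have zE k : (fun x : l2 => x k) @ F --> z k by exact: ck.
have cvg2 (x : l2) k : `|x k - y k| ^+ 2 @[y --> F] --> `|x k - z k| ^+ 2.
  have h : `|x k - y k| @[y --> F] --> `|x k - z k|.
    by apply: cvg_norm; apply: cvgB; [exact: cvg_cst | exact: zE].
  by rewrite expr2; apply: cvgM; exact: h.
have key (e : C) A : 0 < e -> F A ->
    (forall x y : l2, A x -> A y -> `|x - y| <= e) ->
    forall x : l2, A x -> forall n,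
    int_series (fun k => `|x k - z k| ^+ 2) n <= e ^+ 2.
  move=> e0 FA Ae x Ax n.
  apply: (@cvgC_le _ _ F FF
    (fun y : l2 => int_series (fun k => `|x k - y k| ^+ 2) n)).
    apply: (@cvg_int_series _ F _ (fun (y : l2) k => `|x k - y k| ^+ 2)
      (fun k => `|x k - z k| ^+ 2)).
    exact: cvg2.
  apply: filterS FA => y Ay.
  apply: le_trans (l2_partial_le (x - y) n) _.
  by rewrite ler_pXn2r ?nnegrE ?(ltW e0)//; exact: Ae.
have summ (e : C) (x : l2) : 0 < e ->
    (forall n, int_series (fun k => `|x k - z k| ^+ 2) n <= e ^+ 2) ->
    (x : int -> H) - z \in l2_pred.
  move=> e0 xz; apply/asboolP; rewrite /square_summable.
  apply: nneg_series_cvg xz => n.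
  by rewrite addr_ge0// exprn_ge0.
have [A FA Ae] := Fe 1 ltr01.
have [x0 Ax0] := filter_ex FA.
have zl : z \in l2_pred.
  have := summ _ _ ltr01 (key _ _ ltr01 FA Ae _ Ax0).
  move=> h; rewrite (_ : z = (x0 : int -> H) - ((x0 : int -> H) - z)).
    by apply: rpredB; [exact: (valP x0) | exact: h].
  by rewrite opprB addrCA subrr addr0.
apply/cvg_ex; exists (L2 zl); apply/cvgrPdist_le => e e0.
have [B FB Be] := Fe e e0.
have zx := key _ _ e0 FB Be.
apply: filterS FB => x Bx; rewrite distrC.
rewrite -(@ler_pXn2r _ 2)// ?nnegrE ?(ltW e0)// -l2_innerE l2_innerxx.
apply: (@cvgC_le _ _ \oo _ (int_series (fun k => `|x k - z k| ^+ 2))).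
  exact: (l2P (x - L2 zl)).
by apply: nearW => n; exact: zx Bx n.
Qed.

HB.instance Definition _ := Uniform_isComplete.Build l2 l2_complete.

HB.instance Definition _ := NormedModule_isHilbert.Build R l2
  l2_innerDl l2_innerZl l2_innerC l2_innerE.

End l2.

Section von_neumann_algebras.
Context {R : realType} {H : hilbertType R}.
Implicit Types (S T : H -> H) (A N : set (H -> H)).

Definition bounded_op : set (H -> H) :=
  [set T | linear T /\ exists c : R, forall x, `|T x| <= c%:C%C * `|x|].

Definition is_adjoint T T' : Prop :=
  forall x y, inner (T x) y = inner x (T' y).

Definition commutant A : set (H -> H) :=
  [set T | bounded_op T /\ forall S, A S -> T \o S = S \o T].

(* Self-adjoint sets of bounded operators equal to their bicommutant.  The
   adjoint T' is not assumed bounded: this follows from [is_adjoint T T']. *)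
Definition von_neumann_algebra N : Prop :=
  [/\ N `<=` bounded_op,
      forall T T', N T -> is_adjoint T T' -> N T' &
      commutant (commutant N) = N].

Definition scalar_op : set (H -> H) :=
  range (fun (c : R[i]) (x : H) => c *: x).

Definition vna_center N : set (H -> H) := N `&` commutant N.

Definition is_factor N : Prop := vna_center N = scalar_op.

Definition star_automorphism N (alpha : (H -> H) -> (H -> H)) : Prop :=
  [/\ set_bij N N alpha,
      forall (c : R[i]) S T, N S -> N T ->
        alpha (c *: S + T) = c *: alpha S + alpha T,
      forall S T, N S -> N T -> alpha (S \o T) = alpha S \o alpha T &
      forall T T', N T -> is_adjoint T T' -> is_adjoint (alpha T) (alpha T')].

(* The sigma-weak topology is induced by the functionals
   T |-> sum_n <T xi_n, eta_n> with xi, eta square summable. *)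
Definition sigma_weakly_continuous (f : R -> H -> H) : Prop :=
  forall xi eta : nat -> H,
    cvgn (series (fun n => `|xi n| ^+ 2)) ->
    cvgn (series (fun n => `|eta n| ^+ 2)) ->
    continuous (fun t =>
      limn (series (fun n => inner (f t (xi n)) (eta n))) : R[i]).

(* The values of theta t outside N are irrelevant. *)
Record wstar_system N (theta : R -> (H -> H) -> (H -> H)) : Prop := {
  wstar_vna : von_neumann_algebra N;
  wstar_aut : forall t, star_automorphism N (theta t);
  wstar_0 : forall T, N T -> theta 0 T = T;
  wstar_add : forall s t T, N T -> theta (s + t) T = theta s (theta t T);
  wstar_continuous :
    forall T, N T -> sigma_weakly_continuous (fun t => theta t T) }.

Definition fixed_points (G : Type) N (alpha : G -> (H -> H) -> (H -> H)) :
    set (H -> H) :=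
  [set T | N T /\ forall g, alpha g T = T].

Definition ergodic (G : Type) N (alpha : G -> (H -> H) -> (H -> H)) : Prop :=
  fixed_points N alpha = scalar_op.

Definition centrally_ergodic (G : Type) N
    (alpha : G -> (H -> H) -> (H -> H)) : Prop :=
  ergodic (vna_center N) alpha.

Definition expi (x : R) : R[i] := (cos x +i* sin x)%C.

Definition eigenvalues N (theta : R -> (H -> H) -> (H -> H)) : set R :=
  [set s | exists a, [/\ N a, a <> 0 &
                         forall t, theta t a = expi (s * t) *: a]].

Definition int_action (theta : R -> (H -> H) -> (H -> H)) (t : R) :
    int -> (H -> H) -> (H -> H) :=
  fun n => theta (n%:~R * t).

(* The von Neumann algebra on l2(Z, H) generated by the operators pi(x), x in N,
   and the translations lambda(m), m in Z, where
   (pi(x) xi)(n) = alpha_{-n}(x) xi(n) and (lambda(m) xi)(n) = xi(n - m). *)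
Definition crossed_product_gen N (alpha : int -> (H -> H) -> (H -> H)) :
    set (l2 H -> l2 H) :=
  [set T : l2 H -> l2 H | exists2 x, N x &
    forall (xi : l2 H) (n : int), T xi n = alpha (- n) x (xi n)] `|`
  [set T : l2 H -> l2 H | exists m : int,
    forall (xi : l2 H) (n : int), T xi n = xi (n - m)].

End von_neumann_algebras.

Definition crossed_product (R : realType) (H : hilbertType R)
    (N : set (H -> H)) (alpha : int -> (H -> H) -> (H -> H)) :
    set (l2 H -> l2 H) :=
  smallest von_neumann_algebra (crossed_product_gen N alpha).

(* Main.v *)
(* Write Z for the center of N and al = theta_t.

   (1) <-> (3): averaging theta_u(a) against characters over one period turns a
   nonscalar element a of Z fixed by theta_p into an eigenvector of eigenvalue
   2 pi m / p with m <> 0, since the Fourier coefficients cannot all vanish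
   outside m = 0.  Conversely, by ergodicity an eigenvector is a multiple of a
   unitary, and a suitable power of it is fixed by al but not by theta.

   (1) <-> (2): a fixed point of al in Z is central in the crossed product.
   Conversely, the matrix of a central element T is constant along diagonals,
   with entries tau_k in N such that tau_k a = al^(-k)(a) tau_k.  Hence
   w = tau_k* tau_k is in Z and is supported where al^k is trivial on Z.  That
   part of Z is invariant under theta, so for k <> 0 either tau_k = 0 or theta
   is periodic on Z, and the latter makes al nonergodic by the first part.  So T
   is diagonal, with constant entry tau_0 in Z.  Finally tau_0 is fixed by al
   because an operator s with a s = s al^j(a) for all a in N gives an element of
   the commutant of the crossed product; there are enough such s because
   *-automorphisms of von Neumann algebras are normal. *)

Require Import Defs.
From HB Require Import structures.
From mathcomp Require Import all_boot all_order all_algebra.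
From mathcomp Require Import all_classical all_reals all_analysis.
From mathcomp Require Import complex ring lra.

Import Order.TTheory GRing.Theory Num.Theory.
Import numFieldNormedType.Exports.

Local Open Scope classical_set_scope.
Local Open Scope ring_scope.

Set Implicit Arguments.
Unset Strict Implicit.
Unset Printing Implicit Defensive.

(** * Hilbert spaces and bounded operators *)

(** Two difficulties shape the development. The maps [theta u] are given by algebraic conditions
    only, so they do not visibly pass through the strong limits that define the Fourier coefficients
    of an orbit; and [N] acts on an arbitrary [H], where an automorphism need not be implemented by
    a unitary. One device answers both: bounded operators s with T s = s alpha(T) for T in [N],
    numerous enough that no nonzero central d has s d = 0 for all of them. Since s alpha(T) x = T (s
    x), strong convergence of T controls s alpha(T) x; and s, applied in each coordinate and
    combined with a translation, commutes with the crossed product. Support projections are replaced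
    by positive elements that are maximal by Zorn's lemma, and square roots by the inequality |T
    x|^2 <= c <T x, x>. Integrals over a period are limits of dyadic means, and uniqueness of
    Fourier coefficients comes from the powers of cos^2(pi u), which peak at the integers. *)

Section inner_product.
Context {R : realType} {H : hilbertType R}.
Implicit Types (x y z : H) (S T K : H -> H).

Lemma opDE S T x : (S + T) x = S x + T x.
Proof. by []. Qed.

Lemma opBE S T x : (S - T) x = S x - T x.
Proof. by []. Qed.

Lemma opZE (c : R[i]) T x : (c *: T) x = c *: T x.
Proof. by []. Qed.

Lemma op0E x : (0 : H -> H) x = 0.
Proof. by []. Qed.

Lemma inner0l x : inner 0 x = 0 :> R[i].
Proof. by have := innerZl 0 0 x; rewrite scale0r mul0r. Qed.

Lemma inner0r x : inner x 0 = 0 :> R[i].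
Proof. by rewrite innerC inner0l rmorph0. Qed.

Lemma innerNl x y : inner (- x) y = - inner x y.
Proof. by rewrite -scaleN1r innerZl mulN1r. Qed.

Lemma innerNr x y : inner x (- y) = - inner x y.
Proof. by rewrite innerC innerNl rmorphN/= -innerC. Qed.

Lemma innerBl x y z : inner (x - y) z = inner x z - inner y z.
Proof. by rewrite innerDl innerNl. Qed.

Lemma innerBr x y z : inner z (x - y) = inner z x - inner z y.
Proof. by rewrite innerDr innerNr. Qed.

Lemma inner_ge0 x : 0 <= inner x x.
Proof. by rewrite innerE exprn_ge0. Qed.

Lemma inner_eq0 x : inner x x = 0 -> x = 0.
Proof. by rewrite innerE => /eqP; rewrite expf_eq0/= normr_eq0 => /eqP. Qed.

Lemma inner_ext x y : (forall z, inner z x = inner z y) -> x = y.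
Proof.
move=> xy; apply/eqP; rewrite -subr_eq0; apply/eqP/inner_eq0.
by rewrite [in LHS]innerBr xy subrr.
Qed.

Lemma inner_norm_le x y : `|inner x y| <= `|x| * `|y|.
Proof.
have [->|y0] := eqVneq y 0; first by rewrite inner0r !normr0 mulr0.
have yy : 0 < `|y| by rewrite normr_gt0.
(* [|y| ^+ 2] times the component of [x] orthogonal to [y]; the factor avoids a division. *)
have := inner_ge0 (`|y| ^+ 2 *: x - inner x y *: y).
rewrite !(innerBl, innerBr, innerZl, innerZr) (innerC y x) !innerE.
rewrite conj_Creal ?rpredX ?normr_real// [X in 0 <= X](_ : _ =
   `|y| ^+ 2 * ((`|x| * `|y|) ^+ 2 - inner x y * (inner x y)^*)); last by ring.
rewrite pmulr_rge0 ?exprn_gt0// subr_ge0 -normCK.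
by rewrite ler_pXn2r// nnegrE// mulr_ge0.
Qed.

Lemma inner_cvgl (I : Type) (F : set_system I) {FF : Filter F}
    (u : I -> H) x y : u i @[i --> F] --> x ->
  inner (u i) y @[i --> F] --> (inner x y : R[i]).
Proof.
move=> /cvgrPdist_lt ux; apply/cvgrPdist_lt => e e0.
have y1 : 0 < `|y| + 1 by rewrite ltr_wpDl.
have /ux := divr_gt0 e0 y1.
apply: filterS => i; rewrite ltr_pdivlMr// => xu.
rewrite -innerBl; apply: le_lt_trans xu.
apply: le_trans (inner_norm_le _ _) _.
by rewrite ler_wpM2l// lerDl.
Qed.

Lemma inner_cvgr (I : Type) (F : set_system I) {FF : Filter F}
    (u : I -> H) x y : u i @[i --> F] --> y ->
  inner x (u i) @[i --> F] --> (inner x y : R[i]).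
Proof.
move=> uy; rewrite (innerC x y).
under eq_fun do rewrite innerC.
by apply: cvg_conjC; exact: inner_cvgl.
Qed.

Lemma adjoint_sym T T' : is_adjoint T T' -> is_adjoint T' T.
Proof. by move=> TT' x y; rewrite innerC -TT' -innerC. Qed.

Lemma adjoint_unique T S S' : is_adjoint T S -> is_adjoint T S' -> S = S'.
Proof.
by move=> TS TS'; apply/funext => x; apply: inner_ext => z; rewrite -TS TS'.
Qed.

Lemma adjoint_comp S S' T T' : is_adjoint S S' -> is_adjoint T T' ->
  is_adjoint (S \o T) (T' \o S').
Proof. by move=> SS' TT' x y /=; rewrite SS' TT'. Qed.

Lemma adjointZ c T T' : is_adjoint T T' -> is_adjoint (c *: T) (c^* *: T').
Proof.
by move=> TT' x y; rewrite !opZE innerZl innerZr TT' conjCK.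
Qed.

Lemma adjoint_id : is_adjoint (idfun : H -> H) idfun.
Proof. by []. Qed.

Lemma adjoint_linear T T' : is_adjoint T T' -> linear T.
Proof.
move=> TT' a x y; apply: inner_ext => z.
by rewrite [LHS]innerC [RHS]innerC innerDl innerZl !TT' innerDl innerZl.
Qed.

Lemma linear_opD T : linear T -> {morph T : x y / x + y}.
Proof. by move=> lT x y; have := lT 1 x y; rewrite !scale1r. Qed.

Lemma linear_op0 T : linear T -> T 0 = 0.
Proof.
by move=> lT; have := lT (-1) 0 0; rewrite scaler0 add0r scaleN1r addNr.
Qed.

Lemma linear_opZ T : linear T -> forall a x, T (a *: x) = a *: T x.
Proof.
by move=> lT a x; have := lT a x 0; rewrite (linear_op0 lT) !addr0.
Qed.

Lemma linear_opB T : linear T -> {morph T : x y / x - y}.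
Proof.
by move=> lT x y; rewrite (linear_opD lT) -scaleN1r (linear_opZ lT) scaleN1r.
Qed.

Lemma bounded_op_intro T c : linear T -> (forall x, `|T x| <= c * `|x|) ->
  bounded_op T.
Proof.
move=> lT Tc; split=> //; exists (complex.Re `|c|) => x.
rewrite RRe_real ?normr_real//.
have [->|x0] := eqVneq x 0; first by rewrite (linear_op0 lT) !normr0 mulr0.
have c0 : 0 <= c.
  by have := le_trans (normr_ge0 _) (Tc x); rewrite pmulr_lge0// normr_gt0.
by rewrite ger0_norm.
Qed.

Lemma bounded_op_linear T : bounded_op T -> linear T.
Proof. by case. Qed.

Lemma bounded_op_bound T : bounded_op T ->
  exists2 c : R[i], 0 < c & forall x, `|T x| <= c * `|x|.
Proof.
case=> _ [c Tc]; exists (`|c%:C%C| + 1) => [|x]; first by rewrite ltr_wpDl.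
apply: le_trans (Tc x) _; rewrite ler_wpM2r//.
apply: (@le_trans _ _ `|c%:C%C|); last by rewrite lerDl.
by rewrite real_ler_norm// complex_real.
Qed.

Lemma bounded_op_cvg T (I : Type) (F : set_system I) {FF : Filter F}
    (u : I -> H) x : bounded_op T ->
  u i @[i --> F] --> x -> T (u i) @[i --> F] --> T x.
Proof.
move=> bT /cvgrPdist_lt ux; apply/cvgrPdist_lt => e e0.
have [c c0 Tc] := bounded_op_bound bT.
have /ux := divr_gt0 e0 c0; apply: filterS => i.
rewrite ltr_pdivlMr// mulrC => xu.
rewrite -(linear_opB (bounded_op_linear bT)).
exact: le_lt_trans (Tc _) xu.
Qed.

Lemma bounded_op_comp S T : bounded_op S -> bounded_op T ->
  bounded_op (S \o T).
Proof.
move=> bS bT; have [c c0 Sc] := bounded_op_bound bS.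
have [d d0 Td] := bounded_op_bound bT.
apply: (@bounded_op_intro _ (c * d)) => [a x y /=|x /=].
  by rewrite (bounded_op_linear bT) (bounded_op_linear bS).
by apply: le_trans (Sc _) _; rewrite -mulrA ler_wpM2l// ltW.
Qed.

Lemma bounded_op_lin a S T : bounded_op S -> bounded_op T ->
  bounded_op (a *: S + T).
Proof.
move=> bS bT; have [c c0 Sc] := bounded_op_bound bS.
have [d d0 Td] := bounded_op_bound bT.
apply: (@bounded_op_intro _ (`|a| * c + d)) => [b x y|x].
  rewrite !(opDE, opZE) (bounded_op_linear bT) (bounded_op_linear bS).
  by rewrite !scalerDr !scalerA [a * b]mulrC addrACA.
rewrite !(opDE, opZE) mulrDl.
apply: le_trans (ler_normD _ _) _; rewrite normrZ -mulrA.
by rewrite lerD// ler_wpM2l.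
Qed.

Lemma bounded_op_scale (c : R[i]) : bounded_op (fun x : H => c *: x).
Proof.
apply: (@bounded_op_intro _ `|c|) => [a x y|x]; last by rewrite normrZ.
by rewrite scalerDr !scalerA mulrC.
Qed.

Lemma bounded_op_adjoint T T' : bounded_op T -> is_adjoint T T' ->
  bounded_op T'.
Proof.
move=> bT TT'; have [c c0 Tc] := bounded_op_bound bT.
apply: (@bounded_op_intro _ c) => [|x].
  exact: adjoint_linear (adjoint_sym TT').
have [->|Tx0] := eqVneq (T' x) 0.
  by rewrite normr0 mulr_ge0// ltW.
rewrite -(@ler_pM2l _ `|T' x|) ?normr_gt0// -expr2 -innerE -TT'.
apply: le_trans (_ : _ <= `|inner (T (T' x)) x|) _.
  by rewrite real_ler_norm// TT' ger0_real// inner_ge0.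
apply: le_trans (inner_norm_le _ _) _.
by rewrite mulrA [`|T' x| * c]mulrC ler_wpM2r.
Qed.

End inner_product.

(** * Representation of functionals by minimization; existence of adjoints *)

Section representation.
Context {R : realType} {H : hilbertType R}.
Implicit Types (u v w x : H) (S T K : H -> H).

Lemma conj_sum_le (a : R[i]) : a + a^* <= 2 * `|a|.
Proof.
have ar : a + a^* \is Num.real by apply/CrealP; rewrite rmorphD/= conjCK addrC.
apply: le_trans (real_ler_norm ar) _; apply: le_trans (ler_normD _ _) _.
by rewrite norm_conjC mulr2n mulrDl mul1r.
Qed.

(* The functional to be represented is given by its graph, so that it need only
   be defined on a subspace.  The representing vector minimizes
   <Kv, v> - 2 Re z over the points (v, z) of the graph. *)
Lemma coercive_representation K (lam c : R[i]) (G : H -> R[i] -> Prop) :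
  bounded_op K -> is_adjoint K K -> 0 < lam -> 0 <= c ->
  (forall x, lam * `|x| ^+ 2 <= inner (K x) x) ->
  G 0 0 ->
  (forall a v z w y, G v z -> G w y -> G (a *: v + w) (a * z + y)) ->
  (forall v z, G v z -> `|z| <= c * `|v|) ->
  exists u, (forall e : R[i], 0 < e -> exists v z, G v z /\ `|u - v| < e) /\
    (forall v z, G v z -> inner (K v) u = z).
Proof.
move=> bK Ksym l0 c0 Kpos G0 Glin Gb; have lK := bounded_op_linear bK.
pose J v (z : R[i]) : R[i] := inner (K v) v - (z + z^*).
have K0 x : 0 <= inner (K x) x.
  by apply: le_trans (Kpos x); rewrite mulr_ge0 ?exprn_ge0// ltW.
have Jr v z : J v z \is Num.real.
  apply: rpredB; first exact: ger0_real.
  by apply/CrealP; rewrite rmorphD/= conjCK addrC.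
(* Completing the square in |v|: lam |v|^2 - 2 c |v| >= - c^2 / lam. *)
have Jlb v z : G v z -> - (c ^+ 2 / lam) <= J v z.
  move=> /Gb zc; apply: (@le_trans _ _ (lam * `|v| ^+ 2 - 2 * (c * `|v|))).
    rewrite -subr_ge0 [X in 0 <= X](_ : _ =
      (lam * `|v| - c) ^+ 2 / lam); last first.
      by field; rewrite gt_eqF.
    rewrite divr_ge0 ?(ltW l0)//; apply: real_exprn_even_ge0 => //.
    by rewrite rpredB ?rpredM ?normr_real ?ger0_real// ltW.
  rewrite lerB//; apply: le_trans (conj_sum_le z) _.
  by rewrite ler_wpM2l.
pose E : set R := [set r | exists v z, G v z /\ J v z = r%:C%C].
have hE : has_inf E.
  split.
    by exists (complex.Re (J 0 0)), 0, 0; split=> //; rewrite RRe_real.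
  exists (complex.Re (- (c ^+ 2 / lam))) => r [v [z [Gvz Jvz]]].
  by have := Jlb _ _ Gvz; rewrite Jvz lecE => /andP[_].
pose mu : R[i] := (inf E)%:C%C.
have mulb v z : G v z -> mu <= J v z.
  move=> Gvz; rewrite -[J v z]RRe_real// lecR; apply: ge_inf; first by case: hE.
  by exists v, z; rewrite RRe_real.
pose B (e : R[i]) : set H := [set v | exists z, G v z /\ J v z <= mu + e].
have B0 e : 0 < e -> exists v, B e v.
  move=> e0; have er : e = (complex.Re e)%:C%C by rewrite RRe_real// gtr0_real.
  have e1 : 0 < complex.Re e by move: e0; rewrite er ltcR.
  have [r [v [z [Gvz Jvz]]] re] := inf_adherent e1 hE.
  exists v, z; split=> //; rewrite Jvz er -rmorphD lecR/=.
  exact: ltW.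
pose F : set_system H := filter_from [set e : R[i] | 0 < e] B.
have FF : ProperFilter F.
  apply: filter_from_proper; last by move=> e /B0.
  apply: filter_from_filter; first by exists 1; exact: ltr01.
  move=> e f /= e0 f0; exists (Num.min e f) => /=.
    by rewrite /Num.min; case: ifP.
  have ef : (e >=< f)%R by rewrite real_comparable ?gtr0_real.
  move=> v [z [Gvz Jvz]]; split; exists z; split=> //.
    apply: le_trans Jvz _; rewrite lerD2l.
    by rewrite comparable_ge_min// lexx.
  apply: le_trans Jvz _; rewrite lerD2l.
  by rewrite comparable_ge_min// lexx orbT.
(* Parallelogram identity: the midpoint of two near minimizers still costs at least [mu], which
   forces them together. *)
have Bdist e v w : B e v -> B e w -> lam * `|v - w| ^+ 2 <= 4 * e.
  move=> [z [Gvz Jv]] [y [Gwy Jw]].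
  have := mulb _ _ (Glin 2^-1 _ _ _ _ (Glin 1 _ _ _ _ Gvz Gwy) G0).
  move=> m; apply: le_trans (Kpos _) _.
  have -> : inner (K (v - w)) (v - w) = 2 * (J v z + J w y) -
      4 * J (2^-1 *: (1 *: v + w) + 0) (2^-1 * (1 * z + y) + 0).
    rewrite /J !addr0 !scale1r !mul1r !(linear_opB lK) !(linear_opZ lK).
    rewrite !(linear_opD lK).
    rewrite !(innerBl, innerBr, innerDl, innerDr, innerZl, innerZr).
    rewrite rmorphM/= !rmorphD/= fmorphV/= conjC_nat.
    by field.
  rewrite [leRHS](_ : _ = 2 * ((mu + e) + (mu + e)) - 4 * mu); last by ring.
  by rewrite lerB// ?ler_wpM2l// lerD.
have Fcv : cvg F.
  apply: cauchy_cvg; apply/cauchyP => e e0.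
  have e1 : 0 < lam * e ^+ 2 / 8 by rewrite divr_gt0// mulr_gt0// exprn_gt0.
  have [v Bv] := B0 _ e1.
  exists v; exists (lam * e ^+ 2 / 8) => // w Bw.
  rewrite -ball_normE/= -(@ltr_pXn2r _ 2)// ?nnegrE// ?(ltW e0)//.
  rewrite -(ltr_pM2l l0); apply: le_lt_trans (Bdist _ _ _ Bv Bw) _.
  rewrite mulrCA gtr_pMr; last by rewrite mulr_gt0// exprn_gt0.
  by rewrite ltr_pdivrMr// mul1r ltr_nat.
pose u : H := lim F.
have Fu : F --> u by exact: Fcv.
exists u; split=> [e e0|w y Gwy].
  have /cvgrPdist_lt /(_ _ e0) ue : (id v)@[v --> F] --> u by exact: Fu.
  have FB : F (B 1) by exists 1 => //; exact: ltr01.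
  have [v [uv [z [Gvz _]]]] := filter_ex (filterI ue FB).
  by exists v, z.
pose k := inner (K w) w; pose D v := inner (K w) v - y.
have kge0 : 0 <= k by exact: K0.
have k1 : 0 < 1 + k by rewrite ltr_pwDl.
(* Moving v by - rho (D v)^* along w lowers [J] by at least |D v|^2 rho once rho k <= 1; the added 1
   covers k = 0. *)
pose rho := (1 + k)^-1; have r0 : 0 < rho by rewrite invr_gt0.
have rr : rho^* = rho by apply: conj_Creal; exact: gtr0_real.
have rk : rho * k <= 1 by rewrite mulrC ler_pdivrMr// mul1r lerDr.
have Dle e v : B e v -> `|D v| ^+ 2 * rho <= e.
  move=> [z [Gvz Jv]].
  have := mulb _ _ (Glin (- rho * (D v)^*) _ _ _ _ Gwy Gvz).
  have Kd : inner (K w) v = D v + y by rewrite /D subrK.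
  move: (D v) Kd => d Kd.
  have sE : (- rho * d^* )^* = - rho * d.
    by rewrite rmorphM/= conjCK rmorphN/= rr.
  have -> : J (- rho * d^* *: w + v) (- rho * d^* * y + z) =
      J v z - `|d| ^+ 2 * rho * (2 - rho * k).
    rewrite /J (linear_opD lK) (linear_opZ lK).
    rewrite !(innerDl, innerDr, innerZl, innerZr) -/k (Ksym v w).
    rewrite (innerC v (K w)).
    by rewrite Kd sE !rmorphD/= rmorphM/= sE normCK; ring.
  rewrite lerBrDr => h.
  have {}h : `|d| ^+ 2 * rho * (2 - rho * k) <= e.
    by rewrite -(lerD2l mu); apply: le_trans h Jv.
  apply: le_trans h; rewrite ler_peMr//.
    by rewrite mulr_ge0 ?exprn_ge0// ltW.
  by rewrite lerBrDl (natrD _ 1 1) lerD2r.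
have Du : `|D u| ^+ 2 * rho = 0.
  apply/eqP; rewrite eq_le mulr_ge0 ?exprn_ge0 ?(ltW r0)// andbT.
  apply/ler_addgt0Pr => e e0; rewrite add0r.
  apply: (@cvgC_le _ _ F _ (fun v => `|D v| ^+ 2 * rho)); last first.
    by exists e => // v /Dle.
  apply: cvgM; last exact: cvg_cst.
  have Dc : `|D v| @[v --> F] --> `|D u|.
    apply: cvg_norm; apply: cvgB; last exact: cvg_cst.
    exact: (@inner_cvgr _ _ _ F _ id).
  by rewrite expr2; apply: cvgM; exact: Dc.
move/eqP: Du; rewrite mulf_eq0 (gt_eqF r0) orbF expf_eq0/= normr_eq0.
by rewrite subr_eq0 => /eqP.
Qed.

Lemma riesz (f : H -> R[i]) (c : R[i]) : 0 <= c ->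
  (forall a x y, f (a *: x + y) = a * f x + f y) ->
  (forall x, `|f x| <= c * `|x|) -> exists u, forall x, f x = inner x u.
Proof.
move=> c0 flin fc.
have f0 : f 0 = 0 by have := flin (-1) 0 0; rewrite scaler0 add0r mulN1r addNr.
have id1 x : 1 * `|x| ^+ 2 <= inner (id x) x by rewrite mul1r innerE.
have bid : bounded_op (id : H -> H).
  by apply: (@bounded_op_intro _ _ _ 1) => // x; rewrite mul1r.
have [||| u [_ uf]] :=
    @coercive_representation id 1 c (fun v z => z = f v) bid (@adjoint_id _ H)
      ltr01 c0 id1.
- by [].
- by move=> a v z w y -> ->; rewrite flin.
- by move=> v z ->.
by exists u => x; rewrite (uf x (f x)).
Qed.

Lemma adjoint_exists T : bounded_op T -> exists T', is_adjoint T T'.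
Proof.
move=> bT; have [c c0 Tc] := bounded_op_bound bT.
have lT := bounded_op_linear bT.
have h y : exists u, forall x, inner (T x) y = inner x u.
  apply: (@riesz _ (c * `|y|)); first by rewrite mulr_ge0// ltW.
    by move=> a x z; rewrite lT innerDl innerZl.
  move=> x; apply: le_trans (inner_norm_le _ _) _.
  by rewrite -mulrA [`|y| * _]mulrC mulrA ler_wpM2r.
exists (fun y => projT1 (cid (h y))) => x y.
by case: (cid (h y)) => u /= ->.
Qed.

End representation.

(** * Von Neumann algebras and their automorphisms *)

Section positive_operators.
Context {R : realType} {H : hilbertType R}.
Implicit Types (x y : H) (a b S T : H -> H).

Definition pos_op T : Prop := forall x, 0 <= inner (T x) x.

Definition le_op S T : Prop := pos_op (T - S).

Lemma pos_opE T : pos_op T = le_op 0 T.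
Proof. by rewrite /le_op subr0. Qed.

Lemma pos_opZ (c : R[i]) T : 0 <= c -> pos_op T -> pos_op (c *: T).
Proof. by move=> c0 pT x; rewrite opZE innerZl mulr_ge0. Qed.

Lemma pos_op0 : pos_op 0.
Proof. by move=> x; rewrite op0E inner0l. Qed.

Lemma pos_op_adjoint T T' : is_adjoint T T' -> pos_op (T' \o T).
Proof. by move=> TT' x /=; rewrite (adjoint_sym TT') inner_ge0. Qed.

Lemma le_opP S T :
  le_op S T <-> forall x, inner (S x) x <= inner (T x) x.
Proof.
by split=> ST x; have := ST x; rewrite opBE innerBl subr_ge0.
Qed.

Lemma le_op_refl T : le_op T T.
Proof. by apply/le_opP. Qed.

Lemma le_op_trans S T U : le_op S T -> le_op T U -> le_op S U.
Proof.
move=> /le_opP ST /le_opP TU; apply/le_opP => x.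
exact: le_trans (ST x) (TU x).
Qed.

(** Polarization: the form is real at x + y and at x + i y, which compares the real and imaginary
    parts of <T x, y> with those of <T y, x>. *)
Lemma pos_op_selfadjoint T : linear T -> pos_op T -> is_adjoint T T.
Proof.
move=> lT pT x y; rewrite (innerC x).
set p := inner (T x) y; set q := inner (T y) x.
have r z : (inner (T z) z)^* = inner (T z) z.
  by apply: conj_Creal; exact: ger0_real.
have := r (x + y); have := r (x + 'i *: y).
rewrite !(linear_opD lT, linear_opZ lT, innerDl, innerDr, innerZl, innerZr).
rewrite -/p -/q !conjCi !rmorphD/= !rmorphM/= !rmorphN/= !conjCi !r.
have i0 : 'i != 0 :> R[i] by exact: neq0Ci.
move: p q (inner (T x) x) (inner (T y) y) => p q s t h1 h2.
have e1 : p^* - q^* = q - p.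
  apply: (mulfI i0); apply/eqP; rewrite -subr_eq0; apply/eqP.
  move/eqP: h1; rewrite -subr_eq0 => /eqP h1; rewrite -[RHS]h1.
  by ring.
have e2 : p^* + q^* = p + q.
  move/eqP: h2; rewrite -subr_eq0 => /eqP h2; apply/eqP.
  by rewrite -subr_eq0; apply/eqP; rewrite -[RHS]h2; ring.
apply: (@mulfI _ 2); first by rewrite pnatr_eq0.
rewrite [LHS](_ : _ = (p + q) - (q - p)); last by ring.
by rewrite -e1 -e2; ring.
Qed.

(** Positivity at x - c^-1 T x gives T^2 <= c T in the sense of forms. This converts control of a
    form into control of vectors. *)
Lemma pos_op_norm_le T (c : R[i]) : linear T -> pos_op T -> 0 < c ->
  (forall x, inner (T x) x <= c * `|x| ^+ 2) ->
  forall x, `|T x| ^+ 2 <= c * inner (T x) x.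
Proof.
move=> lT pT c0 Tc x.
have cr : (c^-1)^* = c^-1.
  by apply: conj_Creal; rewrite rpredV gtr0_real.
have := pT (x - c^-1 *: T x).
rewrite !(linear_opB lT, linear_opZ lT, innerBl, innerBr, innerZl, innerZr) cr.
have -> : inner (T (T x)) x = inner (T x) (T x).
  exact: pos_op_selfadjoint.
move=> h; have {h} := le_trans h (_ : _ <= inner (T x) x -
  c^-1 * inner (T x) (T x)).
rewrite innerE subr_ge0 ler_pdivrMl//; apply.
have h := Tc (T x).
rewrite -subr_ge0 [X in 0 <= X](_ : _ =
   (c^-1) ^+ 2 * (c * `|T x| ^+ 2 - inner (T (T x)) (T x))).
  by rewrite mulr_ge0 ?exprn_ge0 ?invr_ge0 ?(ltW c0)// subr_ge0.
by field; rewrite gt_eqF.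
Qed.

Lemma le_op_anti S T : linear S -> linear T -> le_op S T -> le_op T S -> S = T.
Proof.
move=> lS lT ST TS; apply/eqP; rewrite -subr_eq0 -oppr_eq0 opprB; apply/eqP.
have lTS : linear (T - S).
  move=> a x y; rewrite !opBE lS lT scalerBr.
  by rewrite opprD addrACA.
apply/funext => x; rewrite op0E; apply/eqP.
have E0 z : inner ((T - S) z) z = 0.
  apply/eqP; rewrite eq_le ST andbT.
  by have := TS z; rewrite !opBE !innerBl subr_ge0 subr_le0.
have := @pos_op_norm_le _ 1 lTS ST ltr01; rewrite -normr_eq0.
move=> /(_ _ x)/[!E0]; rewrite mulr0 => h.
rewrite -sqrf_eq0 eq_le exprn_ge0// andbT; apply: h => z.
by rewrite E0 mul1r exprn_ge0.
Qed.

End positive_operators.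

(** * Commutants, centers and inverses in a von Neumann algebra *)

Section vna_basics.
Context {R : realType} {H : hilbertType R}.
Implicit Types (x y : H) (S T : H -> H) (A N : set (H -> H)).

Lemma commutant_anti A B : A `<=` B -> commutant B `<=` commutant A.
Proof. by move=> AB T [bT TB]; split=> // S /AB /TB. Qed.

Lemma bicommutant_ge A : A `<=` bounded_op -> A `<=` commutant (commutant A).
Proof.
by move=> Ab T AT; split=> [|S [_ SA]]; [exact: Ab | rewrite SA].
Qed.

Lemma commutant_adjoint A T T' : A `<=` bounded_op ->
  (forall S S', A S -> is_adjoint S S' -> A S') ->
  commutant A T -> is_adjoint T T' -> commutant A T'.
Proof.
move=> Ab As [bT TA] TT'; split; first exact: bounded_op_adjoint TT'.
move=> S AS; have [S' SS'] := adjoint_exists (Ab _ AS).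
have TS := TA _ (As _ _ AS SS').
apply: (@adjoint_unique _ _ (S' \o T)).
  exact: adjoint_comp (adjoint_sym SS') TT'.
by rewrite -TS; exact: adjoint_comp TT' (adjoint_sym SS').
Qed.

Lemma commutant_vna A : A `<=` bounded_op ->
  (forall S S', A S -> is_adjoint S S' -> A S') ->
  von_neumann_algebra (commutant A).
Proof.
move=> Ab As; split; first by move=> T [].
  by move=> T T'; exact: commutant_adjoint.
rewrite eqEsubset; split; first exact/commutant_anti/bicommutant_ge.
by apply: bicommutant_ge => T [].
Qed.

Lemma commutantP A T S x : commutant A T -> A S -> T (S x) = S (T x).
Proof. by move=> [_ TA] /TA /(congr1 (@^~ x)). Qed.

Lemma commutant_intro A T : bounded_op T ->
  (forall S x, A S -> T (S x) = S (T x)) -> commutant A T.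
Proof. by move=> bT TA; split=> // S AS; apply/funext => x /=; exact: TA. Qed.

Section vna.
Variable N : set (H -> H).
Hypothesis vN : von_neumann_algebra N.

Lemma vna_bounded T : N T -> bounded_op T.
Proof. by case: vN => Nb _ _ /Nb. Qed.

Lemma vna_linear T : N T -> linear T.
Proof. by move=> /vna_bounded /bounded_op_linear. Qed.

Lemma vna_adjoint T T' : N T -> is_adjoint T T' -> N T'.
Proof. by case: vN => _ + _; apply. Qed.

Lemma vna_adjoint_exists T : N T -> exists T', is_adjoint T T' /\ N T'.
Proof.
move=> NT; have [T' TT'] := adjoint_exists (vna_bounded NT).
by exists T'; split=> //; exact: vna_adjoint TT'.
Qed.

Lemma vna_mem T : bounded_op T ->
  (forall S x, commutant N S -> T (S x) = S (T x)) -> N T.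
Proof.
by move=> bT h; case: vN => _ _ <-; exact: commutant_intro.
Qed.

Lemma vna_comm T S x : N T -> commutant N S -> T (S x) = S (T x).
Proof. by move=> NT NS; rewrite (commutantP _ NS NT). Qed.

Lemma vna_lin a S T : N S -> N T -> N (a *: S + T).
Proof.
move=> NS NT; apply: vna_mem => [|U x NU].
  by apply: bounded_op_lin; exact: vna_bounded.
have lU : linear U by apply: bounded_op_linear; case: NU.
by rewrite !opDE !opZE lU (vna_comm _ NS NU) (vna_comm _ NT NU).
Qed.

Lemma vna_comp S T : N S -> N T -> N (S \o T).
Proof.
move=> NS NT; apply: vna_mem => [|U x NU /=].
  by apply: bounded_op_comp; exact: vna_bounded.
by rewrite (vna_comm _ NT NU) (vna_comm _ NS NU).
Qed.

Lemma vna_scalar (c : R[i]) : N (fun x => c *: x).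
Proof.
apply: vna_mem => [|S x [/bounded_op_linear lS _]].
  exact: bounded_op_scale.
by rewrite (linear_opZ lS).
Qed.

Lemma vna_id : N idfun.
Proof.
have -> : idfun = (fun x : H => (1 : R[i]) *: x); last exact: vna_scalar.
by apply/funext => x; rewrite scale1r.
Qed.

Lemma vna0 : N 0.
Proof.
have -> : (0 : H -> H) = (fun x : H => (0 : R[i]) *: x); last exact: vna_scalar.
by apply/funext => x; rewrite scale0r.
Qed.

Lemma vnaD S T : N S -> N T -> N (S + T).
Proof. by move=> NS NT; rewrite -[S]scale1r; exact: vna_lin. Qed.

Lemma vnaZ a T : N T -> N (a *: T).
Proof.
by move=> NT; rewrite -[_ *: T]addr0; apply: vna_lin => //; exact: vna0.
Qed.

Lemma vnaB S T : N S -> N T -> N (S - T).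
Proof. by move=> NS NT; rewrite addrC -scaleN1r; exact: vna_lin. Qed.

(** The center is the commutant of the self-adjoint set formed by N and its commutant, so general
    results on von Neumann algebras apply to it. *)
Lemma vna_center_vna : von_neumann_algebra (vna_center N).
Proof.
have -> : vna_center N = commutant (commutant N `|` N).
  rewrite eqEsubset; split=> T.
    move=> [NT [bT TN]]; split=> // S [NS|/TN //].
    by apply/funext => x /=; rewrite (vna_comm x NT NS).
  move=> TA; split; last by exact: (commutant_anti (@subsetUr _ _ _) TA).
  by case: vN => _ _ <-; exact: (commutant_anti (@subsetUl _ _ _) TA).
apply: commutant_vna => [T [[]//|/vna_bounded //]|S S' [NS|NS] SS'].
  left; apply: commutant_adjoint NS SS'; first exact: vna_bounded.
  exact: vna_adjoint.
by right; exact: vna_adjoint SS'.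
Qed.

Lemma center_sub T : vna_center N T -> N T.
Proof. by case. Qed.

Lemma center_comm T S x : vna_center N T -> N S -> T (S x) = S (T x).
Proof. by move=> [_ NT] NS; exact: commutantP NT NS. Qed.

Lemma center_intro T : N T -> (forall S x, N S -> T (S x) = S (T x)) ->
  vna_center N T.
Proof.
move=> NT TN; split=> //; apply: commutant_intro => //; exact: vna_bounded.
Qed.

Lemma center_adjoint T T' : vna_center N T -> is_adjoint T T' ->
  vna_center N T'.
Proof.
move=> [NT NT'] TT'; split; first exact: vna_adjoint TT'.
apply: commutant_adjoint NT' TT'; first exact: vna_bounded.
exact: vna_adjoint.
Qed.

(** T + lam is bounded below by lam, so minimization solves (T + lam) u = y, and an inverse commutes
    with whatever T commutes with. Serves as an algebraic mark of positivity. *)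
Lemma vna_inverse T (lam : R[i]) : N T -> pos_op T -> 0 < lam ->
  exists S, [/\ N S, (T + lam *: idfun) \o S = idfun &
                S \o (T + lam *: idfun) = idfun].
Proof.
move=> NT pT l0; set K := T + lam *: idfun.
have NK : N K by apply: vnaD => //; apply: vnaZ; exact: vna_id.
have lK := vna_linear NK; have bK := vna_bounded NK.
have Kge x : lam * `|x| ^+ 2 <= inner (K x) x.
  by rewrite /K opDE opZE innerDl innerZl innerE lerDr.
have pK : pos_op K.
  by move=> x; apply: le_trans (Kge x); rewrite mulr_ge0 ?exprn_ge0// ltW.
have Ksym := pos_op_selfadjoint lK pK.
have Kinj x y : K x = K y -> x = y.
  move=> Kxy; apply/eqP; rewrite -subr_eq0 -normr_eq0 -sqrf_eq0 eq_le.
  rewrite exprn_ge0// andbT -(ler_pM2l l0) mulr0.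
  by apply: le_trans (Kge _) _; rewrite (linear_opB lK) Kxy subrr inner0l.
have Ksurj y : exists u, K u = y.
  have [|||u [_ Ku]] := @coercive_representation _ _ K lam `|y|
      (fun v z => z = inner v y) bK Ksym l0 (normr_ge0 y) Kge.
  - by rewrite inner0l.
  - by move=> a v z w y' -> ->; rewrite innerDl innerZl.
  - by move=> v z ->; rewrite mulrC; exact: inner_norm_le.
  exists u; apply: inner_ext => z; rewrite -(Ku z _ erefl).
  by rewrite Ksym.
pose S y := projT1 (cid (Ksurj y)).
have KS y : K (S y) = y by rewrite /S; case: (cid (Ksurj y)).
have SK y : S (K y) = y by apply: Kinj; rewrite KS.
have lS : linear S.
  by move=> a x y; apply: Kinj; rewrite lK !KS.
exists S; split; [|by apply/funext => y /=..].
apply: vna_mem => [|U x NU]; last first.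
  apply: Kinj; rewrite KS.
  by rewrite -[in LHS](KS x) (vna_comm _ NK NU).
apply: (@bounded_op_intro _ _ _ lam^-1) => // x.
have [->|Sx] := eqVneq (S x) 0.
  by rewrite normr0 mulr_ge0// invr_ge0 ltW.
have Sx0 : 0 < `|S x| by rewrite normr_gt0.
rewrite ler_pdivlMl// -(ler_pM2r Sx0) -mulrA -expr2.
apply: le_trans (Kge _) _; rewrite KS.
by apply: le_trans (real_ler_norm _) (inner_norm_le _ _);
  rewrite -{1}[x]KS ger0_real// pK.
Qed.

End vna.
End vna_basics.

(** * Order and norm under automorphisms *)

Section star_automorphisms.
Context {R : realType} {H : hilbertType R}.
Implicit Types (x y : H) (S T : H -> H).
Variables (N : set (H -> H)) (alpha : (H -> H) -> (H -> H)).
Hypotheses (vN : von_neumann_algebra N) (aut : star_automorphism N alpha).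

Lemma aut_mem T : N T -> N (alpha T).
Proof. by case: aut => -[+ _ _] _ _ _; apply. Qed.

Lemma aut_inj S T : N S -> N T -> alpha S = alpha T -> S = T.
Proof. by case: aut => -[_ + _] _ _ _ NS NT; apply; exact/mem_set. Qed.

Lemma aut_surj T : N T -> exists2 S, N S & alpha S = T.
Proof. by case: aut => -[_ _ h] _ _ _ /h. Qed.

Lemma aut_lin (c : R[i]) S T : N S -> N T ->
  alpha (c *: S + T) = c *: alpha S + alpha T.
Proof. by case: aut => _ + _ _; apply. Qed.

Lemma aut_comp S T : N S -> N T -> alpha (S \o T) = alpha S \o alpha T.
Proof. by case: aut => _ _ + _; apply. Qed.

Lemma aut_adjoint T T' : N T -> is_adjoint T T' ->
  is_adjoint (alpha T) (alpha T').
Proof. by case: aut => _ _ _; apply. Qed.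

Lemma aut0 : alpha 0 = 0.
Proof.
have N0 := vna0 vN; have := aut_lin (-1) N0 N0.
by rewrite scaler0 addr0 scaleN1r addNr.
Qed.

Lemma autD S T : N S -> N T -> alpha (S + T) = alpha S + alpha T.
Proof. by move=> NS NT; rewrite -[S]scale1r aut_lin// !scale1r. Qed.

Lemma autZ (c : R[i]) T : N T -> alpha (c *: T) = c *: alpha T.
Proof.
by move=> NT; rewrite -[_ *: T]addr0 (aut_lin _ NT (vna0 vN)) aut0 addr0.
Qed.

Lemma autB S T : N S -> N T -> alpha (S - T) = alpha S - alpha T.
Proof. by move=> NS NT; rewrite addrC -scaleN1r aut_lin// scaleN1r addrC. Qed.

Lemma aut_id : alpha idfun = idfun.
Proof.
have [S NS S1] := aut_surj (vna_id vN).
have : alpha S = alpha S \o alpha idfun := aut_comp NS (vna_id vN).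
by rewrite S1 => /esym.
Qed.

Lemma aut_scalar (c : R[i]) : alpha (fun x => c *: x) = fun x => c *: x.
Proof.
by have := autZ c (vna_id vN); rewrite aut_id.
Qed.

Lemma aut_center T : vna_center N T -> vna_center N (alpha T).
Proof.
move=> ZT; have NT := center_sub ZT.
apply: center_intro => // [|S x NS]; first exact: aut_mem.
have [U NU <-] := aut_surj NS.
have TU : T \o U = U \o T.
  by apply/funext => y /=; exact: (center_comm _ ZT).
have := congr1 (fun f => alpha f x) TU.
by rewrite (aut_comp NT NU) (aut_comp NU NT).
Qed.

(* T + lam is invertible in N for all lam > 0 when T is positive, and this
   property is preserved by automorphisms. *)
Lemma aut_pos T : N T -> pos_op T -> pos_op (alpha T).
Proof.
move=> NT pT; set S := alpha T.
have NS : N S by exact: aut_mem.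
have lS := vna_linear vN NS.
have Ssym : is_adjoint S S.
  apply: aut_adjoint => //; apply: pos_op_selfadjoint => //.
  exact: vna_linear NT.
have Sr x : inner (S x) x \is Num.real.
  by apply/CrealP; rewrite -innerC Ssym.
(* On the zero space the set [E] below is all of R and has no supremum. *)
have [[x0 x00]|nx] := pselect (exists x : H, x != 0); last first.
  move=> x; have [->|x0] := eqVneq x 0; first by rewrite inner0r.
  by exfalso; apply: nx; exists x.
pose E : set R := [set r | forall x, r%:C%C * `|x| ^+ 2 <= inner (S x) x].
have sE : has_sup E.
  split.
    have [c c0 Sc] := bounded_op_bound (vna_bounded vN NS).
    exists (- complex.Re c) => x; rewrite rmorphN/= RRe_real ?gtr0_real//.
    rewrite mulNr lerNl; apply: (@le_trans _ _ `|inner (S x) x|).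
      by rewrite -normrN real_ler_norm// rpredN.
    apply: le_trans (inner_norm_le _ _) _.
    by rewrite expr2 mulrA ler_wpM2r.
  exists (complex.Re (inner (S x0) x0 / `|x0| ^+ 2)) => r /(_ x0).
  have x2 : 0 < `|x0| ^+ 2 by rewrite exprn_gt0// normr_gt0.
  rewrite -ler_pdivlMr// => h.
  rewrite -lecR RRe_real// rpredM// ?Sr// rpredV.
  by rewrite gtr0_real.
pose m := sup E.
have Em x : m%:C%C * `|x| ^+ 2 <= inner (S x) x.
  apply/ler_addgt0Pr => e e0.
  pose d := e / (`|x| ^+ 2 + 1).
  have x1 : 0 < `|x| ^+ 2 + 1 by rewrite ltr_wpDl// exprn_ge0.
  have d0 : 0 < d by rewrite divr_gt0.
  have dr : d = (complex.Re d)%:C%C by rewrite RRe_real// gtr0_real.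
  have d1 : 0 < complex.Re d by move: d0; rewrite dr ltcR.
  have [r Er mr] := sup_adherent d1 sE.
  apply: (@le_trans _ _ ((r%:C%C + d) * `|x| ^+ 2)).
    rewrite ler_wpM2r ?exprn_ge0// dr -rmorphD lecR/= -lerBlDr.
    exact: ltW.
  rewrite mulrDl; apply: lerD; first exact: (Er x).
  by rewrite /d -mulrA ger_pMr// ler_pdivrMl// mulr1 lerDl.
have [m0|m0] := leP 0 m.
  move=> x; apply: le_trans (Em x).
  by rewrite mulr_ge0 ?exprn_ge0// ler0c.
(* If the best lower bound m of S were negative, S - m would be positive, and invertible as the
   image of the invertible T - m; it would then be bounded below by some q > 0, contradicting the
   choice of m. *)
exfalso; pose lam : R[i] := (- m)%:C%C.
have l0 : 0 < lam by rewrite /lam ltcR oppr_gt0.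
have [U [NU TU UT]] := vna_inverse vN NT pT l0.
have N1 := vna_id vN; have NlN := vnaZ vN lam N1.
have {}UT : alpha U \o (S + lam *: idfun) = idfun.
  have -> : S + lam *: idfun = alpha (T + lam *: idfun).
    by rewrite (autD NT NlN) (autZ _ N1) aut_id.
  by rewrite -(aut_comp NU (vnaD vN NT NlN)) UT aut_id.
set K := S + lam *: idfun in UT.
have NK : N K by exact: vnaD.
have pK : pos_op K.
  move=> x; rewrite /K opDE opZE innerDl innerZl innerE.
  have := Em x; rewrite -subr_ge0 /lam rmorphN mulNr.
  by [].
have [c c0 Kc] := bounded_op_bound (vna_bounded vN NK).
have [d d0 Ud] := bounded_op_bound (vna_bounded vN (aut_mem NU)).
have Kb x : inner (K x) x <= c * `|x| ^+ 2.
  apply: le_trans (real_ler_norm (ger0_real (pK x))) _.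
  apply: le_trans (inner_norm_le _ _) _.
  by rewrite expr2 mulrA ler_wpM2r.
have Kn := pos_op_norm_le (vna_linear vN NK) pK c0 Kb.
have dc : 0 < d ^+ 2 * c by rewrite mulr_gt0// exprn_gt0.
(* Combines |x| = |alpha(U) K x| <= d |K x| with |K x|^2 <= c <K x, x>. *)
have h x : (d ^+ 2 * c)^-1 * `|x| ^+ 2 <= inner (K x) x.
  rewrite ler_pdivrMl// -mulrA.
  apply: le_trans (_ : _ <= d ^+ 2 * `|K x| ^+ 2) _.
    rewrite -exprMn ler_pXn2r ?nnegrE ?mulr_ge0 ?(ltW d0)//.
    by have := Ud (K x); rewrite -[alpha U (K x)]/((alpha U \o K) x) UT.
  by rewrite ler_wpM2l// exprn_ge0// ltW.
pose q := complex.Re (d ^+ 2 * c)^-1.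
have qE : (d ^+ 2 * c)^-1 = q%:C%C.
  by rewrite RRe_real// gtr0_real// invr_gt0.
have q0 : 0 < q by rewrite -ltcR -qE invr_gt0.
have : E (m + q).
  move=> x; have := h x; rewrite /K opDE opZE innerDl innerZl innerE.
  by rewrite qE /lam rmorphN/= mulNr rmorphD/= mulrDl -lerBrDl.
move=> /(sup_upper_bound sE); rewrite -/m leNgt.
by rewrite ltrDl q0.
Qed.

Lemma aut_le S T : N S -> N T -> le_op S T -> le_op (alpha S) (alpha T).
Proof.
by move=> NS NT ST; rewrite /le_op -autB//; apply: aut_pos => //; exact: vnaB.
Qed.

(** Preservation of the order, applied to T^* T <= c^2. *)
Lemma aut_contract T (c : R[i]) : N T -> 0 <= c ->
  (forall x, `|T x| <= c * `|x|) -> forall x, `|alpha T x| <= c * `|x|.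
Proof.
move=> NT c0 Tc x; have [T' [TT' NT']] := vna_adjoint_exists vN NT.
have NTT := vna_comp vN NT' NT; have N1 := vna_id vN.
have : le_op (T' \o T) (c ^+ 2 *: idfun).
  apply/le_opP => y; rewrite /= (adjoint_sym TT') opZE innerZl !innerE.
  by rewrite -exprMn ler_pXn2r// ?nnegrE// mulr_ge0.
move=> /(aut_le NTT (vnaZ vN _ N1)) /le_opP /(_ x).
rewrite (aut_comp NT' NT) (autZ _ N1) aut_id opZE innerZl /=.
rewrite (adjoint_sym (aut_adjoint NT TT')) !innerE -exprMn.
by rewrite ler_pXn2r// ?nnegrE// mulr_ge0.
Qed.

End star_automorphisms.

(** * Normality of automorphisms *)

Section chains.
Context {R : realType} {H : hilbertType R}.
Implicit Types (x y : H) (a b h S T L : H -> H) (D : set (H -> H)).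

(** A bounded increasing chain converges strongly: its forms increase to their supremum, and |(b -
    a) x|^2 <= c <(b - a) x, x> makes the filter of tails Cauchy on each vector. *)
Lemma chain_cvg D (c : R[i]) : 0 < c -> D !=set0 ->
  (forall a b, D a -> D b -> le_op a b \/ le_op b a) ->
  (forall a, D a -> [/\ linear a, pos_op a &
    forall x, inner (a x) x <= c * `|x| ^+ 2]) ->
  exists (F : set_system (H -> H)) L, [/\ ProperFilter F, F D,
    forall a, D a -> F [set b | le_op a b] &
    forall x, b x @[b --> F] --> L x].
Proof.
move=> c0 [a0 Da0] tot DP.
pose B a : set (H -> H) := [set b | D b /\ le_op a b].
pose F := filter_from D B.
have FF : ProperFilter F.
  apply: filter_from_proper; last first.
    by move=> a Da; exists a; split=> //; exact: le_op_refl.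
  apply: filter_from_filter; first by exists a0.
  move=> a b Da Db; have [ab|ba] := tot _ _ Da Db.
    exists b => // d [Dd bd]; split; split=> //.
    exact: le_op_trans bd.
  exists a => // d [Dd ad]; split; split=> //.
  exact: le_op_trans ad.
have Fcv x : cvg (b x @[b --> F]).
  apply: cauchy_cvg; apply/cauchyP => e e0.
  have real_form a : D a -> inner (a x) x \is Num.real.
    by move=> /DP[_ pa _]; exact: ger0_real.
  pose E : set R := [set r | exists2 a, D a & inner (a x) x = r%:C%C].
  have sE : has_sup E.
    split.
      exists (complex.Re (inner (a0 x) x)), a0 => //.
      by rewrite RRe_real ?real_form.
    exists (complex.Re (c * `|x| ^+ 2)) => r [a Da ar].
    have [_ _ /(_ x)] := DP _ Da; rewrite ar lecE => /andP[_].
    by [].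
  (* Chosen so that c d < e^2, the square of the wanted distance. *)
  pose d := e ^+ 2 / c / 2.
  have d0 : 0 < d by rewrite !divr_gt0// exprn_gt0.
  have dr : d = (complex.Re d)%:C%C by rewrite RRe_real// gtr0_real.
  have d1 : 0 < complex.Re d by move: d0; rewrite dr ltcR.
  have [r [a Da ar] rd] := sup_adherent d1 sE.
  exists (a x); exists a => // b [Db ab]; rewrite -ball_normE/= distrC.
  rewrite -(@ltr_pXn2r _ 2)// ?nnegrE// ?(ltW e0)//.
  have [la pa ac] := DP _ Da; have [lb pb bc] := DP _ Db.
  have lba : linear (b - a).
    by move=> k u v; rewrite !opBE la lb scalerBr opprD addrACA.
  have bac y : inner ((b - a) y) y <= c * `|y| ^+ 2.
    rewrite opBE innerBl; apply: le_trans (bc y).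
    by rewrite lerBlDr lerDl.
  have := pos_op_norm_le lba ab c0 bac x; rewrite !opBE.
  move=> /le_lt_trans; apply.
  rewrite -ltr_pdivlMl//.
  apply: (@le_lt_trans _ _ d); last first.
    rewrite /d [e ^+ 2 / c]mulrC gtr_pMr ?mulr_gt0 ?invr_gt0 ?exprn_gt0//.
    by rewrite invf_lt1 ?ltr1n.
  rewrite innerBl ar lerBlDr dr -rmorphD/=.
  have -> : inner (b x) x = (complex.Re (inner (b x) x))%:C%C.
    by rewrite RRe_real// real_form.
  rewrite lecR -lerBlDl; apply: (le_trans _ (ltW rd)); rewrite lerB//.
  apply: (sup_upper_bound sE); exists b => //.
  by rewrite RRe_real// real_form.
exists F, (fun x => lim (b x @[b --> F])); split=> //.
- by exists a0 => // b [].
- by move=> a Da; exists a => // b [].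
Qed.

Section zorn.
Variable N : set (H -> H).
Hypothesis vN : von_neumann_algebra N.

(** The strong limit of a chain is its upper bound: it stays in N because commutation with a bounded
    operator passes to the limit. The last hypothesis asks Q to survive limits from below,
    approximated one vector at a time, which is all that a chain provides. *)
Lemma zorn_interval h (Q : set (H -> H)) : N h -> pos_op h -> Q 0 ->
  (forall D L, D `<=` Q -> N L ->
    (forall b, D b -> [/\ N b, pos_op b & le_op b L]) ->
    (forall x (e : R[i]), 0 < e -> exists2 b, D b & `|L x - b x| < e) ->
    Q L) ->
  exists a, [/\ N a, pos_op a, le_op a h & Q a] /\
    forall b, N b -> le_op a b -> le_op b h -> Q b -> b = a.
Proof.
move=> Nh ph Q0 Qcl.
pose P : set (H -> H) := [set a | [/\ N a, pos_op a, le_op a h & Q a]].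
pose r (s t : {a | P a}) : bool := `[< le_op (sval s) (sval t) >].
have P0 : P 0.
  by split=> //; [exact: (vna0 vN) | exact: pos_op0 | rewrite -pos_opE].
have [||||[a Pa] amax] := @Zorn {a | P a} r.
- by move=> t; apply/asboolP; exact: le_op_refl.
- by move=> s t u /asboolP st /asboolP tu; apply/asboolP; exact: le_op_trans tu.
- move=> [a Pa] [b Pb] /asboolP/= ab /asboolP/= ba; apply: eq_exist => /=.
  case: Pa => Na _ _ _; case: Pb => Nb _ _ _.
  exact: le_op_anti (vna_linear vN Na) (vna_linear vN Nb) ab ba.
- move=> A Atot.
  have [[s0 As0]|A0] := pselect (A !=set0); last first.
    by exists (exist _ 0 P0) => s As; exfalso; apply: A0; exists s.
  pose D : set (H -> H) := [set a | exists2 s, A s & sval s = a].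
  have DP a : D a -> P a by move=> [[b Pb] _ <-].
  have [c c0 hc] := bounded_op_bound (vna_bounded vN Nh).
  have hc2 x : inner (h x) x <= c * `|x| ^+ 2.
    apply: le_trans (real_ler_norm (ger0_real (ph x))) _.
    apply: le_trans (inner_norm_le _ _) _.
    by rewrite expr2 mulrA ler_wpM2r.
  have Dc a : D a -> [/\ linear a, pos_op a &
      forall x, inner (a x) x <= c * `|x| ^+ 2].
    move=> /DP[Na pa ah _]; split=> //; first exact: (vna_linear vN Na).
    by move=> x; apply: le_trans (hc2 x); move/le_opP: ah; exact.
  have [|a b|F [L [FF FD Fle FL]]] := chain_cvg c0 _ _ Dc.
  - by exists (sval s0), s0.
  - move=> [s As <-] [t At <-]; have [/asboolP|/asboolP] := Atot _ _ As At.
      by left.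
    by right.
  have NL : N L.
    have lL : linear L.
      move=> k x y; apply: (cvg_unique _ (FL (k *: x + y))).
        exact: norm_hausdorff.
      have h1 : (k *: b x + b y) @[b --> F] --> k *: L x + L y.
        by apply: cvgD; [apply: cvgZr; exact: FL | exact: FL].
      apply: cvg_trans h1; apply: near_eq_cvg.
      by apply: filterS FD => b /Dc[lb _ _]; rewrite lb.
    apply: (vna_mem vN) => [|S x NS].
      apply: (@bounded_op_intro _ _ _ c) => // x.
      apply: (@cvgC_le _ _ F _ (fun b => `|b x|)).
        by apply: cvg_norm; exact: FL.
      apply: filterS FD => b /Dc[lb pb bc].
      rewrite -(@ler_pXn2r _ 2)// ?nnegrE ?mulr_ge0 ?(ltW c0)// exprMn expr2.
      apply: le_trans (pos_op_norm_le lb pb c0 bc x) _.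
      by rewrite -mulrA ler_wpM2l ?(ltW c0).
    apply: (cvg_unique _ (FL (S x))); first exact: norm_hausdorff.
    have bS : bounded_op S by case: NS.
    apply: cvg_trans (bounded_op_cvg bS (FL x)); apply: near_eq_cvg.
    by apply: filterS FD => b /DP[Nb _ _ _]; rewrite (vna_comm _ Nb NS).
  have Lle b : D b -> le_op b L.
    move=> Db; apply/le_opP => x; rewrite -subr_ge0.
    apply: (@cvgC_ge0 _ _ F _ (fun a => inner (a x) x - inner (b x) x)).
      by apply: cvgB; [apply: inner_cvgl; exact: FL | exact: cvg_cst].
    by apply: filterS (Fle _ Db) => a /le_opP/(_ x); rewrite subr_ge0.
  have Lh : le_op L h.
    apply/le_opP => x; apply: (@cvgC_le _ _ F _ (fun a => inner (a x) x)).
      by apply: inner_cvgl; exact: FL.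
    by apply: filterS FD => a /DP[_ _ /le_opP/(_ x)].
  have pL : pos_op L.
    have Ds0 : D (sval s0) by exists s0.
    rewrite pos_opE; apply: le_op_trans (Lle _ Ds0).
    by rewrite -pos_opE; case: (DP _ Ds0).
  have PL : P L.
    split=> //; apply: (Qcl D) => //.
    + by move=> b /DP[].
    + by move=> b Db; split; [case: (DP _ Db)|case: (DP _ Db)|exact: Lle].
    + move=> x e e0; have /cvgrPdist_lt/(_ _ e0) Fe := FL x.
      by have [b [Db be]] := filter_ex (filterI FD Fe); exists b.
  exists (exist _ L PL) => s As; apply/asboolP; apply: Lle.
  by exists s.
exists a; split=> // b Nb ab bh Qb.
have Pb : P b.
  split=> //; rewrite pos_opE; apply: le_op_trans ab.
  by have [_ pa _ _] := Pa; rewrite -pos_opE.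
have := amax (exist _ b Pb); rewrite /r/= => /(_ (asboolT ab)).
by move=> /(congr1 sval).
Qed.

End zorn.
End chains.

(** * Domination of a transported vector functional *)

Section normality.
Context {R : realType} {H : hilbertType R}.
Implicit Types (x y : H) (a b h S T L : H -> H).

(** Serves to verify the closure condition of [zorn_interval] when Q bounds a form. *)
Lemma form_le_limit (D : set (H -> H)) L x (M : R[i]) :
  (forall b, D b -> le_op b L) ->
  (forall e : R[i], 0 < e -> exists2 b, D b & `|L x - b x| < e) ->
  (forall b, D b -> inner (b x) x <= M) -> inner (L x) x <= M.
Proof.
move=> DL Dlim DM; apply/ler_addgt0Pr => e e0.
have x1 : 0 < `|x| + 1 by rewrite ltr_wpDl.
have [b Db be] := Dlim _ (divr_gt0 e0 x1).
rewrite -[L x](subrK (b x)) innerDl addrC lerD//; first exact: DM.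
have : 0 <= inner (L x - b x) x by have := DL _ Db x; rewrite opBE.
move=> /ger0_norm <-; apply: le_trans (inner_norm_le _ _) _.
move: be; rewrite ltr_pdivlMr// => /ltW; apply: le_trans.
by rewrite ler_wpM2l// lerDl.
Qed.

Lemma form_bound T : bounded_op T -> pos_op T ->
  exists2 c : R[i], 0 < c & forall x, inner (T x) x <= c * `|x| ^+ 2.
Proof.
move=> bT pT; have [c c0 Tc] := bounded_op_bound bT; exists c => // x.
apply: le_trans (real_ler_norm (ger0_real (pT x))) _.
apply: le_trans (inner_norm_le _ _) _.
by rewrite expr2 mulrA ler_wpM2r.
Qed.

Lemma pos_op_form_eq0 T x : bounded_op T -> pos_op T ->
  inner (T x) x = 0 -> T x = 0.
Proof.
move=> bT pT Tx; have [c c0 Tc] := form_bound bT pT.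
have := pos_op_norm_le (bounded_op_linear bT) pT c0 Tc x.
rewrite Tx mulr0 => h; apply/eqP; rewrite -normr_eq0 -sqrf_eq0.
by rewrite eq_le h exprn_ge0.
Qed.

Section automorphism.
Variables (N : set (H -> H)) (alpha beta : (H -> H) -> (H -> H)).
Hypotheses (vN : von_neumann_algebra N).
Hypotheses (aut : star_automorphism N alpha) (aut' : star_automorphism N beta).
Hypothesis betaK : forall T, N T -> alpha (beta T) = T.

(* Dixmier's argument for the normality of a *-isomorphism, with positive
   operators in place of projections.  Zorn's lemma is used twice: first to make
   the functional a |-> <alpha(a) xi, xi> faithful below h, then to dominate it
   by a vector functional below some c <= h. *)
Lemma aut_dominated (d : H -> H) : vna_center N d -> d <> 0 ->
  exists c xi eta, [/\ N c, d (alpha c xi) <> 0 &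
    forall T, N T -> `|alpha T (alpha c xi)| <= `|T (c eta)|].
Proof.
move=> Zd d0; have Nd := center_sub Zd.
have [d' [dd' Nd']] := vna_adjoint_exists vN Nd.
have [xi dxi] : exists xi, d xi <> 0.
  apply: contrapT => h; apply: d0; apply/funext => x.
  by apply: contrapT => dx; apply: h; exists x.
pose p := d' \o d; have Np : N p by exact: vna_comp.
have pp : pos_op p by exact: pos_op_adjoint.
have pE x : inner (p x) x = `|d x| ^+ 2.
  by rewrite /p/= (adjoint_sym dd') innerE.
(* [b0] absorbs a maximal part of [p] on which the vector functional of [xi] vanishes; below
   [p - b0] that functional is faithful. *)
have [b0 [[Nb0 pb0 b0p Qb0] b0max]] :
    exists a, [/\ N a, pos_op a, le_op a p & inner (a xi) xi = 0] /\
      forall b, N b -> le_op a b -> le_op b p -> inner (b xi) xi = 0 -> b = a.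
  apply: (zorn_interval vN Np pp); first by rewrite op0E inner0l.
  move=> D L DQ NL DL Dlim; apply/eqP; rewrite eq_le; apply/andP; split.
    apply: (form_le_limit _ (Dlim xi)); first by move=> b /DL[].
    by move=> b /DQ ->.
  have [b Db _] := Dlim xi _ ltr01; have [_ pb /le_opP/(_ xi)] := DL _ Db.
  exact: le_trans.
have Npb : N (p - b0) by exact: vnaB.
pose h := beta (p - b0); have Nh : N h by exact: (aut_mem aut').
have ph : pos_op h by exact: (aut_pos vN aut').
have ah : alpha h = p - b0 by rewrite /h betaK.
pose phi a := inner (alpha a xi) xi.
have phi_ge0 b : N b -> pos_op b -> 0 <= phi b.
  by move=> Nb pb; exact: (aut_pos vN aut Nb pb).
have phiD b b' : N b -> N b' -> phi (b + b') = phi b + phi b'.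
  by move=> Nb Nb'; rewrite /phi (autD aut)// opDE innerDl.
have faithful b : N b -> pos_op b -> le_op b h -> phi b = 0 -> b = 0.
  move=> Nb pb bh phib; apply: (aut_inj aut Nb (vna0 vN)).
  rewrite (aut0 vN aut).
  have Nab := aut_mem aut Nb.
  have E : b0 + alpha b = b0.
    apply: b0max; first exact: vnaD.
    - rewrite /le_op addrC addKr; exact: (aut_pos vN aut).
    - have := aut_le vN aut Nb Nh bh; rewrite ah /le_op.
      by rewrite opprD addrA.
    - by rewrite opDE innerDl Qb0 add0r.
  by apply: (@addrI _ b0); rewrite E addr0.
have h0 : h <> 0.
  move=> h0; move: ah; rewrite h0 (aut0 vN aut) => /esym/eqP.
  rewrite subr_eq0 => /eqP pb; move: Qb0; rewrite -pb pE => /eqP.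
  by rewrite expf_eq0/= normr_eq0 => /eqP.
have [eta0 heta0] : exists y, inner (h y) y != 0.
  apply: contrapT => hn; apply: h0; apply/funext => y.
  apply: pos_op_form_eq0 => //; first exact: (vna_bounded vN Nh).
  by apply/eqP; apply: contrapT => /negP hy; apply: hn; exists y.
have h1 : 0 < inner (h eta0) eta0 by rewrite lt_def heta0 ph.
(* With q = <h eta0, eta0>, one has k >= 1 and k^2 q >= k q = q + phi h > phi h. *)
pose k := 1 + phi h / inner (h eta0) eta0.
have k1 : 1 <= k by rewrite lerDl divr_ge0// ?(ltW h1)//; exact: phi_ge0.
have k0 : 0 < k by exact: lt_le_trans ltr01 k1.
pose eta := k *: eta0.
have heta : phi h < inner (h eta) eta.
  rewrite /eta (linear_opZ (vna_linear vN Nh)) innerZl innerZr.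
  rewrite conj_Creal ?gtr0_real// mulrA.
  apply: (@lt_le_trans _ _ (k * inner (h eta0) eta0)).
    by rewrite /k mulrDl mul1r divfK// ltrDr.
  by rewrite ler_pM2r// ler_peMl// ltW.
(* Any nonzero b in [0, h - a] with <b eta, eta> <= phi b could be added to a maximal [a]; hence phi
   is dominated on [0, h - a]. The choice of [eta] excludes a = h. *)
have [a [[Na pa ah' Qa] amax]] :
    exists a, [/\ N a, pos_op a, le_op a h & inner (a eta) eta <= phi a] /\
      forall b, N b -> le_op a b -> le_op b h -> inner (b eta) eta <= phi b ->
        b = a.
  apply: (zorn_interval vN Nh ph).
    by rewrite op0E inner0l; apply: phi_ge0; [exact: (vna0 vN)|exact: pos_op0].
  move=> D L DQ NL DL Dlim.
  apply: (form_le_limit _ (Dlim eta)); first by move=> b /DL[].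
  move=> b Db; apply: le_trans (DQ _ Db) _.
  have [Nb _ bL] := DL _ Db.
  by have /le_opP := aut_le vN aut Nb NL bL; apply.
pose c := h - a; have Nc : N c by exact: vnaB.
have pc : pos_op c by exact: ah'.
have ch : le_op c h by rewrite /le_op /c opprB addrC subrK.
have dominated b : N b -> pos_op b -> le_op b c ->
    phi b <= inner (b eta) eta.
  move=> Nb pb bc.
  have r1 : phi b \is Num.real by apply: ger0_real; exact: phi_ge0.
  have r2 : inner (b eta) eta \is Num.real by exact: ger0_real.
  have [//|lt] := real_leP r1 r2.
  suff b0E : b = 0.
    by move: lt; rewrite b0E /phi (aut0 vN aut) !op0E !inner0l ltxx.
  have E : a + b = a.
    apply: amax; first exact: vnaD.
    - by rewrite /le_op addrC addKr.
    - by move: bc; rewrite /le_op /c opprD addrA.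
    - by rewrite opDE innerDl phiD// lerD// ltW.
  by apply: (@addrI _ a); rewrite E addr0.
have phic : phi c <> 0.
  move=> /(faithful _ Nc pc ch) c0.
  have ha : h = a by apply/eqP; rewrite -subr_eq0 -/c c0.
  by move: Qa; rewrite -ha => /(lt_le_trans heta); rewrite ltxx.
have pac := aut_pos vN aut Nc pc; have Nac := aut_mem aut Nc.
have bac := vna_bounded vN Nac.
exists c, xi, eta; split=> //.
(* alpha(c) <= p = d^* d, so a vector killed by d is killed by alpha(c); for the vector alpha(c) xi
   this gives alpha(c) xi = 0. *)
- move=> dc; apply: phic; rewrite /phi.
  suff -> : alpha c xi = 0 by rewrite inner0l.
  have cc : alpha c (alpha c xi) = 0.
    apply: pos_op_form_eq0 => //; apply/eqP; rewrite eq_le pac andbT.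
    have : le_op (alpha c) p.
      apply: le_op_trans (aut_le vN aut Nc Nh ch) _.
      by rewrite ah /le_op opprB addrC subrK.
    move=> /le_opP/(_ (alpha c xi)).
    by rewrite pE dc normr0 expr0n.
  apply: inner_eq0.
  by rewrite -(pos_op_selfadjoint (bounded_op_linear bac) pac) cc inner0l.
- move=> T NT; have [T' [TT' NT']] := vna_adjoint_exists vN NT.
  have [q q0 Tq] := bounded_op_bound (vna_bounded vN NT).
  have [C C0 cC] := form_bound (vna_bounded vN Nc) pc.
  have lc := vna_linear vN Nc.
  have csym := pos_op_selfadjoint lc pc.
  have K0 : 0 < q ^+ 2 * C by rewrite mulr_gt0// exprn_gt0.
  (* c T^* T c <= q^2 c^2 <= q^2 C c, so a multiple of m lies in [0, c], where phi is dominated. The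
     two sides of that inequality are the squared norms to be compared. *)
  pose m := c \o (T' \o (T \o c)).
  have NTc : N (T \o c) by exact: vna_comp.
  have NTTc : N (T' \o (T \o c)) by exact: vna_comp.
  have Nm : N m by exact: vna_comp.
  have mE x : inner (m x) x = `|T (c x)| ^+ 2.
    by rewrite /m/= csym (adjoint_sym TT') innerE.
  have := dominated ((q ^+ 2 * C)^-1 *: m) (vnaZ vN _ Nm).
  rewrite /phi (autZ vN aut)// !opZE !innerZl mE ler_pM2l ?invr_gt0//.
  have -> : inner (alpha m xi) xi = `|alpha T (alpha c xi)| ^+ 2.
    rewrite /m (aut_comp aut)// (aut_comp aut)// (aut_comp aut)//=.
    rewrite (pos_op_selfadjoint (bounded_op_linear bac) pac).
    by rewrite (adjoint_sym (aut_adjoint aut NT TT')) innerE.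
  rewrite ler_pXn2r// ?nnegrE//; apply.
    apply: pos_opZ; first by rewrite invr_ge0 ltW.
    by move=> x; rewrite mE exprn_ge0.
  apply/le_opP => x; rewrite opZE innerZl mE ler_pdivrMl//.
  apply: (@le_trans _ _ (q ^+ 2 * `|c x| ^+ 2)).
    by rewrite -exprMn ler_pXn2r// ?nnegrE// mulr_ge0// ltW.
  rewrite -[leRHS]mulrA ler_wpM2l ?exprn_ge0 ?(ltW q0)//.
  exact: pos_op_norm_le.
Qed.

End automorphism.
End normality.

(** * Intertwiners, and closedness of automorphisms on the center *)

Section intertwiners.
Context {R : realType} {H : hilbertType R}.
Implicit Types (x y : H) (a b h S T L : H -> H).
Variables (N : set (H -> H)) (alpha beta : (H -> H) -> (H -> H)).
Hypotheses (vN : von_neumann_algebra N).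
Hypotheses (aut : star_automorphism N alpha) (aut' : star_automorphism N beta).
Hypothesis betaK : forall T, N T -> alpha (beta T) = T.

(* The intertwiner is the adjoint of T (c eta) |-> alpha(T) (alpha(c) xi). *)
Lemma aut_intertwiner (d : H -> H) : vna_center N d -> d <> 0 ->
  exists s : H -> H, [/\ bounded_op s,
    forall T x, N T -> T (s x) = s (alpha T x) &
    exists x, s (d x) <> 0].
Proof.
move=> Zd d0; have Nd := center_sub Zd.
have [d' [dd' Nd']] := vna_adjoint_exists vN Nd.
have Zd' := center_adjoint vN Zd dd'.
have d'0 : d' <> 0.
  move=> d'0; apply: d0; apply/funext => x; apply: inner_ext => z.
  by rewrite -(adjoint_sym dd') d'0 !op0E inner0l inner0r.
(* Domination is taken for the adjoint of d because the final test is <v0, d d^* v0> = |d^*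
   v0|^2. *)
have [c [xi [eta [Nc dxi dom]]]] :=
  aut_dominated vN aut aut' betaK Zd' d'0.
pose u0 := c eta; pose v0 := alpha c xi.
pose cl u := forall e : R[i], 0 < e -> exists2 T, N T & `|u - T u0| < e.
have cl_lin k u u' : cl u -> cl u' -> cl (k *: u + u').
  move=> cu cu' e e0; have k1 : 0 < `|k| + 1 by rewrite ltr_wpDl.
  have e1 : 0 < e / 2 / (`|k| + 1) by rewrite !divr_gt0.
  have [T NT Tu] := cu _ e1.
  have [T' NT' Tu'] := cu' _ (divr_gt0 e0 (ltr0n _ 2)).
  exists (k *: T + T'); first exact: vna_lin.
  rewrite opDE opZE opprD addrACA -scalerBr [e]splitr.
  apply: le_lt_trans (ler_normD _ _) _; rewrite ltr_leD// ?(ltW Tu')//.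
  rewrite normrZ; apply: le_lt_trans (_ : _ <= (`|k| + 1) * `|u - T u0|) _.
    by rewrite ler_wpM2r// lerDl.
  by rewrite mulrC -ltr_pdivlMr.
(* [u] represents T u0 |-> <alpha(T) v0, zeta>, bounded since |alpha(T) v0| <= |T u0|. Requiring [u]
   to lie in the closure of N u0 makes it unique, whence linearity and the intertwining relation. *)
pose rep zeta u := cl u /\
  forall T, N T -> inner (T u0) u = inner (alpha T v0) zeta.
have rep_ex zeta : exists u, rep zeta u.
  pose G v (z : R[i]) := exists T, [/\ N T, v = T u0 &
    z = inner (alpha T v0) zeta].
  have id1 x : 1 * `|x| ^+ 2 <= inner (idfun x) x by rewrite mul1r innerE.
  have [|||u [ucl uG]] := @coercive_representation _ H idfun 1 `|zeta| G
    (vna_bounded vN (vna_id vN)) (@adjoint_id _ H) ltr01 (normr_ge0 _) id1.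
  - exists 0; split; first exact: (vna0 vN).
      by rewrite op0E.
    by rewrite (aut0 vN aut) op0E inner0l.
  - move=> k v z w y [T [NT -> ->]] [T' [NT' -> ->]].
    exists (k *: T + T'); split; first exact: vna_lin.
      by [].
    by rewrite (aut_lin aut)// opDE opZE innerDl innerZl.
  - move=> v z [T [NT -> ->]]; apply: le_trans (inner_norm_le _ _) _.
    by rewrite mulrC ler_wpM2l// dom.
  exists u; split; last by move=> T NT; apply: (uG); exists T.
  move=> e e0; have [v [z [[T [NT -> _]] ue]]] := ucl _ e0.
  by exists T.
have rep_uniq zeta u u' : rep zeta u -> rep zeta u' -> u = u'.
  move=> [cu ru] [cu' ru'].
  pose w := (-1) *: u + u'; have cw : cl w by exact: cl_lin.
  have w0 T : N T -> inner (T u0) w = 0.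
    move=> NT; rewrite innerDr innerZr ru// ru'//.
    by rewrite rmorphN/= rmorph1 mulN1r addNr.
  suff : w = 0.
    by rewrite /w scaleN1r addrC => /eqP; rewrite subr_eq0 => /eqP.
  apply/eqP; rewrite -normr_eq0; apply/eqP.
  apply/eqP; rewrite eq_le normr_ge0 andbT; apply/ler_addgt0Pr => e e0.
  rewrite add0r; have [T NT Tw] := cw _ e0.
  have [->|wn0] := eqVneq w 0; first by rewrite normr0 ltW.
  rewrite -(@ler_pM2r _ `|w|) ?normr_gt0// -expr2 -innerE.
  rewrite -{1}(subrK (T u0) w) innerDl w0// addr0.
  apply: le_trans (real_ler_norm _) _.
    have -> : inner (w - T u0) w = inner w w by rewrite innerBl w0// subr0.
    by rewrite ger0_real// inner_ge0.
  apply: le_trans (inner_norm_le _ _) _.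
  by rewrite ler_wpM2r// ltW.
pose s zeta := projT1 (cid (rep_ex zeta)).
have sP zeta : rep zeta (s zeta) by rewrite /s; case: cid.
have ls : linear s.
  move=> k x y; apply: (rep_uniq (k *: x + y)); first exact: sP.
  have [c1 r1] := sP x; have [c2 r2] := sP y.
  split=> [|T NT]; first exact: cl_lin.
  by rewrite !innerDr !innerZr r1// r2.
have s_norm x : `|s x| <= 1 * `|x|.
  rewrite mul1r; have [cu ru] := sP x; set u := s x in cu ru *.
  have [->|un0] := eqVneq u 0; first by rewrite normr0.
  have u_gt0 : 0 < `|u| by rewrite normr_gt0.
  have ux T : N T -> `|inner (T u0) u| <= `|T u0| * `|x|.
    move=> NT; rewrite ru//; apply: le_trans (inner_norm_le _ _) _.
    by rewrite ler_wpM2r// dom.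
  rewrite -(ler_pM2l u_gt0) -expr2 -innerE.
  have k0 : 0 < `|u| + `|x| + 1 by rewrite ltr_wpDl// addr_ge0.
  apply/ler_addgt0Pr => e e0; have [T NT Tu] := cu _ (divr_gt0 e0 k0).
  rewrite -(ger0_norm (inner_ge0 u)) -{1}(subrK (T u0) u) innerDl.
  apply: le_trans (ler_normD _ _) _.
  apply: (@le_trans _ _ (`|u - T u0| * `|u| + `|T u0| * `|x|)).
    by rewrite lerD ?ux//; exact: inner_norm_le.
  apply: (@le_trans _ _ (`|u - T u0| * `|u| + (`|u| + `|u - T u0|) * `|x|)).
    rewrite lerD2l ler_wpM2r// -{1}(subKr u (T u0)).
    exact: ler_normB.
  rewrite [leLHS](_ : _ = `|u| * `|x| + `|u - T u0| * (`|u| + `|x|)); last first.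
    by ring.
  rewrite lerD2l; move: Tu; rewrite ltr_pdivlMr// => /ltW; apply: le_trans.
  by rewrite ler_wpM2l// lerDl.
exists s; split.
- exact: bounded_op_intro ls s_norm.
- move=> T x NT; apply: (rep_uniq (alpha T x)); last exact: sP.
  have [cu ru] := sP x; have [T' [TT' NT']] := vna_adjoint_exists vN NT.
  split=> [e e0|S NS].
    have [k k0 Tk] := bounded_op_bound (vna_bounded vN NT).
    have [S NS Su] := cu _ (divr_gt0 e0 k0).
    exists (T \o S); first exact: vna_comp.
    rewrite /= -(linear_opB (vna_linear vN NT)); apply: le_lt_trans (Tk _) _.
    by rewrite mulrC -ltr_pdivlMr.
  rewrite -(adjoint_sym TT') -[T' (S u0)]/((T' \o S) u0) ru; last first.
    exact: vna_comp.
  by rewrite (aut_comp aut)//= (adjoint_sym (aut_adjoint aut NT TT')).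
- exists (d' v0) => sd0; have [_ /(_ idfun (vna_id vN))] := sP (d (d' v0)).
  rewrite sd0 inner0r (aut_id vN aut)/= -(adjoint_sym dd') => /esym/inner_eq0.
  exact: dxi.
Qed.

(* This is the form in which normality of alpha is used. *)
Lemma aut_center_closed (F : set_system nat) {FF : ProperFilter F}
    (u : nat -> H -> H) a b :
  (forall n, vna_center N (u n)) -> vna_center N a -> vna_center N b ->
  (forall x, u n x @[n --> F] --> a x) ->
  (forall x, alpha (u n) x @[n --> F] --> b x) -> alpha a = b.
Proof.
move=> Zu Za Zb ua ub; apply/eqP; rewrite -subr_eq0; apply/eqP.
have vZ := vna_center_vna vN.
apply: contrapT => ab0.
have Zab : vna_center N (alpha a - b).
  by apply: (vnaB vZ) => //; exact: (aut_center vN aut).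
(* s b x = lim s alpha(u_n) x = lim u_n s x = a s x = s alpha(a) x, so s vanishes on (alpha(a) - b)
   x for every x. *)
have [s [bs ss [x sx]]] := aut_intertwiner Zab ab0.
apply: sx; rewrite opBE (linear_opB (bounded_op_linear bs)).
apply/eqP; rewrite subr_eq0; apply/eqP.
rewrite -ss; last exact: center_sub.
apply: (cvg_unique _ (ua (s x))); first exact: norm_hausdorff.
apply: cvg_trans (bounded_op_cvg bs (ub x)); apply: near_eq_cvg.
by apply: nearW => n; rewrite ss//; exact: center_sub.
Qed.

End intertwiners.

(** * Periodic functions and Fourier coefficients *)

Section riemann_means.
Context {R : realType} {K : numFieldType} {V : completeNormedModType K}.
Implicit Types (f g : R -> V) (N M n i j k : nat) (u v : R).

Definition mean_sum N f : V :=
  N%:R^-1 *: \sum_(0 <= j < N) f (j%:R / N%:R).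

(** Plays the role of the integral of f over [0, 1]. Dyadic subdivisions refine one another, so two
    sums compare cell by cell. *)
Definition has_mean f (l : V) : Prop :=
  mean_sum (2 ^ n) f @[n --> \oo] --> l.

Lemma has_mean_unique f l l' : has_mean f l -> has_mean f l' -> l = l'.
Proof. by apply: cvg_unique; exact: norm_hausdorff. Qed.

Lemma has_mean_lin (a : K) f g l m : has_mean f l -> has_mean g m ->
  has_mean (fun u => a *: f u + g u) (a *: l + m).
Proof.
move=> fl gm; rewrite /has_mean.
rewrite [X in X @ _ --> _](_ : _ = fun n =>
  a *: mean_sum (2 ^ n) f + mean_sum (2 ^ n) g).
  by apply: cvgD; [apply: cvgZr | ].
apply/funext => n; rewrite /mean_sum scalerA mulrC -scalerA -scalerDr.
by rewrite big_split/= scaler_sumr.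
Qed.

Lemma mean_sum_cst N (l : V) : (0 < N)%N -> mean_sum N (fun=> l) = l.
Proof.
move=> N0; rewrite /mean_sum big_const_nat subn0 iter_addr addr0.
by rewrite -[l *+ N]scaler_nat scalerA mulVf ?scale1r// pnatr_eq0 -lt0n.
Qed.

Lemma has_mean_cst (l : V) : has_mean (fun=> l) l.
Proof.
rewrite /has_mean (_ : (fun n => _) = fun=> l); first exact: cvg_cst.
by apply/funext => n; rewrite mean_sum_cst// expn_gt0.
Qed.

Lemma has_meanZ (a : K) f l : has_mean f l ->
  has_mean (fun u => a *: f u) (a *: l).
Proof.
move=> fl; have := has_mean_lin (a := a) fl (@has_mean_cst 0); rewrite addr0.
by congr has_mean; apply/funext => u; rewrite addr0.
Qed.

Lemma mean_sum_norm_le N f (c : K) : (0 < N)%N ->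
  (forall j, (j < N)%N -> `|f (j%:R / N%:R)| <= c) -> `|mean_sum N f| <= c.
Proof.
move=> N0 fc; rewrite /mean_sum normrZ normfV normr_nat.
rewrite ler_pdivrMl ?ltr0n//; apply: le_trans (ler_norm_sum _ _ _) _.
rewrite -[N in leRHS]subn0 mulr_natl -sumr_const_nat big_nat [leRHS]big_nat.
by apply: ler_sum => j /andP[_]; exact: fc.
Qed.

Lemma mean_sumB N f g :
  mean_sum N f - mean_sum N g = mean_sum N (fun u => f u - g u).
Proof. by rewrite /mean_sum -scalerBr -sumrB. Qed.

Lemma sum_nat_mul N M (F : nat -> V) :
  \sum_(0 <= i < N * M) F i =
  \sum_(0 <= j < N) \sum_(0 <= k < M) F (j * M + k)%N.
Proof.
elim: N => [|N IH]; first by rewrite mul0n !big_geq.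
rewrite big_nat_recr//= -IH mulSn addnC.
rewrite (@big_cat_nat _ _ _ (N * M)%N) ?leq_addr//=; congr (_ + _).
rewrite -{1}[(N * M)%N]add0n big_addn addKn.
by apply: eq_bigr => i _; rewrite addnC.
Qed.

(** Heine's theorem with v left free, so that only one of two sample points has to be placed in the
    segment. *)
Lemma uniformly_continuous_near_segment f (a b : R) (e : K) : 0 < e ->
  continuous f -> exists2 d : R, 0 < d &
    forall u v, a <= u <= b -> `|u - v| < d -> `|f u - f v| < e.
Proof.
move=> e0 fc.
have /compact_near_coveringP cov := @segment_compact R a b.
have dcov : \forall d \near (0 : R)^'+, [set` `[a, b]] `<=` [set u | forall v,
    `|u - v| < d -> `|f u - f v| < e].
  apply: cov => x _.
  have e2 : 0 < e / 2 by rewrite divr_gt0.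
  have := fc x => /cvgrPdist_lt/(_ _ e2).
  move=> /nbhs_ballP[r /= r0 fr].
  have r2 : 0 < r / 2 by rewrite divr_gt0.
  exists (ball x (r / 2), [set d | d < r / 2]) => /=.
    by split; [exact: nbhsx_ballx | exact: nbhs_right_lt].
  move=> [u d]/= [xu dr] v uv.
  rewrite [e]splitr -(subrKA (f x)); apply: le_lt_trans (ler_normD _ _) _.
  apply: ltrD.
    rewrite distrC; apply: fr; apply: le_ball xu.
    by rewrite ler_pdivrMr// ler_peMr ?(ltW r0)// ler1n.
  apply: fr; rewrite -ball_normE/= in xu *.
  rewrite [r]splitr -(subrKA u); apply: le_lt_trans (ler_normD _ _) _.
  by rewrite ltrD// (lt_trans uv).
have [d [dP d0]] := filter_ex (filterI dcov (nbhs_right_gt (0 : R))).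
by exists d => // u v uab; apply: dP; rewrite /= in_itv.
Qed.

Lemma small_dyadic (d : R) : 0 < d ->
  exists n0, forall n, (n0 <= n)%N -> ((2 ^ n)%:R : R)^-1 < d.
Proof.
move=> d0; have : `|(2^-1 : R)| < 1.
  by rewrite ger0_norm ?invr_ge0// invf_lt1 ?ltr1n.
move=> /cvg_expr /cvgrPdist_lt /(_ _ d0)[n0 _ h].
exists n0 => n n0n; have := h n n0n.
by rewrite /= sub0r normrN normrX ger0_norm ?invr_ge0// exprVn natrX.
Qed.

Lemma has_mean_exists f : continuous f -> exists l, has_mean f l.
Proof.
move=> fc; suff : cvgn (fun n => mean_sum (2 ^ n) f).
  by move=> cv; exists (limn (fun n => mean_sum (2 ^ n) f)).
apply: cauchy_cvg; apply/cauchyP => e e0.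
have e2 : 0 < e / 2 by rewrite divr_gt0.
have [d d0 fd] := uniformly_continuous_near_segment 0 1 e2 fc.
have [n0 n0d] := small_dyadic d0.
pose N := (2 ^ n0)%N; have N0 : (0 < N)%N by rewrite expn_gt0.
exists (mean_sum N f); exists n0 => //= n n0n; rewrite -ball_normE/=.
have [m ->] : exists m, n = (n0 + m)%N by exists (n - n0)%N; rewrite subnKC.
rewrite expnD -/N; set M := (2 ^ m)%N; have M0 : (0 < M)%N by rewrite expn_gt0.
have MR : M%:R != 0 :> K by rewrite pnatr_eq0 -lt0n.
have NM0 : (N * M)%:R != 0 :> K by rewrite pnatr_eq0 muln_eq0 negb_or -!lt0n N0.
have NMR : (0 : R) < (N * M)%:R by rewrite ltr0n muln_gt0 N0.
apply: (@le_lt_trans _ _ (e / 2)); last first.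
  by rewrite ltr_pdivrMr// ltr_pMr ?ltr1n.
(* The coarse sum is written on the fine grid by repeating each value M times. *)
have -> : mean_sum N f = (N * M)%:R^-1 *:
    \sum_(0 <= j < N) \sum_(0 <= k < M) f (j%:R / N%:R).
  rewrite /mean_sum; under [in RHS]eq_bigr do
    rewrite big_const_nat subn0 iter_addr addr0 -[_ *+ M]scaler_nat.
  rewrite -scaler_sumr scalerA natrM invfM -mulrA mulVf// mulr1.
  by [].
rewrite /mean_sum sum_nat_mul -scalerBr -sumrB normrZ normfV normr_nat.
rewrite ler_pdivrMl ?ltr0n ?muln_gt0 ?N0//.
apply: le_trans (ler_norm_sum _ _ _) _.
have -> : (N * M)%:R * (e / 2) = N%:R * (M%:R * (e / 2)).
  by rewrite natrM -mulrA.
rewrite -[N in leRHS]subn0 [leRHS]mulr_natl -sumr_const_nat.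
rewrite big_nat [leRHS]big_nat.
apply: ler_sum => j /andP[_ jN]; rewrite -sumrB.
apply: le_trans (ler_norm_sum _ _ _) _.
rewrite -[M in leRHS]subn0 [leRHS]mulr_natl -sumr_const_nat.
rewrite big_nat [leRHS]big_nat.
apply: ler_sum => k /andP[_ kM]; apply/ltW/fd.
  rewrite divr_ge0//= ler_pdivrMr ?ltr0n// mul1r ler_nat; exact: ltnW.
apply: le_lt_trans (n0d _ (leqnn n0)); rewrite -/N distrC.
have NR : N%:R != 0 :> R by rewrite pnatr_eq0 -lt0n.
have MR' : M%:R != 0 :> R by rewrite pnatr_eq0 -lt0n.
rewrite [X in `|X|](_ : _ = k%:R / (N * M)%:R); last first.
  by rewrite natrD !natrM; field; rewrite NR MR'.
rewrite ger0_norm ?divr_ge0// natrM invfM mulrCA ler_piMr ?invr_ge0//.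
by rewrite ler_pdivrMr ?ltr0n// mul1r ler_nat ltnW.
Qed.

(** A shift by one node permutes the nodes cyclically modulo the period. *)
Lemma mean_sum_shift N j f : (forall u, f (u + 1) = f u) -> (0 < N)%N ->
  mean_sum N (fun u => f (u + j%:R / N%:R)) = mean_sum N f.
Proof.
move=> f1 N0; have NR : N%:R != 0 :> R by rewrite pnatr_eq0 -lt0n.
elim: j => [|j <-].
  by congr mean_sum; apply/funext => u; rewrite mul0r addr0.
rewrite /mean_sum; congr (_ *: _); case: N N0 NR => // N _ NR.
rewrite big_nat_recr//= [in RHS]big_nat_recl//= addrC; congr (_ + _).
  rewrite -[RHS]f1; congr f.
  by rewrite -[N.+1%:R]natr1 -[j.+1%:R]natr1 in NR *; field.
apply: eq_bigr => i _; congr f.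
by rewrite -[N.+1%:R]natr1 -[j.+1%:R]natr1 -[i.+1%:R]natr1 in NR *; field.
Qed.

(** A shift v >= 0 is a whole number of nodes, which leaves the sum unchanged, plus a remainder
    below 1 / N, absorbed by uniform continuity. *)
Lemma has_mean_shift f l v : continuous f -> (forall u, f (u + 1) = f u) ->
  has_mean f l -> has_mean (fun u => f (u + v)) l.
Proof.
move=> fc f1 fl.
have fn (n : nat) u : f (u + n%:R) = f u.
  by elim: n => [|n IH]; rewrite ?addr0// -natr1 addrA f1.
wlog v0 : v / 0 <= v.
  move=> h; pose n := (Num.trunc `|v|).+1.
  have nv : `|v| < n%:R.
    by have /andP[_] := truncn_itv (normr_ge0 v).
  have /h : 0 <= v + n%:R.
    rewrite -lerBlDl sub0r; apply: le_trans (ltW nv).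
    by rewrite -normrN ler_norm.
  by congr has_mean; apply/funext => u; rewrite addrA fn.
apply/cvgrPdist_lt => e e0.
have e2 : 0 < e / 2 by rewrite divr_gt0.
have [d d0 fd] := uniformly_continuous_near_segment 0 1 e2 fc.
have [n0 n0d] := small_dyadic d0.
move/cvgrPdist_lt: fl => /(_ _ e2) fl.
near=> n.
have N0 : (0 < 2 ^ n)%N by rewrite expn_gt0.
have nd : ((2 ^ n)%:R : R)^-1 < d.
  by apply: n0d; near: n; exact: nbhs_infty_ge.
have fln : `|l - mean_sum (2 ^ n) f| < e / 2 by near: n.
set N := (2 ^ n)%N in N0 nd fln *; have NR : (0 : R) < N%:R by rewrite ltr0n.
pose j := Num.trunc (v * N%:R).
pose r := v - j%:R / N%:R.
have r0 : 0 <= r < N%:R^-1.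
  have := truncn_itv (mulr_ge0 v0 (ltW NR)); rewrite -/j => /andP[j1 j2].
  rewrite subr_ge0 ler_pdivrMr// j1/= ltrBlDr.
  by rewrite -{1}[N%:R^-1]mul1r -mulrDl ltr_pdivlMr// addrC natr1.
rewrite -(subrKA (mean_sum N f)) [e]splitr.
apply: le_lt_trans (ler_normD _ _) _.
apply: ltr_leD; first exact: fln.
have -> : mean_sum N (fun u => f (u + v)) =
    mean_sum N (fun u => f (u + r)).
  rewrite -[RHS](@mean_sum_shift N j) => // [|u]; last by rewrite addrAC f1.
  congr mean_sum; apply/funext => u.
  by rewrite -addrA; congr (f (_ + _)); rewrite /r [RHS]addrC subrK.
rewrite mean_sumB; apply: mean_sum_norm_le => // i iN.
apply/ltW/fd.
  rewrite divr_ge0//= ler_pdivrMr// mul1r ler_nat; exact: ltnW.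
rewrite opprD addrA subrr sub0r normrN; case/andP: r0 => r0 r1.
by rewrite ger0_norm//; exact: lt_trans nd.
Unshelve. all: by end_near. Qed.

End riemann_means.

(** * Characters and uniqueness of Fourier coefficients *)

Section fourier.
Context {R : realType}.
Implicit Types (u v x y : R) (m : int) (n : nat).

Lemma expiD x y : expi (x + y) = expi x * expi y.
Proof.
by rewrite /expi cosD sinD; apply/eqP; rewrite eq_complex/= eqxx/= addrC.
Qed.

Lemma expi0 : expi (0 : R) = 1.
Proof. by rewrite /expi cos0 sin0. Qed.

Lemma expi_pi : expi (pi : R) = -1.
Proof.
by rewrite /expi cospi sinpi; apply/eqP; rewrite eq_complex/= oppr0 !eqxx.
Qed.

Lemma expiN x : expi (- x) = (expi x)^*.
Proof. by rewrite /expi cosN sinN. Qed.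

Lemma expi_norm x : `|expi x| = 1.
Proof.
apply/eqP; rewrite -(@pexpr_eq1 _ _ 2)// normCK -expiN -expiD subrr expi0.
by [].
Qed.

Lemma expi_mulrn x n : expi (x * n%:R) = expi x ^+ n.
Proof.
elim: n => [|n IH]; first by rewrite mulr0 expi0.
by rewrite -natr1 mulrDr mulr1 expiD IH exprSr.
Qed.

Lemma expi_2pi : expi (2 * pi : R) = 1.
Proof. by rewrite mulrC expi_mulrn expi_pi sqrrN expr1n. Qed.

Lemma expi_int m : expi (2 * pi * m%:~R : R) = 1.
Proof.
case: m => n; first by rewrite -pmulrn expi_mulrn expi_2pi expr1n.
by rewrite NegzE mulrNz mulrN expiN -pmulrn expi_mulrn expi_2pi expr1n rmorph1.
Qed.

Lemma realC_cvg (T : Type) (F : set_system T) {FF : Filter F} (f : T -> R)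
    (l : R) : f t @[t --> F] --> l -> (f t)%:C%C @[t --> F] --> (l%:C%C : R[i]).
Proof.
move=> /cvgrPdist_lt fl; apply/cvgrPdist_lt => e e0.
have er : e = (complex.Re e)%:C%C by rewrite RRe_real// gtr0_real.
have e1 : 0 < complex.Re e by move: e0; rewrite er ltcR.
have := fl _ e1; apply: filterS => t h.
by rewrite -rmorphB/= normc_def/= expr0n/= addr0 sqrtr_sqr er ltcR.
Qed.

Lemma continuous_expi : continuous (expi : R -> R[i]).
Proof.
have -> : expi = (fun x => (cos x)%:C%C + 'i%C * (sin x)%:C%C) :> (R -> R[i]).
  apply/funext => x; apply/eqP; rewrite eq_complex/=.
  by rewrite ?(mul0r, mul1r, mulr0, subr0, addr0, add0r) !eqxx.
move=> x; apply: cvgD.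
  by apply: realC_cvg; exact: continuous_cos.
apply: cvgM; first exact: cvg_cst.
by apply: realC_cvg; exact: continuous_sin.
Qed.

Definition char m u : R[i] := expi (2 * pi * m%:~R * u).

Lemma charD m u v : char m (u + v) = char m u * char m v.
Proof. by rewrite /char mulrDr expiD. Qed.

Lemma charM m m' u : char (m + m') u = char m u * char m' u.
Proof. by rewrite /char -expiD intrD mulrDr mulrDl. Qed.

Lemma char1 m : char m 1 = 1.
Proof. by rewrite /char mulr1 expi_int. Qed.

Lemma char0 u : char 0 u = 1.
Proof. by rewrite /char mulr0z mulr0 mul0r expi0. Qed.

Lemma continuous_char m : continuous (char m).
Proof.
move=> u; apply: (@continuous_comp _ _ _ (fun u => 2 * pi * m%:~R * u) expi).
  by apply: cvgM; [exact: cvg_cst | exact: cvg_id].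
exact: continuous_expi.
Qed.

Section means.
Variable V : completeNormedModType R[i].

Lemma continuous_charZ m (f : R -> V) : continuous f ->
  continuous (fun u => char m u *: f u).
Proof. by move=> fc u; apply: cvgZ; [exact: continuous_char | exact: fc]. Qed.

(** A shift by 1 / (2 m) preserves the mean and changes the sign of the character. *)
Lemma has_mean_char m (y : V) : m != 0 -> has_mean (fun u => char m u *: y) 0.
Proof.
move=> m0; have c : continuous (fun u => char m u *: y).
  by apply: continuous_charZ => u; exact: cvg_cst.
have [l hl] := has_mean_exists c.
have per u : char m (u + 1) *: y = char m u *: y.
  by rewrite charD char1 mulr1.
have h1 := has_mean_shift (2 * m%:~R)^-1 c per hl.
have h2 : has_mean (fun u => char m (u + (2 * m%:~R)^-1) *: y) (-1 *: l).
  have := has_meanZ (a := -1) hl; congr has_mean; apply/funext => u.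
  rewrite charD scalerA mulrC; congr (_ * _ *: _).
  rewrite /char (_ : _ * _ = pi) ?expi_pi//.
  by field; rewrite intr_eq0.
have := has_mean_unique h1 h2; rewrite scaleN1r => /eqP.
rewrite -subr_eq0 opprK -mulr2n -scaler_nat scaler_eq0 pnatr_eq0/= => /eqP l0.
by rewrite -l0.
Qed.

(** Equal to cos^2(pi u): a trigonometric polynomial with values in [0, 1] that reaches 1 at the
    integers only, so its powers concentrate there. *)
Let k u : R := (1 + cos (2 * pi * u)) / 2.

Let kC u : (k u)%:C%C = 2^-1 + 4^-1 * char 1 u + 4^-1 * char (-1) u.
Proof.
have h : char 1 u + char (-1) u = (2 * cos (2 * pi * u))%:C%C.
  rewrite /char mulrNz mulrN mulr1 mulNr expiN /expi.
  apply/eqP; rewrite eq_complex/= subrr eqxx andbT.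
  by apply/eqP; ring.
rewrite -addrA -mulrDr h /k rmorphM/= rmorphD/= rmorphM/= fmorphV/=.
rewrite rmorph1 rmorphMn/= !rmorph1.
by field.
Qed.

Let k_ge0 u : 0 <= k u.
Proof. by rewrite divr_ge0// -lerBlDl sub0r cos_geN1. Qed.

Let k_le1 u : k u <= 1.
Proof. by rewrite ler_pdivrMr// mul1r [leRHS](natrD _ 1 1) lerD2l cos_le1. Qed.

Let k_per u : k (u + 1) = k u.
Proof. by rewrite /k mulrDr mulr1 mulr_natl cosD2pi. Qed.

Let continuous_k : continuous k.
Proof.
move=> u; apply: cvgM; last exact: cvg_cst.
apply: cvgD; first exact: cvg_cst.
apply: (@continuous_comp _ _ _ (fun u => 2 * pi * u) cos).
  by apply: cvgM; [exact: cvg_cst | exact: cvg_id].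
exact: continuous_cos.
Qed.


Section kernel_powers.
Variable f : R -> V.
Hypotheses (fc : continuous f) (f_per : forall u, f (u + 1) = f u).
Hypothesis f_char : forall m, has_mean (fun u => char m u *: f u) 0.

(** Powers of k are trigonometric polynomials. A factor k moves m by at most 1, so the induction
    runs over all m at once. *)
Let kernel_mean n m : has_mean (fun u => (char m u * (k u ^+ n)%:C%C) *: f u) 0.
Proof.
elim: n m => [|n IH] m.
  have := f_char m; congr has_mean; apply/funext => u.
  by rewrite expr0 mulr1.
have := has_mean_lin (a := 2^-1) (IH m) (has_mean_lin (a := 4^-1) (IH (m + 1))
  (has_meanZ (a := 4^-1) (IH (m - 1)))).
rewrite !scaler0 !addr0; congr has_mean; apply/funext => u.
rewrite !scalerA -!scalerDl !charM exprSr rmorphM/= kC; congr (_ *: _).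
by ring.
Qed.

(** Near 0 continuity gives delta; elsewhere in [-1/2, 1/2] the factor 1 - k is positive and a large
    L dominates. Compactness makes L uniform, and periodicity carries the bound to [0, 1]. *)
Let kernel_bound (delta : R) : 0 < delta -> exists2 L : R, 0 < L &
  forall u, 0 <= u <= 1 -> `|f u - f 0| <= (delta + L * (1 - k u))%:C%C.
Proof.
move=> d0; have dC : (0 : R[i]) < delta%:C%C by rewrite ltcR.
have /compact_near_coveringP cov := @segment_compact R (- 2^-1) 2^-1.
have hcov : \forall L \near +oo, [set` `[- 2^-1, (2^-1 : R)]] `<=` [set u |
    `|f u - f 0| <= (delta + L * (1 - k u))%:C%C].
  apply: cov => x; rewrite /= in_itv/= => /andP[x1 x2].
  have [kx|kx] := eqVneq (k x) 1.
    have x0 : x = 0.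
      have cx : cos (2 * pi * `|x|) = cos 0.
        have : cos (2 * pi * x) = 1.
          by move: kx; rewrite /k; lra.
        rewrite cos0 => c1; apply: etrans c1.
        have [x0|x0] := leP 0 x; first by rewrite ger0_norm.
        by rewrite ltr0_norm// mulrN cosN.
      have p0 := pi_gt0 R.
      have xh : `|x| <= 2^-1 by rewrite ler_norml x1.
      have := cos_inj _ _ cx; rewrite !in_itv/= lexx (ltW p0).
      rewrite mulr_ge0 ?mulr_ge0 ?(ltW p0)//=.
      have -> : 2 * pi * `|x| <= pi by nra.
      move=> /(_ isT isT)/eqP.
      rewrite mulf_eq0 mulf_eq0 (gt_eqF p0) pnatr_eq0/=.
      by rewrite normr_eq0 => /eqP.
    have := @fc x; rewrite x0 => /cvgrPdist_lt/(_ _ dC) fx.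
    exists ([set u | `|f 0 - f u| < delta%:C%C], [set L | 0 <= L]) => /=.
      by split=> //; exact: nbhs_pinfty_ge (num_real _).
    move=> [u L]/= [fu L0]; rewrite distrC; apply: le_trans (ltW fu) _.
    by rewrite lecR lerDl mulr_ge0// subr_ge0.
  have kx1 : k x < 1 by rewrite lt_neqAle kx k_le1.
  pose M : R := complex.Re (`|f x - f 0| + 1).
  have ME : M%:C%C = `|f x - f 0| + 1.
    by rewrite /M RRe_real// rpredD// normr_real.
  have M0 : 0 <= M by rewrite -lecR ME addr_ge0.
  pose c := (1 - k x) / 2.
  have c0 : 0 < c by rewrite divr_gt0// subr_gt0.
  have := @fc x => /cvgrPdist_lt/(_ _ ltr01) fx.
  have := @continuous_k x => /cvgrPdist_lt/(_ _ c0) kux.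
  exists ([set u | `|f x - f u| < 1] `&` [set u | `|k x - k u| < c],
      [set L | M / c <= L]) => /=.
    by split; [exact: filterI | exact: nbhs_pinfty_ge (num_real _)].
  move=> [u L]/= [[fu ku] ML].
  apply: (@le_trans _ _ M%:C%C).
    rewrite ME -(subrKA (f x)) addrC; apply: le_trans (ler_normD _ _) _.
    by rewrite lerD2l distrC ltW.
  rewrite lecR.
  have ku1 : c <= 1 - k u.
    by move: ku; rewrite ltr_norml /c => /andP[k1 k2]; lra.
  have : M <= L * (1 - k u).
    apply: (@le_trans _ _ (L * c)); first by rewrite -ler_pdivrMr.
    rewrite ler_wpM2l//; apply: le_trans ML; by rewrite divr_ge0// ltW.
  by move: d0; lra.
have [L [hL L0]] := filter_ex (filterI hcov (nbhs_pinfty_gt (@real0 R))).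
exists L => // u /andP[u0 u1].
have [u2|u2] := leP u 2^-1.
  by apply: hL; rewrite /= in_itv/= u2 andbT; lra.
have h : `|f (u - 1) - f 0| <= (delta + L * (1 - k (u - 1)))%:C%C.
  by apply: hL; rewrite /= in_itv/=; apply/andP; split; lra.
by move: h; rewrite -(f_per (u - 1)) -(k_per (u - 1)) subrK.
Qed.

Let kernel_sum n i : R := mean_sum (2 ^ i) (fun u => k u ^+ n : R).

Let kernel_pow_continuous n : continuous (fun u => k u ^+ n : R).
Proof.
elim: n => [|n IH] u; first exact: cvg_cst.
under eq_fun do rewrite exprS.
by apply: cvgM; [exact: continuous_k | exact: IH].
Qed.

(** Average k^n f(0) = k^n f - k^n (f - f(0)). The weight 1 - k in the bound on f - f(0) turns the
    mean of k^n into a difference of consecutive means. *)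
Let kernel_sum_le (delta L : R) n i :
  (forall u, 0 <= u <= 1 -> `|f u - f 0| <= (delta + L * (1 - k u))%:C%C) ->
  `|f 0| * (kernel_sum n i)%:C%C <=
  `|mean_sum (2 ^ i) (fun u => (char 0 u * (k u ^+ n)%:C%C) *: f u)| +
  (delta * kernel_sum n i + L * (kernel_sum n i - kernel_sum n.+1 i))%:C%C.
Proof.
move=> fL; set N := (2 ^ i)%N; have N0 : (0 < N)%N by rewrite expn_gt0.
have NC : (N%:R : R[i]) = (N%:R : R)%:C%C by rewrite rmorph_nat.
have A0 (m : nat) : 0 <= kernel_sum m i.
  rewrite /kernel_sum /mean_sum mulr_ge0 ?invr_ge0//.
  by apply: sumr_ge0 => j _; rewrite exprn_ge0.
have E : (kernel_sum n i)%:C%C *: f 0 =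
    mean_sum N (fun u => (char 0 u * (k u ^+ n)%:C%C) *: f u) -
    mean_sum N (fun u => (k u ^+ n)%:C%C *: (f u - f 0)).
  rewrite mean_sumB /kernel_sum /mean_sum -/N rmorphM/= fmorphV/= -NC -scalerA.
  congr (_ *: _); rewrite rmorph_sum/= scaler_suml; apply: eq_bigr => j _.
  by rewrite char0 mul1r -scalerBr opprB addrC subrK.
rewrite -[X in _ * X]ger0_norm ?ler0c// mulrC -normrZ E.
apply: le_trans (ler_normB _ _) _; rewrite lerD2l.
rewrite /mean_sum normrZ normfV normr_nat NC -fmorphV/=.
apply: le_trans (_ : _ <= ((N%:R)^-1 * \sum_(0 <= j < N)
    (k (j%:R / N%:R) ^+ n * (delta + L * (1 - k (j%:R / N%:R)))))%:C%C) _.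
  rewrite rmorphM/= ler_wpM2l ?ler0c ?invr_ge0//.
  rewrite rmorph_sum/=; apply: le_trans (ler_norm_sum _ _ _) _.
  rewrite [leLHS]big_nat [leRHS]big_nat; apply: ler_sum => j /andP[_ jN].
  rewrite normrZ ger0_norm ?ler0c ?exprn_ge0// rmorphM/=.
  rewrite ler_wpM2l ?ler0c ?exprn_ge0//; apply: fL.
  by rewrite divr_ge0//= ler_pdivrMr ?ltr0n// mul1r ler_nat ltnW.
have SE (m : nat) : kernel_sum m i =
    N%:R^-1 * \sum_(0 <= j < N) k (j%:R / N%:R) ^+ m by [].
have -> : \sum_(0 <= j < N)
      (k (j%:R / N%:R) ^+ n * (delta + L * (1 - k (j%:R / N%:R)))) =
    (delta + L) * \sum_(0 <= j < N) k (j%:R / N%:R) ^+ n -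
    L * \sum_(0 <= j < N) k (j%:R / N%:R) ^+ n.+1.
  rewrite !mulr_sumr -sumrB; apply: eq_bigr => j _.
  by rewrite exprS; ring.
rewrite lecR !SE.
move: (\sum_(_ <= _ < _) _) (\sum_(_ <= _ < _) _) => s1 s2.
by rewrite [leLHS](_ : _ = delta * (N%:R^-1 * s2) +
  L * (N%:R^-1 * s2 - N%:R^-1 * s1)) ?lexx//; ring.
Qed.

(** By continuity k >= sigma on some [0, 1/N]. The nodes there are a fraction 1/N of all, which is
    the constant c; the other terms are nonnegative. *)
Let kernel_sum_ge (sigma : R) : 0 < sigma -> sigma < 1 ->
  exists2 c : R, 0 < c & forall n,
    \forall i \near \oo, c * sigma ^+ n <= kernel_sum n i.
Proof.
move=> s0 s1; have k0 : k 0 = 1 by rewrite /k mulr0 cos0; lra.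
have s2 : 0 < 1 - sigma by rewrite subr_gt0.
have := @continuous_k 0 => /cvgrPdist_lt/(_ _ s2)/nbhs_ballP[d /= d0 kd].
have [n0 n0d] := small_dyadic d0.
pose N := (2 ^ n0)%N; have N0 : (0 < N)%N by rewrite expn_gt0.
have NR : (0 : R) < N%:R by rewrite ltr0n.
exists N%:R^-1 => [|n]; first by rewrite invr_gt0.
exists n0 => // i /= n0i.
have [m ->] : exists m : nat, i = (n0 + m)%N.
  by exists (i - n0)%N; rewrite subnKC.
rewrite /kernel_sum expnD -/N; set M := (2 ^ m)%N.
have M0 : (0 < M)%N by rewrite expn_gt0.
have MR : (0 : R) < M%:R by rewrite ltr0n.
rewrite /mean_sum natrM invfM.
rewrite -[_ *: _]/(_ * _) -mulrA ler_pM2l ?invr_gt0//.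
rewrite -[leLHS]mul1r ler_pdivlMl// mul1r.
rewrite (@big_cat_nat _ _ _ M) ?leq_pmull//=.
apply: (@le_trans _ _ (\sum_(0 <= j < M) k (j%:R * (N%:R^-1 / M%:R)) ^+ n)).
  have -> : M%:R * sigma ^+ n = \sum_(0 <= j < M) sigma ^+ n.
    by rewrite sumr_const_nat subn0 mulr_natl.
  rewrite [leLHS]big_nat [leRHS]big_nat.
  apply: ler_sum => j /andP[_ jM]; apply: lerXn2r; rewrite ?nnegrE ?(ltW s0)//.
  have : ball 0 d (j%:R * (N%:R^-1 / M%:R) : R).
    rewrite -ball_normE/= sub0r normrN ger0_norm ?mulr_ge0 ?invr_ge0//.
    apply: le_lt_trans (n0d _ (leqnn n0)); rewrite -/N mulrCA.
    by rewrite ler_piMr ?invr_ge0// ler_pdivrMr// mul1r ler_nat ltnW.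
  move=> /kd/=; rewrite k0 ltr_norml => /andP[_].
  by move=> h; lra.
by rewrite lerDl; apply: sumr_ge0 => j _; rewrite exprn_ge0.
Qed.

(* Were f 0 nonzero, the means of k ^+ n would be O(rho ^+ n) by kernel_sum_le,
   yet bounded below by c * sigma ^+ n with sigma > rho by kernel_sum_ge. *)
Lemma fourier_unique0 : f 0 = 0.
Proof.
apply/eqP; apply: contrapT => /negP f0.
(* Half of |f 0|, so that delta times the mean of k^n is left on the left side of [kernel_sum_le]
   once the delta term on the right is subtracted. *)
pose delta : R := complex.Re `|f 0| / 2.
have fE : `|f 0| = (2 * delta)%:C%C.
  by rewrite /delta mulrC divfK ?pnatr_eq0// RRe_real ?normr_real.
have d0 : 0 < delta.
  by rewrite divr_gt0// -ltcR RRe_real ?normr_real// normr_gt0.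
have [L' L'0 fL'] := kernel_bound d0.
(* Enlarged by delta to have delta / L < 1, hence rho > 0. *)
pose L := L' + delta; have L0 : 0 < L by rewrite addr_gt0.
have fL u : 0 <= u <= 1 -> `|f u - f 0| <= (delta + L * (1 - k u))%:C%C.
  move=> /fL' h; apply: le_trans h _; rewrite lecR lerD2l ler_wpM2r//.
    by rewrite subr_ge0.
  by rewrite lerDl ltW.
have dL : delta / L < 1 by rewrite ltr_pdivrMr// mul1r ltrDr.
have dL0 : 0 < delta / L by rewrite divr_gt0.
pose rho := 1 - delta / L.
(* Halfway between rho and 1. *)
pose sigma := 1 - delta / L / 2.
have r0 : 0 < rho by rewrite subr_gt0.
have rs : rho < sigma by rewrite /rho /sigma; lra.
have s0 : 0 < sigma by exact: lt_trans rs.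
have [|c c0 cA] := kernel_sum_ge s0; first by rewrite /sigma; lra.
have A_ex n : exists a : R, has_mean (fun u => k u ^+ n : R) a.
  by apply: has_mean_exists; exact: kernel_pow_continuous.
pose a n : R := projT1 (cid (A_ex n)).
have aP n : kernel_sum n i @[i --> \oo] --> a n.
  by rewrite /a; case: cid.
have a_le n : delta * a n <= L * (a n - a n.+1).
  rewrite -subr_le0.
  apply/ler_addgt0Pr => e e0; rewrite add0r.
  have cvl : (delta * kernel_sum n i - L * (kernel_sum n i - kernel_sum n.+1 i))
      @[i --> \oo] --> delta * a n - L * (a n - a n.+1).
    apply: cvgB; apply: cvgM; try exact: cvg_cst; first exact: aP.
    by apply: cvgB; exact: aP.
  rewrite -(cvg_lim _ cvl)//; apply: limr_le; first by apply: cvgP cvl.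
  have eC : (0 : R[i]) < e%:C%C by rewrite ltcR.
  have /cvgrPdist_lt/(_ _ eC) := kernel_mean n 0.
  apply: filterS => i; rewrite sub0r normrN => Se.
  have := kernel_sum_le n i fL; rewrite fE -rmorphM/= => h.
  have := le_trans h (lerD (ltW Se) (lexx _)).
  by rewrite -rmorphD/= lecR; lra.
have a_dec n : a n.+1 <= rho * a n.
  have : (delta / L) * a n <= a n - a n.+1.
    by rewrite mulrAC ler_pdivrMr// [leRHS]mulrC.
  by rewrite /rho; lra.
have a_ge n : c * sigma ^+ n <= a n.
  rewrite -(cvg_lim _ (aP n))//; apply: limr_ge; first by apply: cvgP (aP n).
  exact: cA.
have a_le_rho n : a n <= rho ^+ n * a 0%N.
  elim: n => [|n IH]; first by rewrite expr0 mul1r.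
  apply: le_trans (a_dec n) _; rewrite exprS -mulrA.
  by rewrite ler_wpM2l// ltW.
have a0 : 0 < a 0%N.
  by apply: lt_le_trans (a_ge 0%N); rewrite expr0 mulr1.
have rs1 : `|rho / sigma| < 1.
  by rewrite ger0_norm ?divr_ge0 ?(ltW r0) ?(ltW s0)// ltr_pdivrMr// mul1r.
have ca0 : 0 < c / a 0%N by rewrite divr_gt0.
have /cvgrPdist_lt/(_ _ ca0)[n _ /(_ n (leqnn n))] := cvg_expr rs1.
rewrite sub0r normrN normrX ger0_norm ?divr_ge0 ?(ltW r0) ?(ltW s0)//.
rewrite expr_div_n ltr_pdivrMr ?exprn_gt0// mulrAC ltr_pdivlMr//.
by move=> /(le_lt_trans (le_trans (a_ge n) (a_le_rho n))); rewrite ltxx.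
Qed.

End kernel_powers.

(** Translation reduces to the point 0: shifting f by v multiplies its mean against [char m] by the
    scalar [char m (- v)]. *)
Lemma fourier_unique (f : R -> V) (v : R) : continuous f ->
  (forall u, f (u + 1) = f u) ->
  (forall m, has_mean (fun u => char m u *: f u) 0) -> f v = 0.
Proof.
move=> fc f1 fm; pose g u := f (u + v).
have -> : f v = g 0 by rewrite /g add0r.
apply: fourier_unique0 => [u|u|m].
- apply: (@continuous_comp _ _ _ (fun u => u + v) f); last exact: fc.
  by apply: cvgD; [exact: cvg_id | exact: cvg_cst].
- by rewrite /g addrAC f1.
- have c := continuous_charZ (m := m) fc.
  have per u : char m (u + 1) *: f (u + 1) = char m u *: f u.
    by rewrite charD char1 mulr1 f1.
  have := has_meanZ (a := char m (- v)) (has_mean_shift v c per (fm m)).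
  rewrite scaler0; congr has_mean; apply/funext => u.
  by rewrite scalerA -charD addrC addrK.
Qed.

End means.
End fourier.

(** * One-parameter automorphism groups *)

Section flows.
Context {R : realType} {H : hilbertType R}.
Implicit Types (x y : H) (a S T : H -> H) (s u v p : R).
Variables (N : set (H -> H)) (theta : R -> (H -> H) -> (H -> H)).
Hypothesis sys : wstar_system N theta.

Let vN : von_neumann_algebra N := wstar_vna sys.
Let aut u : star_automorphism N (theta u) := wstar_aut sys u.
Let vZ : von_neumann_algebra (vna_center N) := vna_center_vna vN.

Lemma thetaK u T : N T -> theta u (theta (- u) T) = T.
Proof. by move=> NT; rewrite -(wstar_add sys)// subrr (wstar_0 sys). Qed.

Lemma thetaC u v T : N T -> theta u (theta v T) = theta v (theta u T).
Proof. by move=> NT; rewrite -!(wstar_add sys)// addrC. Qed.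

Lemma theta_center u T : vna_center N T -> vna_center N (theta u T).
Proof. exact: aut_center. Qed.

Lemma theta_closed u (F : set_system nat) {FF : ProperFilter F}
    (w : nat -> H -> H) a b :
  (forall n, vna_center N (w n)) -> vna_center N a -> vna_center N b ->
  (forall x, w n x @[n --> F] --> a x) ->
  (forall x, theta u (w n) x @[n --> F] --> b x) -> theta u a = b.
Proof.
exact: (aut_center_closed vN (aut u) (aut (- u)) (@thetaK u)).
Qed.

(** Sequences with a single nonzero term reduce a sigma-weakly continuous functional to one pair of
    vectors. *)
Lemma theta_weak_continuous T x y : N T ->
  continuous (fun u => inner (theta u T x) y).
Proof.
move=> NT.
pose d0 (z : H) (n : nat) : H := if n is 0 then z else 0.
have tail (g : nat -> R[i]) : (forall n, g n.+1 = 0) -> series g @ \oo --> g 0%N.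
  move=> g0; apply: (@cvg_trans _ ((fun=> g 0%N) @ \oo)); last exact: cvg_cst.
  apply: near_eq_cvg; exists 1%N => // -[//|n] _.
  by rewrite /series/= big_nat_recl//= big1 ?addr0// => i _; rewrite g0.
have sq z : cvgn (series (fun n => `|d0 z n| ^+ 2)).
  by apply/cvg_ex; exists (`|d0 z 0%N| ^+ 2); apply: tail => n /=;
    rewrite normr0 expr0n.
rewrite (_ : (fun u => inner (theta u T x) y) = fun u =>
    limn (series (fun n => inner (theta u T (d0 x n)) (d0 y n)))).
  by have h := wstar_continuous sys NT; have := h _ _ (sq x) (sq y).
apply/funext => u; apply/esym/cvg_lim; first exact: norm_hausdorff.
by apply: (tail (fun n => inner (theta u T (d0 x n)) (d0 y n))) => n /=;
  rewrite inner0r.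
Qed.

(* For an automorphism group, weak continuity gives strong continuity since
   |theta_u(T) x|^2 = <theta_u(T* T) x, x>. *)
Lemma theta_strong_continuous T x : N T -> continuous (fun u => theta u T x).
Proof.
move=> NT v; have [T' [TT' NT']] := vna_adjoint_exists vN NT.
have NTT : N (T' \o T) by exact: vna_comp.
have nE u : inner (theta u (T' \o T) x) x = inner (theta u T x) (theta u T x).
  rewrite (aut_comp (aut u) NT' NT)/=.
  exact: adjoint_sym (aut_adjoint (aut u) NT TT') _ _.
pose y := theta v T x.
have c1 := @theta_weak_continuous (T' \o T) x x NTT v.
have c2 := @theta_weak_continuous T x y NT v.
have : (fun u => inner (theta u (T' \o T) x) x - inner (theta u T x) y -
    ((inner (theta u T x) y)^* - inner y y)) @ v --> (0 : R[i]).
  have -> : 0 = inner (theta v (T' \o T) x) x - inner (theta v T x) y -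
      ((inner (theta v T x) y)^* - inner y y).
    by rewrite nE -/y -innerC !subrr.
  apply: cvgB; first exact: cvgB c1 c2.
  by apply: cvgB; [exact: cvg_conjC c2 | exact: cvg_cst].
move=> /cvgrPdist_lt c; apply/cvgrPdist_lt => e e0.
have e2 : 0 < e ^+ 2 by rewrite exprn_gt0.
have := c _ e2; apply: filterS => u.
rewrite nE -innerC -!innerBr -innerBl sub0r normrN innerE.
by rewrite normrX normr_id ltr_pXn2r// ?nnegrE ?(ltW e0)// distrC.
Qed.

Lemma vna_sum (N' : set (H -> H)) (n : nat) (F : nat -> H -> H) :
  von_neumann_algebra N' -> (forall j, N' (F j)) ->
  N' (\sum_(0 <= j < n) F j).
Proof.
move=> vN' NF; elim: n => [|n IH]; first by rewrite big_geq//; exact: vna0.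
by rewrite big_nat_recr//=; exact: vnaD.
Qed.

Lemma aut_sum (alpha : (H -> H) -> H -> H) (n : nat) (F : nat -> H -> H) :
  star_automorphism N alpha -> (forall j, N (F j)) ->
  alpha (\sum_(0 <= j < n) F j) = \sum_(0 <= j < n) alpha (F j).
Proof.
move=> au NF; elim: n => [|n IH]; first by rewrite !big_geq// (aut0 vN au).
by rewrite !big_nat_recr//= (autD au) ?IH//; exact: vna_sum.
Qed.

Lemma sum_opE (n : nat) (F : nat -> H -> H) x :
  (\sum_(0 <= j < n) F j) x = \sum_(0 <= j < n) F j x.
Proof.
elim: n => [|n IH]; first by rewrite !big_geq.
by rewrite !big_nat_recr//= -IH.
Qed.

Lemma has_mean_op S (f : R -> H) l : bounded_op S -> has_mean f l ->
  has_mean (fun u => S (f u)) (S l).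
Proof.
move=> bS fl; rewrite /has_mean.
rewrite [X in X @ _ --> _](_ : _ = fun n => S (mean_sum (2 ^ n) f)).
  exact: bounded_op_cvg.
apply/funext => n; have lS := bounded_op_linear bS.
rewrite /mean_sum (linear_opZ lS); congr (_ *: _).
rewrite -(@big_morph _ _ S 0 +%R 0 +%R)//; first exact: linear_opD lS.
exact: linear_op0 lS.
Qed.

End flows.

(** * Eigenvectors and freeness of the flow on the center *)

Section central_flow.
Context {R : realType} {H : hilbertType R}.
Implicit Types (x y : H) (a S T : H -> H) (s u v p t : R).
Variables (N : set (H -> H)) (theta : R -> (H -> H) -> (H -> H)).
Hypothesis sys : wstar_system N theta.
Hypothesis erg : centrally_ergodic N theta.

Let vN : von_neumann_algebra N := wstar_vna sys.
Let aut u : star_automorphism N (theta u) := wstar_aut sys u.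
Let vZ : von_neumann_algebra (vna_center N) := vna_center_vna vN.

Lemma center_fixed_scalar a : vna_center N a -> (forall u, theta u a = a) ->
  scalar_op a.
Proof. by move=> Za fa; rewrite -erg. Qed.

Lemma flow_eigenvector a p : p != 0 -> vna_center N a -> theta p a = a ->
  ~ scalar_op a -> exists (m : int) s, [/\ m != 0,
    eigenvalues (vna_center N) theta s & s * p = 2 * pi * m%:~R].
Proof.
move=> p0 Za pa na; have Na := center_sub Za.
(* Time is rescaled to give the orbit period 1. *)
pose f x u := theta (p * u) a x.
have fc x : continuous (f x).
  move=> u; apply: (@continuous_comp _ _ _ (fun u => p * u) (fun u => theta u a x)).
    by apply: cvgM; [exact: cvg_cst | exact: cvg_id].
  exact: (theta_strong_continuous sys).
have fper x u : f x (u + 1) = f x u.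
  by rewrite /f mulrDr mulr1 (wstar_add sys)// pa.
have Eex m x := has_mean_exists (continuous_charZ (m := m) (@fc x)).
pose E m x := projT1 (cid (Eex m x)).
have EP m x : has_mean (fun u => char m u *: f x u) (E m x).
  by rewrite /E; case: cid.
have Zf u : vna_center N (theta (p * u) a) by exact: (theta_center sys).
have ZE m : vna_center N (E m).
  have lE : linear (E m).
    move=> k x y; apply: (has_mean_unique (EP m _)).
    have := has_mean_lin (a := k) (EP m x) (EP m y).
    congr has_mean; apply/funext => u.
    rewrite /f (vna_linear vZ (Zf u)) scalerDr !scalerA.
    by rewrite [k * _]mulrC.
  have Ecomm S x : bounded_op S -> (forall u x, theta (p * u) a (S x) =
      S (theta (p * u) a x)) -> E m (S x) = S (E m x).
    move=> bS Sc; apply: (has_mean_unique (EP m _)).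
    have := has_mean_op bS (EP m x); congr has_mean; apply/funext => u.
    by rewrite (linear_opZ (bounded_op_linear bS)) /f Sc.
  have bE : bounded_op (E m).
    have [c c0 ac] := bounded_op_bound (vna_bounded vN Na).
    apply: (@bounded_op_intro _ _ _ c) => // x.
    apply: (@cvgC_le _ _ \oo _
      (fun n => `|mean_sum (2 ^ n) (fun u => char m u *: f x u)|)).
      by apply: cvg_norm; exact: EP.
    apply: nearW => n; apply: mean_sum_norm_le; first by rewrite expn_gt0.
    move=> j _; rewrite normrZ expi_norm mul1r.
    exact: (aut_contract vN (aut _) Na (ltW c0) ac).
  apply: (center_intro vN); last first.
    move=> S x NS; apply: Ecomm; first exact: (vna_bounded vN NS).
    by move=> u y; exact: (center_comm _ (Zf u) NS).
  apply: (vna_mem vN bE) => S x NS; apply: Ecomm; first by case: NS.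
  by move=> u y; exact: (vna_comm _ (center_sub (Zf u)) NS).
(* Formally the change of variable u |-> u + s / p in the integral of char_m(u) theta_{p u}(a). That
   integral is the strong limit of the sums [w n], and normality lets [theta s] pass through it. *)
have Eth m s : theta s (E m) = char m (- (s / p)) *: E m.
  pose w n : H -> H := ((2 ^ n)%N%:R : R[i])^-1 *: \sum_(0 <= j < 2 ^ n)
    (char m (j%:R / (2 ^ n)%:R) *: theta (p * (j%:R / (2 ^ n)%:R)) a).
  have NF n j : N (char m (j%:R / (2 ^ n)%:R) *:
      theta (p * (j%:R / (2 ^ n)%:R)) a).
    by apply: (vnaZ vN); exact: center_sub.
  apply: (@theta_closed _ _ _ _ sys s \oo _ w).
  - move=> n; apply: (vnaZ vZ); apply: vna_sum => // j.
    by apply: (vnaZ vZ).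
  - exact: ZE.
  - exact: (vnaZ vZ).
  - move=> x; rewrite [X in X @ _ --> _](_ : _ = fun n =>
      mean_sum (2 ^ n) (fun u => char m u *: f x u)); first exact: EP.
    by apply/funext => n; rewrite /w opZE sum_opE.
  - move=> x; rewrite [X in X @ _ --> _](_ : _ = fun n =>
      mean_sum (2 ^ n) (fun u => char m u *: f x (u + s / p))).
      have per u : char m (u + 1) *: f x (u + 1) = char m u *: f x u.
        by rewrite charD char1 mulr1 fper.
      have := has_mean_shift (s / p) (continuous_charZ (m := m) (@fc x)) per
        (EP m x).
      move=> /(has_meanZ (a := char m (- (s / p)))).
      congr has_mean; apply/funext => u.
      by rewrite scalerA -charD addrC addrK.
    apply/funext => n; rewrite /w (autZ vN (aut s)); last exact: vna_sum.
    rewrite (aut_sum sys _ (aut s))// opZE sum_opE /mean_sum.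
    congr (_ *: _); apply: eq_bigr => j _.
    rewrite (autZ vN (aut s)); last exact: center_sub.
    rewrite opZE -(wstar_add sys)// /f; congr (_ *: theta _ _ _).
    by rewrite mulrDr [p * (s / p)]mulrC divfK// addrC.
have [[m [m0 Em]]|nE] := pselect (exists m, m != 0 /\ E m <> 0).
  (* The sign is reversed because [E m] integrates against [char m], not against its conjugate. *)
  exists (- m), (- (2 * pi * m%:~R / p)); split; first by rewrite oppr_eq0.
    exists (E m); split=> // u; rewrite Eth /char; congr (expi _ *: _).
    rewrite mulrN mulNr -!mulrA; congr (- (_ * (_ * (_ * _)))).
    by rewrite mulrC.
  by rewrite mulNr divfK// mulrNz mulrN.
(* With every other coefficient zero, each orbit map f x equals its mean E 0 x, so [a] is fixed by
   the whole flow. *)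
exfalso; apply: na; apply: center_fixed_scalar => // s.
have E0 m : m != 0 -> E m = 0.
  by move=> m0; apply: contrapT => Em; apply: nE; exists m.
have fE x u : f x u = E 0 x.
  apply/eqP; rewrite -subr_eq0; apply/eqP.
  apply: (@fourier_unique _ _ (fun u => f x u - E 0 x)) => [v|v|m].
  - by apply: cvgB; [exact: fc | exact: cvg_cst].
  - by rewrite fper.
  - have [->|m0] := eqVneq m 0.
      have := has_mean_lin (a := -1) (@has_mean_cst R _ _ (E 0 x)) (EP 0 x).
      rewrite scaleN1r addNr; congr has_mean; apply/funext => v.
      by rewrite char0 !scale1r addrC.
    have := has_mean_lin (a := -1) (has_mean_char (E 0 x) m0) (EP m x).
    rewrite scaleN1r oppr0 add0r (_ : E m x = 0); last by rewrite E0.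
    congr has_mean; apply/funext => v.
    by rewrite scalerBr addrC ?scaleN1r.
apply/funext => x.
have := fE x (s / p); rewrite -(fE x 0) /f mulrCA mulfV// mulr1 => ->.
by rewrite mulr0 (wstar_0 sys).
Qed.

Lemma eigenvalue_not_ergodic s t (n : nat) (q : int) :
  eigenvalues (vna_center N) theta s -> s != 0 -> (0 < n)%N ->
  s * t * n%:R = 2 * pi * q%:~R ->
  exists b, [/\ vna_center N b, forall k : int, theta (k%:~R * t) b = b &
    ~ scalar_op b].
Proof.
move=> [a [Za a0 ath]] s0 n0 stq; have Na := center_sub Za.
have [a' [aa' Na']] := vna_adjoint_exists vN Na.
have Za' := center_adjoint vN Za aa'.
(* The phases cancel in a^* a, so ergodicity makes it a scalar. That scalar is nonzero, hence [a]
   and all its powers are injective. *)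
have [c _ ac] : scalar_op (a' \o a).
  apply: center_fixed_scalar => [|u]; first exact: (vna_comp vZ).
  have a'th : theta u a' = (expi (s * u))^* *: a'.
    apply: (@adjoint_unique _ _ (theta u a)); first exact: (aut_adjoint (aut u)).
    by rewrite ath; exact: adjointZ.
  rewrite (aut_comp (aut u))// a'th ath; apply/funext => x /=.
  rewrite !opZE (linear_opZ (vna_linear vZ Za')) scalerA.
  by rewrite mulrC -normCK expi_norm expr1n scale1r.
have acx x : a' (a x) = c *: x by rewrite -[LHS]/((a' \o a) x) -ac.
have [x0 ax0] : exists x, a x <> 0.
  by apply: contrapT => h; apply: a0; apply/funext => x; apply: contrapT => ax;
    apply: h; exists x.
have c0 : c != 0.
  apply/eqP => c0; apply: ax0; apply: inner_eq0.
  by rewrite -(adjoint_sym aa') acx c0 scale0r inner0l.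
have ainj x : a x = 0 -> x = 0.
  move=> ax; apply/eqP; have := acx x; rewrite ax.
  by rewrite (linear_op0 (vna_linear vZ Za')) => /esym/eqP;
    rewrite scaler_eq0 (negPf c0).
pose b j := iter j (fun T => a \o T) idfun.
have Zb j : vna_center N (b j).
  elim: j => [|j IH]; first exact: (vna_id vZ).
  exact: (vna_comp vZ).
have bth j u : theta u (b j) = expi (s * u * j%:R) *: b j.
  elim: j => [|j IH].
    by rewrite (aut_id vN (aut u)) mulr0 expi0 scale1r.
  rewrite /b iterS -/(b j) (aut_comp (aut u))//; last exact: center_sub (Zb j).
  rewrite IH ath; apply/funext => x /=.
  rewrite !opZE (linear_opZ (vna_linear vZ Za)) scalerA.
  by rewrite -expiD -natr1 mulrDr mulr1 addrC.
have binj j x : b j x = 0 -> x = 0.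
  by elim: j => // j IH /ainj /IH.
have x00 : x0 <> 0.
  by move=> x00; apply: ax0; rewrite x00 (linear_op0 (vna_linear vZ Za)).
exists (b n); split=> // [k|[k _ bk]].
  rewrite bth (_ : _ * _ = 2 * pi * (q * k)%:~R) ?expi_int ?scale1r//.
  by rewrite intrM [RHS]mulrA -stq; ring.
have nR : n%:R != 0 :> R by rewrite pnatr_eq0 -lt0n.
(* At time pi / (s n) the flow multiplies a^n by -1, whereas it would fix a scalar. *)
have := bth n (pi / (s * n%:R)).
rewrite (_ : s * _ * _ = pi); last first.
  by field; rewrite s0 nR.
rewrite expi_pi -{1}bk (aut_scalar vN (aut _)) bk => /(congr1 (@^~ x0)).
rewrite opZE scaleN1r => /eqP; rewrite -subr_eq0 opprK -mulr2n -scaler_nat.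
by rewrite scaler_eq0 pnatr_eq0/= => /eqP/binj.
Qed.

(* The largest positive contraction a of the center supported where theta_p
   is trivial is a projection, invariant under the flow, hence 0 or 1. *)
Lemma flow_free p w : vna_center N w -> pos_op w ->
  (forall z x, vna_center N z -> w (theta p z x) = w (z x)) ->
  w = 0 \/ forall z, vna_center N z -> theta p z = z.
Proof.
move=> Zw pw wQ; have Z1 := vna_id vZ.
have p1 : pos_op (idfun : H -> H) by move=> x; exact: inner_ge0.
(* [Q b] expresses that b is supported where theta_p is trivial on the center. *)
pose Q (b : H -> H) : Prop :=
  forall z x, vna_center N z -> b (theta p z x) = b (z x).
have [|D L DQ ZL DP Dlim z x Zz|a [[Za pa a1 Qa] amax]] :=
    @zorn_interval _ _ _ vZ idfun Q Z1 p1.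
- by [].
- have lL := vna_linear vZ ZL.
  apply/eqP; rewrite -subr_eq0 -(linear_opB lL) -normr_eq0 eq_le normr_ge0 andbT.
  apply/ler_addgt0Pr => e e0; rewrite add0r.
  have [b Db be] := Dlim (theta p z x - z x) _ e0.
  have [Zb _ _] := DP _ Db.
  have by0 : b (theta p z x - z x) = 0.
    by rewrite (linear_opB (vna_linear vZ Zb)) (DQ _ Db)// subrr.
  by rewrite -[X in `|X|]subr0 -by0 ltW.
pose e : H -> H := idfun - a.
have Ze : vna_center N e by exact: (vnaB vZ).
have pe : pos_op e by exact: a1.
have e_sym := pos_op_selfadjoint (vna_linear vZ Ze) pe.
have ee x : inner (e x) (e x) <= inner (e x) x.
  rewrite innerE -[leRHS]mul1r; apply: pos_op_norm_le => //.
    exact: (vna_linear vZ Ze).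
  move=> y; rewrite mul1r -innerE /e opBE innerBl lerBlDr lerDl.
  exact: pa.
(* The compression e b e satisfies [Q] and lies below e^2 <= e, so maximality of [a] makes it
   vanish; hence b e = 0. *)
have supp b x : vna_center N b -> pos_op b -> le_op b idfun -> Q b ->
    b (a x) = b x.
  move=> Zb pb b1 Qb; pose b' := e \o (b \o e).
  have Zb' : vna_center N b' by do 2! apply: (vna_comp vZ) => //.
  have b'E y : inner (b' y) y = inner (b (e y)) (e y) by rewrite /b'/= e_sym.
  have b'0 : b' = 0.
    apply: (@addrI _ a); rewrite addr0; apply: amax.
    - exact: (vnaD vZ).
    - by rewrite /le_op addrC addKr => y; rewrite b'E.
    - apply/le_opP => y; rewrite opDE innerDl -lerBrDl.
      rewrite b'E; apply: le_trans (_ : _ <= inner (e y) (e y)) _.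
        by move/le_opP: b1; exact.
      by apply: le_trans (ee y) _; rewrite /e opBE innerBl.
    - move=> z y Zz; rewrite !opDE Qa//; congr (_ + _); rewrite /b'/=.
      rewrite -!(center_comm _ Ze (center_sub Zb)).
      by rewrite Qb.
  have : b (e x) = 0.
    apply: pos_op_form_eq0 => //; first exact: (vna_bounded vZ).
    by rewrite -b'E b'0 inner0l.
  rewrite /e opBE (linear_opB (vna_linear vZ Zb)) => /eqP.
  by rewrite subr_eq0 => /eqP.
(* The flow is abelian and preserves the center, so theta_s(a) inherits [Q] from [a]. *)
have ath s : vna_center N (theta s a) /\ forall x, theta s a (a x) = theta s a x.
  have Zta : vna_center N (theta s a) by exact: (theta_center sys).
  split=> // x; apply: supp => //.
  - exact: (aut_pos vN (aut s) (center_sub Za)).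
  - rewrite -(aut_id vN (aut s)).
    by apply: (aut_le vN (aut s)) => //; [exact: center_sub | exact: (vna_id vN)].
  - move=> z y Zz; have Zz' := theta_center sys (- s) Zz.
    rewrite -(thetaK sys s (center_sub Zz)) (thetaC sys p s (center_sub Zz')).
    have NpZ : N (theta p (theta (- s) z)).
      by apply: center_sub; exact: (theta_center sys).
    rewrite -[LHS]/((theta s a \o theta s (theta p (theta (- s) z))) y).
    rewrite -(aut_comp (aut s) (center_sub Za) NpZ).
    rewrite -[RHS]/((theta s a \o theta s (theta (- s) z)) y).
    rewrite -(aut_comp (aut s) (center_sub Za) (center_sub Zz')).
    by congr (theta s _ y); apply/funext => v /=; exact: Qa.
(* By the previous step theta_s(a) a = theta_s(a); transporting the same relation for - s by theta_s
   gives a theta_s(a) = a. *)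
have ainv s : theta s a = a.
  have [Zs hs] := ath s; have [Zs' hs'] := ath (- s).
  have Es : theta (- s) a \o a = theta (- s) a by apply/funext => x /=.
  have := congr1 (theta s) Es.
  rewrite (aut_comp (aut s) (center_sub Zs') (center_sub Za)).
  rewrite (thetaK sys s (center_sub Za)) => E.
  apply/funext => x; rewrite -hs -(center_comm _ Za (center_sub Zs)).
  by rewrite -[LHS]/((a \o theta s a) x) E.
(* Now a = k 1. If k = 0, every admissible element vanishes; if not, k = 1 and [Q] holds for the
   identity. *)
have [k _ ak] := center_fixed_scalar Za ainv.
have [k0|k0] := eqVneq k 0.
  left; have [c c0 wc] := form_bound (vna_bounded vZ Zw) pw.
  apply/funext => x.
  (* Scaling brings [w] below the identity, where [supp] reads c^-1 w = c^-1 w a = 0. *)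
  have := @supp (c^-1 *: w) x (vnaZ vZ _ Zw).
  rewrite -ak k0 scale0r !opZE (linear_op0 (vna_linear vZ Zw)) scaler0.
  move=> /(_ _ _ _)/esym h.
  have : c^-1 *: w x = 0.
    apply: h.
    - by apply: pos_opZ => //; rewrite invr_ge0 ltW.
    - by apply/le_opP => y; rewrite opZE innerZl ler_pdivrMl//= innerE.
    - by move=> z y Zz; rewrite !opZE wQ.
  by move/eqP; rewrite scaler_eq0 invr_eq0 (gt_eqF c0) => /eqP.
right=> z Zz; apply/funext => x.
have kid y : k *: y = y.
  apply: (scalerI k0); have [_ /(_ y)] := ath 0.
  by rewrite ainv -ak.
by have := Qa z x Zz; rewrite -ak !kid.
Qed.

End central_flow.

(** * Crossed products by the integers *)

Section l2_operators.
Context {R : realType} {H : hilbertType R}.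
Implicit Types (k m n : int) (x y : H) (xi eta : l2 H).

Lemma l2_ext xi eta : (forall n, xi n = eta n) -> xi = eta.
Proof. by move=> h; apply/val_inj/funext. Qed.

Lemma inner_l2E xi eta : inner xi eta = l2_inner xi eta :> R[i].
Proof. by []. Qed.

Lemma l2_addE xi eta n : (xi + eta) n = xi n + eta n.
Proof. by []. Qed.

Lemma l2_scaleE (c : R[i]) xi n : (c *: xi) n = c *: xi n.
Proof. by []. Qed.

Let idx n := match n with Posz i => i | Negz i => i end.

(** The integers from -N to N - 1, those met by the first N terms of [int_series]; [Negz i] is - i -
    1. *)
Let block (N : nat) : seq int := map Posz (iota 0 N) ++ map Negz (iota 0 N).

Let mem_block n (N : nat) : (n \in block N) = (idx n < N)%N.
Proof.
rewrite mem_cat; case: n => i /=.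
  rewrite mem_map ?mem_iota ?add0n; last by move=> ? ? [].
  by case: (_ < _)%N => //=; apply/negP => /mapP[j _].
rewrite orbC mem_map ?mem_iota ?add0n; last by move=> ? ? [].
by case: (_ < _)%N => //=; apply/negP => /mapP[j _].
Qed.

Let block_uniq N : uniq (block N).
Proof.
rewrite cat_uniq !map_inj_uniq ?iota_uniq; [|by move=> ? ? []..].
by rewrite andbT; apply/hasPn => k /mapP[i _ ->]; apply/negP => /mapP[j _].
Qed.

Lemma int_seriesE (a : int -> R[i]) (N : nat) :
  int_series a N = \sum_(k <- block N) a k.
Proof.
rewrite /int_series /series/= big_cat/= !big_map -big_split/=.
by rewrite /index_iota subn0.
Qed.

(** Partial sums of a translated sequence run over a translated block of integers; this bounds them
    by the full sum. *)
Lemma sum_uniq_le_int_series (a : int -> R[i]) (s : seq int) :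
  (forall k, 0 <= a k) -> cvgn (int_series a) -> uniq s ->
  \sum_(k <- s) a k <= limn (int_series a).
Proof.
move=> a0 ca us; pose N := (\max_(k <- s) idx k).+1.
apply: le_trans (int_series_le a0 ca N); rewrite int_seriesE.
rewrite [leRHS](bigID (mem s))/= -[X in _ <= X + _]big_filter.
have ps : perm_eq [seq k <- block N | k \in s] s.
  apply: uniq_perm => // [|k]; first exact/filter_uniq/block_uniq.
  rewrite mem_filter; case: (boolP (k \in s)) => //= ks.
  by rewrite mem_block ltnS; exact: leq_bigmax_seq.
rewrite (perm_big _ ps) lerDl.
by apply: sumr_ge0.
Qed.

Lemma cvg_int_series1 (a : int -> R[i]) n : (forall k, k != n -> a k = 0) ->
  int_series a @ \oo --> a n.
Proof.
move=> an; apply: (@cvg_trans _ ((fun=> a n) @ \oo)); last exact: cvg_cst.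
apply: near_eq_cvg; exists (idx n).+1 => // N /= nN.
rewrite int_seriesE (bigD1_seq n) ?block_uniq ?mem_block//=.
by rewrite big1 ?addr0// => k /an.
Qed.

Lemma l2_intro (g : int -> H) (c : R[i]) :
  (forall N, int_series (fun k => `|g k| ^+ 2) N <= c) ->
  exists xi : l2 H, (forall k, xi k = g k) /\ `|xi| ^+ 2 <= c.
Proof.
move=> gc; have cg : g \in @l2_pred R H.
  apply/asboolP; apply: nneg_series_cvg gc => n.
  by rewrite addr_ge0// exprn_ge0.
exists (L2 cg); split=> //.
rewrite -l2_innerE l2_innerxx.
apply: (@cvgC_le _ _ \oo _ _ _ _ (l2P (x := L2 cg))).
by apply: nearW => n; exact: gc.
Qed.

Lemma l2_deltaP n x :
  exists xi : l2 H, forall k, xi k = if k == n then x else 0.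
Proof.
pose g k : H := if k == n then x else 0.
have cg : g \in @l2_pred R H.
  apply/asboolP/cvg_ex; exists (`|g n| ^+ 2).
  by apply: (cvg_int_series1 (a := fun k => `|g k| ^+ 2)) => k kn;
    rewrite /g (negPf kn) normr0 expr0n.
by exists (L2 cg).
Qed.

Definition l2_delta n x : l2 H := projT1 (cid (l2_deltaP n x)).

Lemma l2_deltaE n x k : l2_delta n x k = if k == n then x else 0.
Proof. by rewrite /l2_delta; case: cid. Qed.

Lemma inner_l2_delta n x xi : inner (l2_delta n x) xi = inner x (xi n) :> R[i].
Proof.
rewrite inner_l2E; apply: cvg_lim; first exact: norm_hausdorff.
have := @cvg_int_series1 (fun k => inner (l2_delta n x k) (xi k)) n.
rewrite l2_deltaE eqxx; apply => k kn.
by rewrite l2_deltaE (negPf kn) inner0l.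
Qed.

Lemma l2_deltaD (c : R[i]) n x y :
  l2_delta n (c *: x + y) = c *: l2_delta n x + l2_delta n y.
Proof.
apply: l2_ext => k; rewrite l2_addE l2_scaleE !l2_deltaE.
by case: eqP => // _; rewrite scaler0 addr0.
Qed.

Lemma l2_delta_norm n x : `|l2_delta n x| = `|x|.
Proof.
apply/eqP; rewrite -(@eqrXn2 _ 2)// -!innerE inner_l2_delta.
by rewrite l2_deltaE eqxx.
Qed.

Lemma l2_diagonal (y : int -> H -> H) (c : R[i]) : 0 <= c ->
  (forall n, linear (y n)) -> (forall n x, `|y n x| <= c * `|x|) ->
  exists T : l2 H -> l2 H, bounded_op T /\
    forall xi n, T xi n = y n (xi n).
Proof.
move=> c0 ly yc.
have h xi : exists eta : l2 H, (forall k, eta k = y k (xi k)) /\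
    `|eta| ^+ 2 <= c ^+ 2 * `|xi| ^+ 2.
  apply: l2_intro => N; apply: le_trans (_ : _ <= c ^+ 2 *
      int_series (fun k => `|xi k| ^+ 2) N) _.
    rewrite !int_seriesE mulr_sumr; apply: ler_sum => k _.
    by rewrite -exprMn ler_pXn2r// ?nnegrE// mulr_ge0.
  by rewrite ler_wpM2l ?exprn_ge0// l2_partial_le.
pose T xi := projT1 (cid (h xi)).
have TP xi : (forall k, T xi k = y k (xi k)) /\
    `|T xi| ^+ 2 <= c ^+ 2 * `|xi| ^+ 2.
  by rewrite /T; case: cid.
exists T; split; last by move=> xi n; case: (TP xi).
apply: (@bounded_op_intro _ _ _ c) => [a xi eta|xi].
  apply: l2_ext => n; rewrite l2_addE l2_scaleE.
  by rewrite !(TP _).1 l2_addE l2_scaleE ly.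
have [_] := TP xi; rewrite -exprMn ler_pXn2r// ?nnegrE//.
by rewrite mulr_ge0.
Qed.

Lemma l2_shift m : exists T : l2 H -> l2 H, bounded_op T /\
  forall xi n, T xi n = xi (n - m).
Proof.
have h xi : exists eta : l2 H, (forall k, eta k = xi (k - m)) /\
    `|eta| ^+ 2 <= `|xi| ^+ 2.
  apply: l2_intro => N; rewrite int_seriesE.
  rewrite -(big_map (fun k => k - m) xpredT (fun k => `|xi k| ^+ 2)).
  rewrite -l2_innerE l2_innerxx; apply: sum_uniq_le_int_series.
  - by move=> k; rewrite exprn_ge0.
  - exact: l2P.
  - by rewrite map_inj_uniq ?block_uniq//; exact: addIr.
pose T xi := projT1 (cid (h xi)).
have TP xi : (forall k, T xi k = xi (k - m)) /\ `|T xi| ^+ 2 <= `|xi| ^+ 2.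
  by rewrite /T; case: cid.
exists T; split; last by move=> xi n; case: (TP xi).
apply: (@bounded_op_intro _ _ _ 1) => [a xi eta|xi].
  apply: l2_ext => n; rewrite l2_addE l2_scaleE.
  by rewrite !(TP _).1 l2_addE l2_scaleE.
by have [_] := TP xi; rewrite mul1r ler_pXn2r// ?nnegrE.
Qed.

End l2_operators.

(** * The center of the crossed product *)

Section crossed_products.
Context {R : realType} {H : hilbertType R}.
Implicit Types (k m n j : int) (x y : H) (xi eta : l2 H) (a b : H -> H).
Variables (N : set (H -> H)) (theta : R -> (H -> H) -> (H -> H)) (t : R).
Hypothesis sys : wstar_system N theta.

Let vN : von_neumann_algebra N := wstar_vna sys.
Let aut u : star_automorphism N (theta u) := wstar_aut sys u.
Let vZ : von_neumann_algebra (vna_center N) := vna_center_vna vN.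

Local Notation alpha := (int_action theta t).
Local Notation gens := (crossed_product_gen N alpha).
Local Notation M := (crossed_product N alpha).

Let alpha0 a : N a -> alpha 0 a = a.
Proof. by move=> Na; rewrite /int_action mulr0z mul0r (wstar_0 sys). Qed.

Let alphaD k m a : N a -> alpha (k + m) a = alpha k (alpha m a).
Proof. by move=> Na; rewrite /int_action intrD mulrDl (wstar_add sys). Qed.

Let N_alpha k a : N a -> N (alpha k a).
Proof. exact: (aut_mem (aut _)). Qed.

(** The generators are described by their values only. That pi(a) maps l2 to itself rests on
    automorphisms not increasing bounds, uniformly in n. *)
Let gen_pi_exists a : N a -> exists T : l2 H -> l2 H, bounded_op T /\
  forall xi n, T xi n = alpha (- n) a (xi n).
Proof.
move=> Na; have [c c0 ac] := bounded_op_bound (vna_bounded vN Na).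
apply: (@l2_diagonal _ _ (fun n => alpha (- n) a) c); first exact: ltW.
  by move=> n; exact: (vna_linear vN (N_alpha _ Na)).
by move=> n; exact: (aut_contract vN (aut _) Na (ltW c0) ac).
Qed.

Let gens_bounded : gens `<=` bounded_op.
Proof.
move=> T [[a Na Ta]|[m Tm]].
  have [S [bS Sa]] := gen_pi_exists Na.
  suff -> : T = S by [].
  by apply/funext => xi; apply: l2_ext => n; rewrite Ta Sa.
have [S [bS Sm]] := @l2_shift R H m.
suff -> : T = S by [].
by apply/funext => xi; apply: l2_ext => n; rewrite Tm Sm.
Qed.

Let gens_adjoint S S' : gens S -> is_adjoint S S' -> gens S'.
Proof.
move=> [[a Na Sa]|[m Sm]] SS'.
  have [a' [aa' Na']] := vna_adjoint_exists vN Na.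
  left; exists a' => // xi n; apply: inner_ext => z.
  rewrite -inner_l2_delta -SS' -(aut_adjoint (aut _) Na aa').
  rewrite -inner_l2_delta; congr inner; apply: l2_ext => k.
  rewrite Sa !l2_deltaE; case: eqP => [->//|_].
  exact: linear_op0 (vna_linear vN (N_alpha _ Na)).
right; exists (- m) => xi n; apply: inner_ext => z.
rewrite opprK -inner_l2_delta -SS' -inner_l2_delta; congr inner.
apply: l2_ext => k; rewrite Sm !l2_deltaE.
by rewrite subr_eq.
Qed.

Let gens_sub : gens `<=` M.
Proof. by move=> T gT A [_ gA]; exact: gA. Qed.

(** The bicommutant is one of the algebras that [smallest] intersects, so elements of the crossed
    product commute with all that commutes with the generators. *)
Let M_sub : M `<=` commutant (commutant gens).
Proof.
move=> T; apply; split; last exact: bicommutant_ge.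
apply: commutant_vna => [S []//|S S']; exact: commutant_adjoint.
Qed.

Let M_scalar : scalar_op `<=` M.
Proof. by move=> _ [c _ <-] A [vA _]; exact: vna_scalar. Qed.

Let scalar_center : scalar_op `<=` vna_center M.
Proof.
move=> T sT; split; first exact: M_scalar.
case: sT => c _ <-; apply: commutant_intro; first exact: bounded_op_scale.
move=> S xi /M_sub[bS _].
by rewrite (linear_opZ (bounded_op_linear bS)).
Qed.

(** The case m = 0, with s in the commutant of N, later places the matrix entries of a central
    element in N; general m accommodates the intertwiners of alpha^m. *)
Let gens_commutant (s : H -> H) m : bounded_op s ->
  (forall a x, N a -> a (s x) = s (alpha m a x)) ->
  exists T : l2 H -> l2 H, commutant gens T /\
    forall xi n, T xi n = s (xi (n - m)).
Proof.
move=> bs ss; have [c c0 sc] := bounded_op_bound bs.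
have [D [bD DE]] := @l2_diagonal R H (fun=> s) c (ltW c0)
  (fun=> bounded_op_linear bs) (fun=> sc).
have [U [bU UE]] := @l2_shift R H m.
exists (D \o U); split; last by move=> xi n /=; rewrite DE UE.
apply: commutant_intro; first exact: bounded_op_comp.
move=> S xi gS; apply: l2_ext => n; rewrite /= DE UE.
case: gS => [[a Na Sa]|[j Sj]].
  rewrite !Sa DE UE ss; last exact: N_alpha.
  by rewrite -alphaD// opprB addrC.
by rewrite !Sj DE UE addrAC.
Qed.

Lemma crossed_product_not_factor b : vna_center N b ->
  (forall k, alpha k b = b) -> ~ scalar_op b -> ~ is_factor M.
Proof.
move=> Zb bfix nb fM; apply: nb; have Nb := center_sub Zb.
have [T [bT TE]] := gen_pi_exists Nb.
have gT : gens T by left; exists b.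
have [c _ Tc] : scalar_op T.
  rewrite -fM; split; first exact: gens_sub.
  apply: commutant_intro => // S xi MS.
  (* As [b] is fixed, [T] is diagonal with constant entry [b]: it commutes with translations, and
     with each pi(a) because [b] is central. *)
  have gT' : commutant gens T.
    apply: commutant_intro => // S' eta [[a Na Sa]|[m Sm]]; apply: l2_ext => n.
      by rewrite !TE !Sa !TE !bfix (center_comm _ Zb (N_alpha _ Na)).
    by rewrite !TE !Sm !TE !bfix.
  by have [_ h] := M_sub MS; have := h _ gT' => /(congr1 (@^~ xi)).
exists c => //; apply/funext => x.
have := congr1 (fun f : l2 H -> l2 H => f (l2_delta 0 x) 0) Tc.
by rewrite TE l2_scaleE !l2_deltaE eqxx bfix.
Qed.

Lemma crossed_product_factor :
  centrally_ergodic N alpha ->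
  (forall k w, k != 0 -> vna_center N w -> pos_op w ->
     (forall z x, vna_center N z -> w (alpha k z x) = w (z x)) -> w = 0) ->
  is_factor M.
Proof.
move=> erg free; rewrite /is_factor eqEsubset; split; last exact: scalar_center.
move=> T [MT [bT TM]]; have lT := bounded_op_linear bT.
have Tgen S xi : gens S -> T (S xi) = S (T xi).
  by move=> /gens_sub/TM/(congr1 (@^~ xi)).
have Tcom S xi : commutant gens S -> T (S xi) = S (T xi).
  move=> gS; have [_ h] := M_sub MT.
  by have := h _ gS => /(congr1 (@^~ xi)).
(* The matrix entry of [T] in row k and column 0; commutation with translations determines the other
   columns. *)
pose tau k x := T (l2_delta 0 x) k.
have Tdelta m x k : T (l2_delta m x) k = tau (k - m) x.
  have [U [bU UE]] := @l2_shift R H m.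
  have -> : l2_delta m x = U (l2_delta 0 x).
    by apply: l2_ext => n; rewrite UE !l2_deltaE subr_eq0.
  by rewrite Tgen ?UE//; right; exists m.
have Ntau k : N (tau k).
  apply: (vna_mem vN) => [|S x NS].
    have [c c0 Tc] := bounded_op_bound bT.
    apply: (@bounded_op_intro _ _ _ c) => [l x y|x].
      by rewrite /tau l2_deltaD lT l2_addE l2_scaleE.
    by apply: le_trans (l2_norm_coord _ _) _; rewrite -(l2_delta_norm 0 x) Tc.
  have [bS _] := NS.
  have [|D [gD DE]] := @gens_commutant S 0 bS.
    by move=> a y Na; rewrite alpha0// (vna_comm _ Na NS).
  rewrite /tau; have -> : l2_delta 0 (S x) = D (l2_delta 0 x).
    apply: l2_ext => n; rewrite DE subr0 !l2_deltaE; case: eqP => // _.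
    by rewrite (linear_op0 (bounded_op_linear bS)).
  by rewrite Tcom// DE subr0.
have tau_alpha k a x : N a -> tau k (a x) = alpha (- k) a (tau k x).
  move=> Na; have [P [bP PE]] := gen_pi_exists Na.
  rewrite /tau; have -> : l2_delta 0 (a x) = P (l2_delta 0 x).
    apply: l2_ext => n; rewrite PE !l2_deltaE; case: eqP => [->|_].
      by rewrite oppr0 alpha0.
    by rewrite (linear_op0 (vna_linear vN (N_alpha _ Na))).
  by rewrite Tgen ?PE//; left; exists a.
have tau0 k : k != 0 -> tau k = 0.
  move=> k0; have [tk' [tt' Nt']] := vna_adjoint_exists vN (Ntau k).
  pose w := tk' \o tau k.
  have Nw : N w by exact: vna_comp.
  (* tau_k S = alpha^(-k)(S) tau_k and its adjoint relation give w S = tau_k^* alpha^(-k)(S) tau_k =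
     S w. *)
  have Zw : vna_center N w.
    apply: (center_intro vN Nw) => S x NS.
    rewrite /w/= tau_alpha//; apply: inner_ext => z.
    have [S' [SS' NS']] := vna_adjoint_exists vN NS.
    rewrite -tt' -(adjoint_sym (aut_adjoint (aut _) NS SS')).
    by rewrite -/(alpha (- k) S') -tau_alpha// tt' (adjoint_sym SS').
  have pw : pos_op w by exact: pos_op_adjoint.
  have w0 : w = 0.
    apply: (free (- k)) => //; first by rewrite oppr_eq0.
    (* alpha^(-k)(z) is central and so moves past tau_k: w alpha^(-k)(z) = tau_k^* alpha^(-k)(z)
       tau_k = w z. *)
    move=> z x Zz.
    have Nz : N (alpha (- k) z) by apply: N_alpha; exact: center_sub.
    have Zaz : vna_center N (alpha (- k) z) by exact: (aut_center vN (aut _)).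
    rewrite /w/= -(center_comm _ Zaz (Ntau k)) -tau_alpha//.
    exact: center_sub.
  apply/funext => x; apply: inner_eq0.
  by rewrite tt' -[tk' _]/(w x) w0 inner0r.
have tau_center : vna_center N (tau 0).
  apply: (center_intro vN (Ntau 0)) => S x NS.
  by rewrite tau_alpha// oppr0 alpha0.
have TE xi n : T xi n = tau 0 (xi n).
  have [T' TT'] := adjoint_exists bT.
  have [s [st _]] := vna_adjoint_exists vN (Ntau 0).
  (* The coordinates of T xi are inner products of [xi] with T^* applied to deltas, which avoids
     expanding [xi] as an infinite sum. *)
  have T'delta z : T' (l2_delta n z) = l2_delta n (s z).
    apply: l2_ext => k; apply: inner_ext => z'.
    rewrite -inner_l2_delta -TT' innerC inner_l2_delta Tdelta l2_deltaE.
    case: eqP => [->|/eqP kn]; first by rewrite subrr -innerC st.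
    by rewrite tau0 ?subr_eq0 1?eq_sym// op0E !inner0r rmorph0.
  apply: inner_ext => z; rewrite -inner_l2_delta -(adjoint_sym TT') T'delta.
  by rewrite inner_l2_delta (adjoint_sym st).
have tau_fixed j : alpha j (tau 0) = tau 0.
  apply/eqP; rewrite -subr_eq0; apply/eqP; apply: contrapT => d0.
  have Zd : vna_center N (alpha j (tau 0) - tau 0).
    by apply: (vnaB vZ) => //; exact: (aut_center vN (aut _)).
  have [s [bs ss [x sx]]] := aut_intertwiner vN (aut (j%:~R * t))
    (aut (- (j%:~R * t))) (@thetaK _ _ _ _ sys (j%:~R * t)) Zd d0.
  have [S [gS SE]] := @gens_commutant s j bs ss.
  apply: sx; rewrite opBE (linear_opB (bounded_op_linear bs)).
  apply/eqP; rewrite subr_eq0; apply/eqP; rewrite -/(alpha j _) -ss//.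
  (* Coordinate j of T S = S T on a delta at 0 reads tau_0 s x = s tau_0 x, while the intertwining
     relation reads tau_0 s x = s alpha^j(tau_0) x. *)
  have := congr1 (fun f : l2 H => f j) (Tcom _ (l2_delta 0 x) gS).
  by rewrite TE !SE TE subrr l2_deltaE eqxx.
have [c _ tc] : scalar_op (tau 0) by rewrite -erg.
exists c => //; apply/funext => xi; apply: l2_ext => n.
by rewrite TE -tc.
Qed.

End crossed_products.

(** * Nonergodicity, nonfactoriality and rational multiples of eigenvalues *)

Unset Implicit Arguments.

Theorem theorem1p4 (R : realType) (H : hilbertType R) (N : set (H -> H))
    (theta : R -> (H -> H) -> (H -> H)) (t : R) :
  wstar_system N theta ->
  centrally_ergodic N theta ->
  ~ is_factor N ->
  t != 0 ->
  (~ centrally_ergodic N (int_action theta t) <->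
   ~ is_factor (crossed_product N (int_action theta t))) /\
  (~ is_factor (crossed_product N (int_action theta t)) <->
   exists (r : rat) (s : R),
     eigenvalues (vna_center N) theta s /\ ratr r * s * t = 2 * pi).
Proof.
move=> sys erg nfac t0.
have vN := wstar_vna sys; have vZ := vna_center_vna vN.
have fixed_scalar b : scalar_op b -> fixed_points (vna_center N)
    (int_action theta t) b.
  case=> c _ <-; split; first exact: vna_scalar.
  by move=> k; exact: (aut_scalar vN (wstar_aut sys _)).
have not_ergodic : ~ centrally_ergodic N (int_action theta t) ->
    exists b, [/\ vna_center N b, forall k, int_action theta t k b = b &
      ~ scalar_op b].
  move=> ne; apply: contrapT => h; apply: ne.
  rewrite /centrally_ergodic /ergodic eqEsubset; split=> // b [Zb fb].
  by apply: contrapT => nb; apply: h; exists b.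
have one_three : ~ centrally_ergodic N (int_action theta t) ->
    exists (r : rat) (s : R),
      eigenvalues (vna_center N) theta s /\ ratr r * s * t = 2 * pi.
  move=> /not_ergodic[b [Zb fb nb]].
  have tb : theta t b = b by have := fb 1; rewrite /int_action mulr1z mul1r.
  have [m [s [m0 Es st]]] := flow_eigenvector sys erg t0 Zb tb nb.
  exists (m%:~R^-1), s; split=> //.
  rewrite fmorphV/= ratr_int -mulrA st mulrCA mulVf ?mulr1//.
  by rewrite intr_eq0.
have three_one : (exists (r : rat) (s : R),
      eigenvalues (vna_center N) theta s /\ ratr r * s * t = 2 * pi) ->
    ~ centrally_ergodic N (int_action theta t).
  move=> [r [s [Es rst]]] erg'.
  have pi0 : 2 * pi != 0 :> R by rewrite mulf_neq0 ?pnatr_eq0// gt_eqF// pi_gt0.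
  have s0 : s != 0.
    by apply/eqP => s0; move: pi0; rewrite -rst s0 mulr0 mul0r eqxx.
  have r0 : r != 0.
    by apply/eqP => r0; move: pi0; rewrite -rst r0 raddf0 !mul0r eqxx.
  have d0 : (denq r)%:~R != 0 :> R by rewrite intr_eq0 denq_neq0.
  have stp : s * t * (numq r)%:~R = 2 * pi * (denq r)%:~R.
    by rewrite -rst /ratr; field.
  have [n [q [n0 nq]]] : exists (n : nat) (q : int), (0 < n)%N /\
      s * t * n%:R = 2 * pi * q%:~R.
    have : numq r != 0 by rewrite numq_eq0.
    (* A negative numerator is made positive by giving its sign to the denominator. *)
    case: (numq r) stp => p stp p0.
      by exists p, (denq r); rewrite lt0n.
    exists p.+1, (- denq r); split=> //; rewrite mulrNz mulrN -stp NegzE mulrNz.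
    by rewrite mulrN opprK.
  have [b [Zb fb nb]] := eigenvalue_not_ergodic sys erg Es s0 n0 nq.
  by apply: nb; rewrite -erg'; split.
have one_two : ~ centrally_ergodic N (int_action theta t) <->
    ~ is_factor (crossed_product N (int_action theta t)).
  split=> [/not_ergodic[b [Zb fb nb]]|nf erg'].
    exact: crossed_product_not_factor fb nb.
  apply: nf; apply: crossed_product_factor => // k w k0 Zw pw wz.
  have [//|triv] := flow_free sys erg Zw pw wz.
  have kt0 : k%:~R * t != 0 by rewrite mulf_neq0// intr_eq0.
  (* As N is not a factor, its center has a nonscalar element; triviality of theta_{k t} on the
     center makes it periodic. *)
  have [a [Za na]] : exists a, vna_center N a /\ ~ scalar_op a.
    apply: contrapT => h; apply: nfac; rewrite /is_factor eqEsubset; split=> b.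
      by move=> Zb; apply: contrapT => nb; apply: h; exists b.
    by move=> /fixed_scalar[].
  have [m [s [m0 Es st]]] := flow_eigenvector sys erg kt0 Za (triv a Za) na.
  (* The eigenvalue satisfies s k t = 2 pi m with m nonzero, so k / m is the required rational. *)
  exfalso; apply: three_one erg'; exists (k%:~R / m%:~R), s; split=> //.
  rewrite fmorph_div/= !ratr_int.
  have mR : m%:~R != 0 :> R by rewrite intr_eq0.
  apply: (mulIf mR); rewrite -st; field.
  by rewrite mR.
split=> //; split=> [/one_two|/three_one /one_two//]; exact: one_three.
Qed.
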